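(* Let $n\ge 2$ and $r(z,\overline z)=\sum_{j=1}^n|z_j|^2-|z_{n+1}|^2$. For non-negative integers $A,B$ let $\mathcal{H}(n;A,B)\cap I(r)$ denote the collection of Hermitian symmetric bihomogeneous polynomials (in $z\in\mathbf{C}^{n+1}$ and $\overline z$) divisible by $r$ and with signature pair $(A,B)$. Put $M=2(2n^2-n)$. Then the following hold: \begin{itemize} \item $\mathcal{H}(n;0,0)\cap I(r)=\{0\}$. \item If $A=0$ or $B=0$ but not both are $0$, then $\mathcal{H}(n;A,B)\cap I(r)$ is empty. \item $\mathcal{H}(n;A,1)\cap I(r)$ is empty for $A<n$, and $\mathcal{H}(n;1,B)\cap I(r)$ is empty for $B<n$. \item If $A=1$ and $B\ge M-1$, or if $B=1$ and $A\ge M-1$, then $\mathcal{H}(n;A,B)\cap I(r)$ is non-empty, but $\mathcal{D}^*\left(\mathcal{H}(n;A,B)\cap I(r)\right)$ is finite. \item If $A+B\ge M$ and $A,B\ge 2$, then $\mathcal{H}(n;A,B)\cap I(r)$ is non-empty and $\mathcal{D}^*\left(\mathcal{H}(n;A,B)\cap I(r)\right)$ is infinite. \end{itemize}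
   Context: A Hermitian symmetric polynomial on $\mathbf{C}^{N}$ is a polynomial $p(z,\overline{w})=\sum c_{\alpha\beta}z^\alpha\overline{w}^\beta$ with Hermitian coefficient matrix $(c_{\alpha\beta})$, identified with the real-valued function $p(z,\overline z)$. Its signature pair is $\mathbf{s}(p)=(A,B)$ if the coefficient matrix has $A$ positive and $B$ negative eigenvalues. It is bihomogeneous of degree $(m,m)$ if it is homogeneous of degree $m$ in $z$ and of degree $m$ in $\overline{z}$; in the sets above the degree $m$ is arbitrary. Two Hermitian symmetric polynomials $p,q$ are equivalent, $p\sim q$, if $|u(z)|^2p(z,\overline z)=|v(z)|^2q(z,\overline z)$ for some nonzero holomorphic polynomials $u,v$. The projective degree $\mathcal{D}(p)$ of a bihomogeneous $p$ is the smallest $m$ such that there is a bihomogeneous polynomial of degree $(m,m)$ equivalent to $p$. For a non-empty set $S$ of such polynomials, $\mathcal{D}^*(S)=\sup_{p\in S}\mathcal{D}(p)$. *)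

(* Defs.v *)
From mathcomp Require Import all_boot all_order all_algebra.
From mathcomp Require Import mpoly complex.
From mathcomp Require Import boolp classical_sets constructive_ereal reals ereal.

Set Implicit Arguments.
Unset Strict Implicit.
Unset Printing Implicit Defensive.

Import Order.TTheory GRing.Theory Num.Theory.

Local Open Scope ring_scope.
Local Open Scope classical_set_scope.

(* A polynomial p(z, w^bar) on C^N x C^N is an element of
   {mpoly R[i][N + N]}: the first N variables are z, the last N are w^bar. *)
Notation hpoly R N := {mpoly (R[i])[N + N]}.

(* The exponent of z^a w^bar^b *)
Definition mnm_pair (N : nat) (a b : 'X_{1..N}) : 'X_{1..N + N} :=
  [multinom (match split i with inl j => a j | inr j => b j end) | i < N + N].

Definition hcoef (R : realType) (N : nat) (p : hpoly R N)
    (a b : 'X_{1..N}) : R[i] :=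
  mcoeff (mnm_pair a b) p.

(* The value p(z, z^bar) *)
Definition heval (R : realType) (N : nat) (p : hpoly R N)
    (z : 'I_N -> R[i]) : R[i] :=
  meval (fun i => match split i with inl j => z j | inr j => (z j)^* end) p.

Definition hermitian_symmetric (R : realType) (N : nat) (p : hpoly R N) : Prop :=
  forall a b : 'X_{1..N}, hcoef p b a = (hcoef p a b)^*.

(* With this definition 0 is bihomogeneous of every degree. *)
Definition bihomogeneous (R : realType) (N d : nat) (p : hpoly R N) : Prop :=
  forall a b : 'X_{1..N}, hcoef p a b != 0 -> mdeg a = d /\ mdeg b = d.

(* The coefficient matrix (c_{a b}), indexed by the multi-indices of degree at
   most the total degree of p.  All coefficients outside of this range vanish,
   and rows and columns of zeros do not affect the nonzero eigenvalues. *)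
Definition coef_matrix (R : realType) (N : nat) (p : hpoly R N) :
    'M[R[i]]_#|{: 'X_{1..N < msize p}}| :=
  \matrix_(i, j) hcoef p
    (enum_val i : 'X_{1..N < msize p}) (enum_val j : 'X_{1..N < msize p}).

(* The eigenvalues, listed with (algebraic) multiplicity *)
Definition eigenvalues (R : realType) (k : nat) (M : 'M[R[i]]_k) : seq R[i] :=
  sval (closed_field_poly_normal (char_poly M)).

(* For x : R[i], 0 < x (resp. x < 0) says that x is a positive (resp. negative)
   real number. *)
Definition signature_pair (R : realType) (N : nat) (p : hpoly R N) : nat * nat :=
  (count (fun x => 0 < x) (eigenvalues (coef_matrix p)),
   count (fun x => x < 0) (eigenvalues (coef_matrix p))).

Definition hequiv (R : realType) (N : nat) (p q : hpoly R N) : Prop :=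
  exists u v : {mpoly (R[i])[N]},
    [/\ u != 0, v != 0 &
        forall z : 'I_N -> R[i],
          `|meval z u| ^+ 2 * heval p z = `|meval z v| ^+ 2 * heval q z].

Definition bihom_equiv_degree (R : realType) (N : nat) (p : hpoly R N) : set nat :=
  [set m | exists q : hpoly R N,
     [/\ hermitian_symmetric q, bihomogeneous m q & hequiv p q]].

(* The least element of bihom_equiv_degree p; by projective_degreeP below the
   default value 0 is irrelevant when p is bihomogeneous. *)
Definition projective_degree (R : realType) (N : nat) (p : hpoly R N) : nat :=
  xget 0%N [set m | bihom_equiv_degree p m /\
                    forall k, bihom_equiv_degree p k -> (m <= k)%N].

Definition sup_projective_degree (R : realType) (N : nat) (S : set (hpoly R N)) :
    \bar R :=
  ereal_sup [set ((projective_degree p)%:R)%:E | p in S].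

(* The collection H(n; A, B), in the variables z_1, ..., z_{n+1} *)
Definition Hset (R : realType) (n A B : nat) : set (hpoly R n.+1) :=
  [set p | [/\ hermitian_symmetric p,
               exists m : nat, bihomogeneous m p &
               signature_pair p = (A, B)]].

(* r = |z_1|^2 + ... + |z_n|^2 - |z_{n+1}|^2 *)
Definition rpoly (R : realType) (n : nat) : hpoly R n.+1 :=
  \sum_(j < n) 'X_(lshift n.+1 (widen_ord (leqnSn n) j)) *
               'X_(rshift n.+1 (widen_ord (leqnSn n) j))
  - 'X_(lshift n.+1 ord_max) * 'X_(rshift n.+1 ord_max).

(* The Hermitian symmetric multiples of f.  No symmetry is asked of the
   quotient: when f != 0 is Hermitian symmetric, it is automatic. *)
Definition Iset (R : realType) (N : nat) (f : hpoly R N) :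
    set (hpoly R N) :=
  [set p | hermitian_symmetric p /\
           exists q : hpoly R N, p = f * q].

Lemma projective_degreeP (R : realType) (N m : nat) (p : hpoly R N) :
  hermitian_symmetric p -> bihomogeneous m p ->
  bihom_equiv_degree p (projective_degree p) /\
  forall k, bihom_equiv_degree p k -> (projective_degree p <= k)%N.
Proof.
move=> hp hm.
have ex : exists k, `[< bihom_equiv_degree p k >].
  exists m; apply/asboolP; exists p; split=> //.
  by exists 1, 1; rewrite oner_neq0.
case: (ex_minnP ex) => k /asboolP kP kmin.
rewrite /projective_degree; case: xgetP => [l _ [lP lmin] //|/(_ k)[]].
by split=> // j /asboolP; exact: kmin.
Qed.

(* Main.v *)
(* Write a bihomogeneous p as sum_k lam_k |F_k|^2 with A positive and B negative lam_k,
   and p(z, w) for its polarization. If r divides p, then F(z) is orthogonal to the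
   reflected vector G(w) = (lam_k conj(F_k)(Jw))_k whenever z.w = 0.

   Definite case: F vanishes on the null cone of r, which is dense enough to give F = 0.

   Rank: at dual bases (z_i), (w_j) in general position the matrix of values of p is
   diagonal and invertible, hence A + B >= n + 1.

   One positive or one negative eigenvalue: let GG be the set of all G with
   F(z).G(w) = 0 for z.w = 0. A vector U(z) orthogonal to all G(w), z.w = 0, G in GG,
   spans with F(z) an isotropic subspace for z on the null cone, so that U is parallel to
   F. The jets at w, along z^perp, of order at most A + B of the elements of GG already
   determine F(z) up to a factor: the stationary rank turns them into a linear
   differential system. As w may be kept fixed while z runs through a line in w^perp,
   F is parallel on each line to a vector of degree at most (A + B)^2. Pade approximation
   makes this global: F is parallel to a polynomial vector V whose degree is bounded in
   terms of A + B, and p is equivalent to sum_k lam_k |V_k|^2.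

   Existence: the substitution x_j = |z_j|^2 reduces the signature of a polynomial in
   x to its numbers of positive and negative coefficients. From a multiple c of
   s = x_1 + ... + x_n - x_{n+1} of degree d one gets others by x_{n+1} c + a x_1^d s.

   Infinite projective degree: if x_j^d and x_k^d both occur in c, then
   the polynomial with |z_j|^2 in place of x_j has projective degree at least d. *)

From HB Require Import structures.
Require Import Defs.
From mathcomp Require Import all_boot all_order all_algebra.
From mathcomp Require Import mpoly complex ring lra zify.
From mathcomp Require Import boolp classical_sets constructive_ereal reals ereal.

Set Implicit Arguments.
Unset Strict Implicit.
Unset Printing Implicit Defensive.

Import Order.TTheory GRing.Theory Num.Theory.

Local Open Scope ring_scope.

(** * Polynomials restricted to lines and curves *)

(** The obstacle to finiteness is that the degree of p is not controlled by K = A + B, so every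
    bound has to come from ranks. Jets are vectors of length K, hence their rank stops growing at
    some order at most K. Minors of size at most K of jets of order at most K have degree at most K
    K in z: this is the degree D reached on lines. The Pade system has K (D + 1) unknowns and
    entries of degree at most 2 D in the direction x, since the coefficient of s^l in F(b + s x) has
    degree at most l in x whatever the degree of F. Its kernel vector has degree at most K (D + 1) 2
    D.

    GG contains all G orthogonal to F, and not just the reflection of F, because a vector U
    orthogonal to GG must itself reflect into GG: only then is the span of F(z) and U(z) isotropic.

    For existence, the moves add n or n - 1 positive coefficients, and every integer from (n - 1)(n
    - 2) on is a sum of such steps. Only the larger of A and B is known to be large, so M is
    compared with twice the resulting threshold. *)

Section PolyIdentity.
Variable C : numFieldType.

Lemma poly_eq0_nat (q : {poly C}) : (forall k : nat, q.[k%:R] = 0) -> q = 0.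
Proof.
move=> q0; apply/eqP/negPn/negP => qn0.
pose rs := [seq k%:R : C | k <- iota 0 (size q)].
have := max_poly_roots qn0 (rs := rs).
rewrite size_map size_iota ltnn => H; suff: false by []; apply: H.
  by apply/allP => _ /mapP[k _ ->]; apply/rootP.
by rewrite map_inj_uniq ?iota_uniq // => a b /eqP; rewrite eqr_nat => /eqP.
Qed.

(** The form in which exceptional parameters are discarded below: [q1] is typically a minor, and
    [q1 * q2] vanishes everywhere. *)
Lemma poly_eq0_generic (q1 q2 : {poly C}) :
  q1 != 0 -> (forall t, q1.[t] != 0 -> q2.[t] = 0) -> q2 = 0.
Proof.
move=> q1n0 H; have /eqP : q1 * q2 = 0.
  apply: poly_eq0_nat => k; rewrite hornerM.
  by have [->|/H ->] := eqVneq q1.[k%:R] 0; rewrite (mul0r, mulr0).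
by rewrite mulf_eq0 (negPf q1n0) => /eqP.
Qed.

End PolyIdentity.

Section MMap.

Lemma eq_mmap (n : nat) (R S : nzRingType) (f1 f2 : R -> S) (h1 h2 : 'I_n -> S)
    (p : {mpoly R[n]}) : f1 =1 f2 -> h1 =1 h2 -> mmap f1 h1 p = mmap f2 h2 p.
Proof.
move=> ef eh; apply: eq_bigr => m _; rewrite ef; congr (_ * _).
by apply: eq_bigr => i _; rewrite eh.
Qed.

Lemma rmorph_mmap (n : nat) (R S T : nzRingType) (f : {rmorphism R -> S})
    (g : {rmorphism S -> T}) (h : 'I_n -> S) (p : {mpoly R[n]}) :
  g (mmap f h p) = mmap (g \o f) (g \o h) p.
Proof.
rewrite /mmap rmorph_sum; apply: eq_bigr => m _.
rewrite rmorphM rmorph_prod; congr (_ * _).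
by apply: eq_bigr => i _; rewrite rmorphXn.
Qed.

Lemma horner_mmap (n : nat) (R : comNzRingType) (h : 'I_n -> {poly R})
    (p : {mpoly R[n]}) (t : R) :
  (mmap (@polyC R) h p).[t] = p.@[fun i => (h i).[t]].
Proof.
rewrite -/(horner_eval t _) (rmorph_mmap (@polyC R) (horner_eval t)).
by apply: eq_mmap => // c; rewrite /= /horner_eval hornerC.
Qed.

Lemma meval_mmap (n k : nat) (R : comNzRingType) (h : 'I_n -> {mpoly R[k]})
    (p : {mpoly R[n]}) (v : 'I_k -> R) :
  (mmap (@mpolyC k R) h p).@[v] = p.@[fun i => (h i).@[v]].
Proof.
rewrite (rmorph_mmap (@mpolyC k R) (meval v)).
by apply: eq_mmap => // c; rewrite /= mevalC.
Qed.

Lemma meval_sum (n : nat) (R : nzRingType) (I : Type) (r : seq I) (Q : pred I)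
    (f : I -> {mpoly R[n]}) (v : 'I_n -> R) :
  (\sum_(i <- r | Q i) f i).@[v] = \sum_(i <- r | Q i) (f i).@[v].
Proof. exact: (raddf_sum (meval v)). Qed.

(* [P k x] reads: x has degree at most k. *)
Record filtration (S : comNzRingType) (P : nat -> S -> Prop) : Prop := Filtration {
  filt_le : forall a b x, (a <= b)%N -> P a x -> P b x;
  filt0 : forall a, P a 0;
  filt1 : P 0%N 1;
  filtN : forall a x, P a x -> P a (- x);
  filtD : forall a x y, P a x -> P a y -> P a (x + y);
  filtM : forall a b x y, P a x -> P b y -> P (a + b)%N (x * y) }.

Lemma filt_sum (S : comNzRingType) (P : nat -> S -> Prop) (I : Type) (r : seq I)
    (Q : pred I) (f : I -> S) k :
  filtration P -> (forall i, Q i -> P k (f i)) -> P k (\sum_(i <- r | Q i) f i).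
Proof.
by move=> fP Pf; elim/big_ind: _ => //; [exact: filt0|exact: filtD].
Qed.

Lemma filt_prod (S : comNzRingType) (P : nat -> S -> Prop) (I : finType)
    (f : I -> S) (e : I -> nat) :
  filtration P -> (forall i, P (e i) (f i)) -> P (\sum_i e i)%N (\prod_i f i).
Proof.
move=> fP Pf; elim/big_ind2: _ => //; first exact: filt1.
by move=> *; exact: filtM.
Qed.

Lemma mmap_filtration (n : nat) (R : nzRingType) (S : comNzRingType)
    (P : nat -> S -> Prop) (f : R -> S) (h : 'I_n -> S) (p : {mpoly R[n]}) (k : nat) :
  filtration P -> (forall c, P 0%N (f c)) -> (forall i, P 1%N (h i)) ->
  (msize p <= k.+1)%N -> P k (mmap f h p).
Proof.
move=> fP Pf Ph pk; rewrite /mmap big_seq.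
apply: (filt_sum _ fP) => m mp.
apply: (filt_le fP (a := 0 + mdeg m)%N).
  by rewrite add0n -ltnS (leq_trans (msize_mdeg_lt mp)).
apply: (filtM fP) => //; rewrite /mmap1 mdegE; apply: (filt_prod fP) => i.
elim: (m i) => [|j IH]; first by rewrite expr0; exact: filt1.
by rewrite exprS -add1n; apply: filtM.
Qed.

Lemma filt_sign (S : comNzRingType) (P : nat -> S -> Prop) (m : nat) :
  filtration P -> P 0%N ((-1) ^+ m).
Proof.
move=> fP; rewrite -signr_odd; case: odd; last exact: filt1.
by rewrite expr1; apply: filtN => //; exact: filt1.
Qed.

Lemma filt_det (S : comNzRingType) (P : nat -> S -> Prop) (k r : nat) (M : 'M[S]_r) :
  filtration P -> (forall i j, P k (M i j)) -> P (r * k)%N (\det M).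
Proof.
move=> fP PM; apply: (filt_sum _ fP) => s _; rewrite -[(r * k)%N]add0n.
apply: (filtM fP); first exact: filt_sign.
rewrite -[in (r * k)%N](card_ord r) -sum_nat_const; exact: (filt_prod fP).
Qed.

Lemma poly_filtration (R : idomainType) :
  filtration (fun k (q : {poly R}) => size q <= k.+1)%N.
Proof.
split.
- by move=> a b x ab /leq_trans; apply.
- by move=> a; rewrite size_poly0.
- by rewrite size_poly1.
- by move=> a x; rewrite size_polyN.
- by move=> a x y xa ya; rewrite (leq_trans (size_polyD _ _)) // geq_max xa ya.
- move=> a b x y xa yb; apply: leq_trans (size_polyMleq _ _) _.
  by rewrite -subn1 leq_subLR add1n -addnS -addSn leq_add.
Qed.

Lemma mpoly_filtration (n : nat) (R : idomainType) :
  filtration (fun k (q : {mpoly R[n]}) => msize q <= k.+1)%N.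
Proof.
split.
- by move=> a b x ab /leq_trans; apply.
- by move=> a; rewrite msize0.
- by rewrite msize1.
- by move=> a x; rewrite msizeN.
- by move=> a x y xa ya; rewrite (leq_trans (msizeD_le _ _)) // geq_max xa ya.
- move=> a b x y xa yb; have [->|xn0] := eqVneq x 0; first by rewrite mul0r msize0.
  have [->|yn0] := eqVneq y 0; first by rewrite mulr0 msize0.
  rewrite msizeM // -subn1 leq_subLR add1n -addnS -addSn leq_add //.
Qed.

End MMap.

(** * Zero tests for multivariate polynomials *)

Section Kronecker.
Variables (C : numFieldType) (n : nat).

Lemma digits_inj (D k : nat) (a b : nat -> nat) :
  (forall i, a i < D)%N -> (forall i, b i < D)%N ->
  (\sum_(i < k) a i * D ^ i = \sum_(i < k) b i * D ^ i)%N ->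
  forall i, (i < k)%N -> a i = b i.
Proof.
elim: k a b => [//|k IH] a b aD bD.
rewrite !big_ord_recl /= !expn0 !muln1.
have E (c : nat -> nat) : (\sum_(i < k) c (bump 0 i) * D ^ bump 0 i =
    D * \sum_(i < k) c i.+1 * D ^ i)%N.
  by rewrite big_distrr; apply: eq_bigr => i _; rewrite /bump /= add1n expnS mulnCA.
rewrite !E => H.
have Dgt0 : (0 < D)%N by apply: leq_ltn_trans (aD 0%N).
have ab0 : a 0%N = b 0%N.
  have := congr1 (modn^~ D) H.
  by rewrite ![(_ + D * _)%N]addnC ![(D * _)%N]mulnC !modnMDl !modn_small.
move: H => /eqP; rewrite ab0 eqn_add2l eqn_pmul2l // => /eqP H.
by case=> [|i] // ik; apply: (IH (a \o S) (b \o S)) => // j; rewrite /= ?aD ?bD.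
Qed.

(** [D] exceeds every exponent in [p], so by uniqueness of base [D] expansions distinct monomials go
    to distinct powers of t and nothing cancels. *)
Lemma kronecker (p : {mpoly C[n]}) : p != 0 ->
  exists (D : nat) (q : {poly C}),
    q != 0 /\ forall t, q.[t] = p.@[fun i => t ^+ (D ^ i)].
Proof.
move=> pn0; pose D := msize p; exists D.
pose e (m : 'X_{1..n}) := (\sum_(i < n) m i * D ^ i)%N.
exists (mmap (@polyC C) (fun i : 'I_n => 'X^(D ^ i)) p); split; last first.
  by move=> t; rewrite horner_mmap; apply: meval_eq => i; rewrite hornerXn.
have mE (m : 'X_{1..n}) : mmap1 (fun i : 'I_n => 'X^(D ^ i)) m = 'X^(e m) :> {poly C}.
  rewrite /mmap1 /e; elim/big_rec2: _ => [|i y1 y2 _ ->]; first by rewrite expr0.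
  by rewrite -exprM exprD mulnC.
have [m mp] : exists m, m \in msupp p.
  by exists (mlead p); apply: mlead_supp.
apply/eqP => /(congr1 (fun q : {poly C} => q`_(e m))).
rewrite coef0 /mmap coef_sum (bigD1_seq m) ?msupp_uniq //= big1_seq => [|m' /andP[m'm m'p]].
  by rewrite mE coefCM coefXn eqxx mulr1 addr0 => /eqP; apply/negP; rewrite -mcoeff_msupp.
rewrite mE coefCM coefXn; case: eqP => [emm'|]; last by rewrite mulr0.
case/eqP: m'm; apply/mnmP => i.
pose dg (m0 : 'X_{1..n}) (j : nat) := oapp m0 0%N (insub j : option 'I_n).
have dgE (m0 : 'X_{1..n}) (j : 'I_n) : dg m0 j = m0 j by rewrite /dg valK.
have mD (m0 : 'X_{1..n}) j : m0 \in msupp p -> (dg m0 j < D)%N.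
  move=> m0p; have m0D := msize_mdeg_lt m0p.
  rewrite /dg; case: insubP => [j' _ _|_] /=; last exact: leq_ltn_trans m0D.
  by apply: leq_ltn_trans m0D; rewrite mdegE (bigD1 j') //= leq_addr.
rewrite -!dgE; apply: (digits_inj (D := D) (k := n) (a := dg m') (b := dg m)) => // [j|j|];
  [exact: mD|exact: mD|].
transitivity (e m'); first by apply: eq_bigr => l _; rewrite dgE.
by rewrite -emm'; apply: eq_bigr => l _; rewrite dgE.
Qed.

(** All coordinates are powers of one [ts k], so the test points can be kept in a prescribed set:
    natural numbers give the real points of the polarization argument, points of the unit circle
    give points of the null cone. *)
Lemma mpoly_nonzero (p : {mpoly C[n]}) (ts : nat -> C) : injective ts -> p != 0 ->
  exists (k : nat) (e : 'I_n -> nat), p.@[fun i => ts k ^+ e i] != 0.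
Proof.
move=> ts_inj /kronecker[D [q [qn0 qE]]].
apply: contrapT => H.
pose rs := [seq ts k | k <- iota 0 (size q)].
have := max_poly_roots qn0 (rs := rs).
rewrite size_map size_iota ltnn => H'; suff: false by []; apply: H'.
  apply/allP => _ /mapP[k _ ->]; apply/rootP; rewrite qE.
  by apply/eqP/negPn/negP => ne; apply: H; exists k, (fun i => D ^ i)%N.
by rewrite map_inj_uniq ?iota_uniq.
Qed.

Lemma natr_inj : injective (fun k : nat => k%:R : C).
Proof. by move=> a b /eqP; rewrite eqr_nat => /eqP. Qed.

Lemma mpoly_eq0 (p : {mpoly C[n]}) : (forall v, p.@[v] = 0) -> p = 0.
Proof.
move=> p0; apply/eqP/negPn/negP => /(mpoly_nonzero natr_inj)[k [e]].
by rewrite p0 eqxx.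
Qed.

Lemma mpoly_ext (p q : {mpoly C[n]}) : (forall v, p.@[v] = q.@[v]) -> p = q.
Proof.
by move=> pq; apply/eqP; rewrite -subr_eq0; apply/eqP/mpoly_eq0 => v; rewrite mevalB pq subrr.
Qed.

Lemma mpolyM_eq0 (p q : {mpoly C[n]}) : p * q = 0 -> p != 0 -> q = 0.
Proof. by move=> /eqP; rewrite mulf_eq0 => /orP[/eqP -> /eqP|/eqP]. Qed.

Lemma mpoly_neq0P (p : {mpoly C[n]}) : p != 0 -> exists v, p.@[v] != 0.
Proof. by move=> /(mpoly_nonzero natr_inj)[k [e H]]; eexists; exact: H. Qed.

End Kronecker.

Section Line.
Variables (C : numFieldType) (n : nat).

Definition line (v d : 'I_n -> C) (p : {mpoly C[n]}) : {poly C} :=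
  mmap (@polyC C) (fun i => (v i)%:P + (d i)%:P * 'X) p.

HB.instance Definition _ v d := GRing.RMorphism.copy (line v d) (line v d).

Lemma horner_line v d p t : (line v d p).[t] = p.@[fun i => v i + d i * t].
Proof.
by rewrite /line horner_mmap; apply: meval_eq => i; rewrite !hornerE.
Qed.

Lemma size_line v d p : (size (line v d p) <= msize p)%N.
Proof.
have [->|pn0] := eqVneq p 0; first by rewrite rmorph0 size_poly0.
rewrite (mpolySpred _ pn0); apply: (mmap_filtration (poly_filtration C)).
- by move=> c; rewrite size_polyC leq_b1.
- move=> i; rewrite (leq_trans (size_polyD _ _)) // geq_max.
  rewrite size_polyC (leq_trans (leq_b1 _)) //=.
  rewrite (leq_trans (size_polyMleq _ _)) // size_polyX addn2 /= ltnS.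
  by rewrite size_polyC leq_b1.
- by rewrite -mpolySpred.
Qed.

Lemma lineX v d i : line v d 'X_i = (v i)%:P + (d i)%:P * 'X.
Proof. by rewrite /line mmapX mmap1U. Qed.

Lemma lineZ v d c p : line v d (c *: p) = c *: line v d p.
Proof. by rewrite /line mmapZ /= mul_polyC. Qed.

Lemma deriv_line v d p :
  (line v d p)^`() = \sum_j d j *: line v d p^`M(j).
Proof.
pose Q p := (line v d p)^`() = \sum_j d j *: line v d p^`M(j).
have QM p1 p2 : Q p1 -> Q p2 -> Q (p1 * p2).
  rewrite /Q rmorphM derivM => -> ->.
  under [RHS]eq_bigr do rewrite mderivM rmorphD !rmorphM scalerDr.
  rewrite big_split /= mulr_suml mulr_sumr; congr (_ + _); apply: eq_bigr => j _.
    by rewrite scalerAl.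
  by rewrite scalerAr.
have Q1 : Q 1.
  rewrite /Q rmorph1 derivC big1 // => j _.
  by rewrite -mpolyC1 mderivC rmorph0 scaler0.
elim/mpolyind: p => [|c m p _ _ IH].
  by rewrite rmorph0 deriv0 big1 // => j _; rewrite mderiv0 rmorph0 scaler0.
rewrite rmorphD derivD IH /=.
under [RHS]eq_bigr do rewrite mderivD rmorphD scalerDr.
rewrite big_split /=; congr (_ + _).
rewrite lineZ derivZ.
under eq_bigr do rewrite mderivZ lineZ scalerA mulrC -scalerA.
rewrite -scaler_sumr; congr (_ *: _).
rewrite -/(Q 'X_[m]) mpolyXE_id; elim/big_ind: _ => // i _.
elim: (m i) => [|k IHk]; first by rewrite expr0.
rewrite exprS; apply: QM => //; rewrite /Q lineX derivD derivC deriv_mulC derivX mulr1 add0r.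
rewrite (bigD1 i) //= big1 => [|j ji].
  rewrite mderivX mnm1E eqxx scale1r addr0.
  rewrite (_ : (U_(i) - U_(i))%MM = 0%MM) ?mpolyX0 ?rmorph1 ?alg_polyC //.
  by apply/mnmP => l; rewrite mnmBE subnn mnm0E.
by rewrite mderivX mnm1E eq_sym (negPf ji) scale0r rmorph0 scaler0.
Qed.

End Line.

(** * Polynomial kernel vectors and a linear differential system *)

Section KernelVector.

(* The kernel of a full-rank matrix extends polynomially: if [E] is a right
   inverse of [M] at a point and [u] is in the kernel of [M] there, then [kerv M E u]
   takes the value [u] at this point. *)
Definition kerv (S : comNzRingType) (r K : nat) (M : 'M[S]_(r, K)) (E : 'M[S]_(K, r))
    (u : 'cV[S]_K) : 'cV[S]_K :=
  \det (M *m E) *: u - E *m (\adj (M *m E) *m (M *m u)).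

Lemma mul_kerv (S : comNzRingType) (r K : nat) (M : 'M[S]_(r, K)) (E : 'M[S]_(K, r))
    (u : 'cV[S]_K) : M *m kerv M E u = 0.
Proof.
rewrite /kerv mulmxBr -scalemxAr mulmxA mulmxA mul_mx_adj.
by rewrite mul_scalar_mx subrr.
Qed.

Lemma map_kerv (S T : comNzRingType) (f : {rmorphism S -> T}) (r K : nat)
    (M : 'M[S]_(r, K)) (E : 'M[S]_(K, r)) (u : 'cV[S]_K) :
  map_mx f (kerv M E u) = kerv (map_mx f M) (map_mx f E) (map_mx f u).
Proof.
by rewrite /kerv map_mxB map_mxZ !map_mxM map_mx_adj map_mxM -det_map_mx map_mxM.
Qed.

Lemma kerv_id (S : comNzRingType) (r K : nat) (M : 'M[S]_(r, K)) (E : 'M[S]_(K, r))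
    (u : 'cV[S]_K) : M *m E = 1%:M -> M *m u = 0 -> kerv M E u = u.
Proof. by move=> ME Mu; rewrite /kerv ME Mu det1 scale1r !mulmx0 subr0. Qed.

Lemma kerv_filtration (S : comNzRingType) (P : nat -> S -> Prop) (k r K : nat)
    (M : 'M[S]_(r, K)) (E : 'M[S]_(K, r)) (u : 'cV[S]_K) :
  filtration P -> (forall i j, P k (M i j)) -> (forall i j, P 0%N (E i j)) ->
  (forall i j, P 0%N (u i j)) -> forall i j, P (r * k)%N (kerv M E u i j).
Proof.
move=> fP PM PE Pu i j.
have PME a b : P k ((M *m E) a b).
  by rewrite mxE; apply: filt_sum => // l _; rewrite -[k]addn0; exact: filtM.
have PMu a b : P k ((M *m u) a b).
  by rewrite mxE; apply: filt_sum => // l _; rewrite -[k]addn0; exact: filtM.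
rewrite !mxE; apply: filtD => //.
  by rewrite -[(r * k)%N]addn0; apply: filtM => //; exact: filt_det.
apply: filtN => //; apply: filt_sum => // a _; rewrite -[(r * k)%N]add0n.
apply: filtM => //; rewrite mxE; apply: filt_sum => // b _.
have -> : (r * k = r.-1 * k + k)%N by rewrite -mulSnr prednK // (leq_ltn_trans _ (ltn_ord a)).
apply: filtM => //; rewrite mxE /cofactor -[(r.-1 * k)%N]add0n; apply: filtM => //.
  exact: filt_sign.
by apply: (filt_det fP) => c d; rewrite 2!mxE; exact: PME.
Qed.

Lemma row_free_mulmx1 (F : fieldType) (r K : nat) (M : 'M[F]_(r, K)) (E : 'M[F]_(K, r)) :
  \det (M *m E) != 0 -> row_free M.
Proof.
move=> dn0; have U : M *m E \in unitmx by rewrite unitmxE unitfE.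
by apply/row_freeP; exists (E *m invmx (M *m E)); rewrite mulmxA mulmxV.
Qed.

End KernelVector.

(** Uniqueness for d y' = A y. As d(0) is nonzero and the characteristic is 0, comparing
    coefficients of degree m determines the coefficient m + 1 of y from the earlier ones. *)
Lemma linear_ode0 (C : numFieldType) (r : nat) (d : {poly C}) (A : 'M[{poly C}]_r)
    (y : 'cV[{poly C}]_r) :
  d.[0] != 0 -> (forall i, (y i 0).[0] = 0) ->
  (forall i, d * (y i 0)^`() = (A *m y) i 0) -> y = 0.
Proof.
move=> d0 y0 yE.
have H m : forall i j, (j <= m)%N -> (y i 0)`_j = 0.
  elim: m => [|m IH] i j; first by rewrite leqn0 => /eqP ->; rewrite -horner_coef0.
  rewrite leq_eqVlt => /predU1P[->|]; last by rewrite ltnS; exact: IH.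
  have := congr1 (fun q : {poly C} => q`_m) (yE i).
  rewrite /= coefM big_ord_recl /= subn0 coef_deriv big1 => [|l _]; last first.
    rewrite coef_deriv /bump /= add1n IH ?mul0rn ?mulr0 //.
    by rewrite subnSK ?leq_subr // ltn_ord.
  rewrite mxE coef_sum addr0 big1 => [|l _].
    move/eqP; rewrite mulf_eq0 -horner_coef0 (negPf d0) /= -mulr_natr mulf_eq0.
    by rewrite pnatr_eq0 orbF => /eqP.
  by rewrite coefM big1 // => s _; rewrite IH ?mulr0 // leq_subr.
apply/colP => i; rewrite mxE; apply/polyP => j; rewrite coef0; exact: (H j).
Qed.

(** * Jets along the hyperplanes orthogonal to z *)

Section Jets.
Variables (C : numFieldType) (N : nat).

Definition dot (z w : 'I_N -> C) : C := \sum_i z i * w i.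

Lemma dotDl z1 z2 t w : dot (fun i => z1 i + z2 i * t) w = dot z1 w + t * dot z2 w.
Proof.
by rewrite /dot mulr_sumr -big_split; apply: eq_bigr => i _; rewrite mulrDl mulrCA mulrA.
Qed.

Lemma dotC z w : dot z w = dot w z.
Proof. by apply: eq_bigr => i _; rewrite mulrC. Qed.

(* Iterated derivatives along the vector fields [z_l d/dw_j - z_j d/dw_l],
   which are tangent to the hyperplane [z.w = 0] for fixed [z]. *)
Fixpoint jet (z : 'I_N -> C) (e : seq ('I_N * 'I_N)) (g : {mpoly C[N]}) : {mpoly C[N]} :=
  if e is (j, l) :: e' then z l *: (jet z e' g)^`M(j) - z j *: (jet z e' g)^`M(l) else g.

(** The sum of v_j y_l (z_l d/dw_j - z_j d/dw_l) is z.y times the derivative along v minus z.v times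
    the derivative along y. The tangential fields thus produce every derivative along a direction
    orthogonal to z. *)
Lemma deriv_line_jet z y v w e g : dot z v = 0 -> dot z y = 1 ->
  (line w v (jet z e g))^`() =
  \sum_j \sum_l (v j * y l) *: line w v (jet z ((j, l) :: e) g).
Proof.
move=> zv zy; rewrite deriv_line /=; set q := jet z e g.
pose L j := line w v q^`M(j).
transitivity (\sum_j (\sum_l y l * z l) *: (v j *: L j) -
              \sum_l (\sum_j v j * z j) *: (y l *: L l)).
  have -> : \sum_l y l * z l = 1 by rewrite -[RHS]zy /dot; apply: eq_bigr => i _; rewrite mulrC.
  have -> : \sum_l v l * z l = 0 by rewrite -[RHS]zv /dot; apply: eq_bigr => i _; rewrite mulrC.
  rewrite [X in _ - X]big1 ?subr0 => [|l _]; last by rewrite scale0r.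
  by apply: eq_bigr => j _; rewrite scale1r.
transitivity (\sum_j \sum_l ((v j * y l * z l) *: L j - (v j * y l * z j) *: L l)).
  under [RHS]eq_bigr do rewrite sumrB; rewrite sumrB; congr (_ - _).
    apply: eq_bigr => j _; rewrite scaler_suml; apply: eq_bigr => l _.
    by rewrite scalerA; congr (_ *: _); rewrite mulrC mulrA.
  rewrite exchange_big; apply: eq_bigr => l _; rewrite scaler_suml; apply: eq_bigr => j _.
  by rewrite scalerA mulrAC.
apply: eq_bigr => j _; apply: eq_bigr => l _.
by rewrite rmorphB /= !lineZ scalerBr !scalerA.
Qed.

(** Separation of variables: the first components carry z and have degree at most the order of the
    jet, the second ones are derivatives of [g]. Hence the degree in z does not depend on [g]. *)
Fixpoint jetc (e : seq ('I_N * 'I_N)) (g : {mpoly C[N]}) :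
    seq ({mpoly C[N]} * {mpoly C[N]}) :=
  if e is (j, l) :: e' then
    [seq ('X_l * t.1, t.2^`M(j)) | t <- jetc e' g] ++
    [seq (- 'X_j * t.1, t.2^`M(l)) | t <- jetc e' g]
  else [:: (1, g)].

Lemma jetcE z e g : jet z e g = \sum_(t <- jetc e g) t.1.@[z] *: t.2.
Proof.
elim: e => [|[j l] e IH] /=; first by rewrite big_seq1 meval1 scale1r.
have dE i : (jet z e g)^`M(i) = \sum_(t <- jetc e g) t.1.@[z] *: t.2^`M(i).
  by rewrite IH (raddf_sum (mderiv i)); apply: eq_bigr => t _; exact: mderivZ.
rewrite big_cat !big_map /= !dE !scaler_sumr -sumrN.
congr (_ + _); apply: eq_bigr => t _.
  by rewrite scalerA mevalM mevalXU.
by rewrite scalerA mevalM mevalN mevalXU mulNr scaleNr.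
Qed.

Lemma jetc_size e g : all (fun t => msize t.1 <= (size e).+1)%N (jetc e g).
Proof.
elim: e => [|[j l] e IH] /=; first by rewrite msize1.
have fM := filtM (mpoly_filtration N C).
have fN := filtN (mpoly_filtration N C).
rewrite all_cat !all_map; apply/andP; split; apply: sub_all IH => t /= tE.
  by rewrite -add1n; apply: (fM 1%N (size e)) => //; rewrite msizeX mdeg1.
rewrite -add1n; apply: (fM 1%N (size e)) => //.
by apply: (fN 1%N); rewrite msizeX mdeg1.
Qed.

Definition jet_line b x w e g : {poly C} :=
  \sum_(t <- jetc e g) t.2.@[w] *: line b x t.1.

Lemma horner_jet_line b x w e g s :
  (jet_line b x w e g).[s] = (jet (fun i => b i + x i * s) e g).@[w].
Proof.
rewrite jetcE /jet_line horner_sum meval_sum; apply: eq_bigr => t _.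
by rewrite hornerZ horner_line mevalZ mulrC.
Qed.

Lemma size_jet_line b x w e g : (size (jet_line b x w e g) <= (size e).+1)%N.
Proof.
rewrite /jet_line big_seq; apply: (filt_sum _ (poly_filtration C)) => t tP.
have /allP/(_ _ tP) := jetc_size e g.
by apply: leq_trans; apply: leq_trans (size_scale_leq _ _) (size_line _ _ _).
Qed.

(** Here w follows z through [h], whereas [jet_line] keeps w fixed. *)
Definition jet_comp (h : 'I_N -> {mpoly C[N]}) e g : {mpoly C[N]} :=
  \sum_(t <- jetc e g) t.1 * mmap (@mpolyC N C) h t.2.

Lemma meval_jet_comp h e g z :
  (jet_comp h e g).@[z] = (jet z e g).@[fun i => (h i).@[z]].
Proof.
rewrite jetcE /jet_comp !meval_sum; apply: eq_bigr => t _.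
by rewrite mevalM mevalZ meval_mmap.
Qed.

End Jets.

(** * The reflection argument *)

Section Reflection.
Variables (C : numFieldType) (N K : nat) (F : 'I_K -> {mpoly C[N]}) (i0 : 'I_K) (j0 : 'I_N).
Variable GG : ('I_K -> {mpoly C[N]}) -> Prop.
Hypothesis GGF : forall G z w, GG G -> dot z w = 0 -> \sum_k (F k).@[z] * (G k).@[w] = 0.
Hypothesis GG_max : forall U,
  (forall G z w, GG G -> dot z w = 0 -> \sum_k (U k).@[z] * (G k).@[w] = 0) ->
  forall k, F i0 * U k = F k * U i0.

(** The factor [F i0] is the one cancelled in parallelism relations; the factor ['X_j0] supplies a
    vector y with z.y = 1. *)
Definition zeta : {mpoly C[N]} := F i0 * 'X_j0.

Definition good (z w : 'I_N -> C) := dot z w = 0 /\ zeta.@[z] != 0.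

(** The orthogonality relation holds on the whole hyperplane z.w = 0, and the fields defining [jet]
    are tangent to it. *)
Lemma jet_orthogonal G z w e : GG G -> dot z w = 0 ->
  \sum_k (F k).@[z] * (jet z e (G k)).@[w] = 0.
Proof.
move=> GGG; elim: e w => [|[j l] e IH] w zw; first exact: GGF.
pose v i := z l * (i == j)%:R - z j * (i == l)%:R.
pose q := \sum_k (F k).@[z] *: line w v (jet z e (G k)).
have zv : dot z v = 0.
  rewrite /dot; under eq_bigr do rewrite mulrBr !mulrA.
  rewrite sumrB (bigD1 j) //= big1 => [|i /negPf ->]; last by rewrite mulr0.
  rewrite (bigD1 l) //= big1 => [|i /negPf ->]; last by rewrite mulr0.
  by rewrite !eqxx !mulr1 !addr0 mulrC subrr.
have q0 : q = 0.
  apply: poly_eq0_nat => t; rewrite /q horner_sum.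
  under eq_bigr do rewrite hornerZ horner_line.
  by apply: IH; rewrite dotC dotDl dotC zw dotC zv mulr0 addr0.
have := congr1 (fun p : {poly C} => p^`().[0]) q0.
rewrite /= deriv0 horner0 => q'0; rewrite -[RHS]q'0 /q raddf_sum horner_sum; apply: eq_bigr => k _ /=.
rewrite derivZ hornerZ deriv_line horner_sum; congr (_ * _).
rewrite mevalB !mevalZ.
transitivity (\sum_i v i * ((jet z e (G k))^`M(i)).@[w]); last first.
  apply: eq_bigr => i _; rewrite hornerZ horner_line; congr (_ * _).
  by apply: meval_eq => a; rewrite mulr0 addr0.
rewrite /v; under [RHS]eq_bigr do rewrite mulrBl.
rewrite sumrB (bigD1 j) //= [X in _ = _ + X - _]big1 => [|i /negPf ->]; last by rewrite mulr0 mul0r.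
rewrite (bigD1 l) //= [X in _ = _ - (_ + X)]big1 => [|i /negPf ->]; last by rewrite mulr0 mul0r.
by rewrite !eqxx !mulr1 !addr0.
Qed.

Definition jetdata := (seq ('I_N * 'I_N) * ('I_K -> {mpoly C[N]}))%type.

Definition jetrow (d : jetdata) (z w : 'I_N -> C) : 'rV[C]_K :=
  \row_k (jet z d.1 (d.2 k)).@[w].

Definition jetmx (r : nat) (d : 'I_r -> jetdata) (z w : 'I_N -> C) : 'M[C]_(r, K) :=
  \matrix_(i, k) jetrow (d i) z w 0 k.

Definition jets k (d : jetdata) := (size d.1 <= k)%N /\ GG d.2.

(* Some [r] jets of order at most [k] are independent at some good point. *)
Definition rk k r := exists (d : 'I_r -> jetdata) z w,
  [/\ forall i, jets k (d i), good z w & row_free (jetmx d z w)].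

(** If each order brought a new independent jet, order K + 1 would give K + 1 independent vectors of
    length K. This bounds the order without reference to the degrees of [F] and of the G. *)
Lemma rk_stable : (exists z w, good z w) ->
  exists k r, [/\ (k <= K)%N, rk k r & ~ rk k.+1 r.+1].
Proof.
move=> [z [w zw]]; apply: contrapT => H.
have rkS m : (m <= K.+1)%N -> rk m m.
  elim: m => [|m IH] mK.
    have d (i : 'I_0) : jetdata by case: i.
    by exists d, z, w; split => // [[]|] //; rewrite /row_free -leqn0 rank_leq_row.
  apply: contrapT => Hm; apply: H; exists m, m; split => //.
  exact/IH/ltnW.
have [d [z' [w' [_ _]]]] := rkS _ (leqnn _).
rewrite /row_free => /eqP E; have := rank_leq_col (jetmx d z' w').
by rewrite E ltnn.
Qed.

Variables (k r : nat) (d : 'I_r -> jetdata).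
Hypothesis rk_max : ~ rk k.+1 r.+1.
Hypothesis d_jets : forall i, jets k (d i).

(** A jet outside the row space could be added to [d], giving r + 1 independent jets of order at
    most k + 1 at a good point. *)
Lemma jetrow_sub z w d' : good z w -> row_free (jetmx d z w) -> jets k.+1 d' ->
  (jetrow d' z w <= jetmx d z w)%MS.
Proof.
move=> zw free d'P; apply/negPn/negP => nsub; apply: rk_max.
pose d2 (i : 'I_(1 + r)) := if split i is inr j then d j else d'.
exists d2, z, w; split => //.
  move=> i; rewrite /d2; case: (@split 1 r i) => // j.
  by have [szd GGd] := d_jets j; split => //; exact: leqW.
have -> : jetmx d2 z w = col_mx (jetrow d' z w) (jetmx d z w).
  apply/matrixP => i c; rewrite !mxE /d2; case: (@split 1 r i) => j //.
  - by rewrite ord1 !mxE.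
  - by rewrite !mxE.
rewrite /row_free eqn_leq rank_leq_row /=.
have : (\rank (jetmx d z w) < \rank (jetrow d' z w + jetmx d z w)%MS)%N.
  by apply: rank_ltmx; rewrite ltmxE addsmxSr addsmx_sub (negPf nsub).
by rewrite (eqP free) addsmxE.
Qed.

Lemma good_normal z w : good z w -> exists y, dot z y = 1.
Proof.
move=> [_]; rewrite /zeta mevalM mevalXU mulf_eq0 negb_or => /andP[_ zj].
exists (fun i => (i == j0)%:R / z j0).
rewrite /dot (bigD1 j0) //= big1 => [|i /negPf ->]; last by rewrite mul0r mulr0.
by rewrite eqxx mul1r mulfV // addr0.
Qed.

(* On a line w + t v in z^perp let M be the matrix of jets. By maximality of the rank,
   the jets of order k + 1 lie in its row space, so that delta M' = A M with delta <> 0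
   at w. As M u = 0 at w, it follows that M u = 0 on the line. *)
Lemma kernel_annihilates z w (u : 'cV[C]_K) G w' : good z w -> row_free (jetmx d z w) ->
  jetmx d z w *m u = 0 -> GG G -> dot z w' = 0 -> \sum_k (G k).@[w'] * u k 0 = 0.
Proof.
move=> zw free Mu GGG zw'; have [y zy] := good_normal zw.
pose v i := w' i - w i; pose wt t i := w i + v i * t.
have zv : dot z v = 0.
  rewrite -[RHS](subr0 0) -[X in X - _]zw' -(proj1 zw) /dot -sumrB.
  by apply: eq_bigr => i _; rewrite mulrBr.
have zwt t : dot z (wt t) = 0.
  by rewrite dotC /wt dotDl dotC (proj1 zw) dotC zv mulr0 addr0.
have goodt t : good z (wt t) by split => //; exact: (proj2 zw).
pose Mp : 'M[{poly C}]_(r, K) := \matrix_(i, c) line w v (jet z (d i).1 ((d i).2 c)).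
have MpE t : map_mx (horner_eval t) Mp = jetmx d z (wt t).
  by apply/matrixP => i c; rewrite !mxE /horner_eval horner_line /wt.
have w0 : jetmx d z (wt 0) = jetmx d z w.
  by apply/matrixP => i c; rewrite !mxE; apply: meval_eq => a; rewrite /wt mulr0 addr0.
have /row_freeP[E ME] := free.
pose Ep : 'M[{poly C}]_(K, r) := map_mx (@polyC C) E.
have EpE t : map_mx (horner_eval t) Ep = E.
  by apply/matrixP => i c; rewrite !mxE /horner_eval hornerC.
pose dl := \det (Mp *m Ep).
have dlE t : dl.[t] = \det (jetmx d z (wt t) *m E).
  by rewrite -/(horner_eval t dl) -det_map_mx map_mxM MpE EpE.
have dl0 : dl.[0] != 0 by rewrite dlE w0 ME det1 oner_neq0.
have dln0 : dl != 0 by apply: contraNneq dl0 => ->; rewrite horner0.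
have freet t : dl.[t] != 0 -> row_free (jetmx d z (wt t)).
  by rewrite dlE; exact: row_free_mulmx1.
pose D := map_mx (@deriv C) Mp.
(* If D = A M at a point, then D E adj(M E) M = A (M E) adj(M E) M = delta A M. This holds wherever
   delta is nonzero, hence identically. *)
have DE : dl *: D = (D *m Ep *m \adj (Mp *m Ep)) *m Mp.
  apply/matrixP => i c; apply/eqP; rewrite -subr_eq0; apply/eqP.
  apply: (poly_eq0_generic dln0) => t dlt.
  have /submxP[A AE] : (map_mx (horner_eval t) D <= jetmx d z (wt t))%MS.
    apply/row_subP => a.
    have -> : row a (map_mx (horner_eval t) D) = \sum_j \sum_l
        (v j * y l) *: jetrow ((j, l) :: (d a).1, (d a).2) z (wt t).
      apply/rowP => b; rewrite !mxE /horner_eval (deriv_line_jet _ _ _ zv zy).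
      rewrite horner_sum summxE; apply: eq_bigr => j _.
      rewrite horner_sum summxE; apply: eq_bigr => l _.
      by rewrite hornerZ horner_line !mxE.
    do 2![apply: summx_sub => ? _]; apply: scalemx_sub; apply: jetrow_sub => //.
      exact: freet.
    by have [sza GGa] := d_jets a; split.
  have : map_mx (horner_eval t) (dl *: D) =
         map_mx (horner_eval t) ((D *m Ep *m \adj (Mp *m Ep)) *m Mp).
    rewrite map_mxZ !map_mxM map_mx_adj map_mxM EpE MpE AE -[X in X *: _]/(dl.[t]) dlE.
    set Mt := jetmx d z (wt t); rewrite -!mulmxA (mulmxA Mt E) (mulmxA (Mt *m E)) mul_mx_adj.
    by rewrite mul_scalar_mx -scalemxAr.
  move/matrixP/(_ i c); rewrite 2![map_mx _ _ _ _]mxE => EE.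
  by apply/eqP; rewrite hornerD hornerN subr_eq0; apply/eqP.
pose up : 'cV[{poly C}]_K := map_mx (@polyC C) u.
have Mpu : Mp *m up = 0.
  apply: (linear_ode0 (A := D *m Ep *m \adj (Mp *m Ep)) dl0) => i.
    have := congr1 (fun X : 'cV_r => X i 0) Mu; rewrite !mxE => Mui.
    rewrite -[RHS]Mui horner_sum; apply: eq_bigr => c _; rewrite !mxE hornerM hornerC horner_line.
    by congr (_ * _); apply: meval_eq => a; rewrite /wt mulr0 addr0.
  rewrite mulmxA -DE -scalemxAl [RHS]mxE; congr (_ * _).
  rewrite !mxE raddf_sum; apply: eq_bigr => c _.
  by rewrite !mxE /= mulrC deriv_mulC mulrC.
(* [G] is a jet of order 0, so it lies in the row space of M along the line; the point w' is reached
   at t = 1. *)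
pose g := \sum_c u c 0 *: line w v (G c).
have g0 : g = 0.
  apply: (poly_eq0_generic dln0) => t dlt.
  have sub : (jetrow ([::], G) z (wt t)
              <= jetmx d z (wt t))%MS.
    by apply: jetrow_sub => //; exact: freet.
  have /submxP[A AE] := sub.
  have := congr1 (fun X => map_mx (horner_eval t) X) Mpu.
  rewrite map_mxM MpE map_mx0 => Mtu.
  have upE : map_mx (horner_eval t) up = u.
    by apply/matrixP => a b; rewrite !mxE /horner_eval hornerC.
  rewrite upE in Mtu.
  have := congr1 (fun X : 'rV_K => (X *m u) 0 0) AE.
  rewrite -mulmxA Mtu mulmx0 mxE [RHS]mxE => gt0.
  rewrite -[RHS]gt0 /g horner_sum; apply: eq_bigr => c _.
  by rewrite hornerZ horner_line !mxE mulrC.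
have := congr1 (fun q : {poly C} => q.[1]) g0.
rewrite /= horner0 => g1; rewrite -[RHS]g1 /g horner_sum; apply: eq_bigr => c _.
rewrite hornerZ horner_line mulrC; congr (_ * _).
by apply: meval_eq => a; rewrite mulr1 /v addrC subrK.
Qed.

(* Extend u to a polynomial vector U(z) in the kernel of the jets at (z, wz z), where
   wz z is orthogonal to z and equal to w1 at z1, and apply [GG_max] to a multiple of U. *)
Lemma kernel_parallel z1 w1 (u : 'cV[C]_K) : good z1 w1 -> row_free (jetmx d z1 w1) ->
  jetmx d z1 w1 *m u = 0 -> forall c, (F i0).@[z1] * u c 0 = (F c).@[z1] * u i0 0.
Proof.
move=> zw free Mu; have [y zy] := good_normal zw.
have [zw0 zeta1] := zw.
pose ydot : {mpoly C[N]} := \sum_l y l *: 'X_l.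
pose wdot : {mpoly C[N]} := \sum_l w1 l *: 'X_l.
have ydotE z : ydot.@[z] = dot z y.
  by rewrite meval_sum; apply: eq_bigr => l _; rewrite mevalZ mevalXU mulrC.
have wdotE z : wdot.@[z] = dot z w1.
  by rewrite meval_sum; apply: eq_bigr => l _; rewrite mevalZ mevalXU mulrC.
(* w1 (z.y) - y (z.w1) is orthogonal to every z, and equals w1 at z1, where z.y = 1 and z.w1 = 0. *)
pose h i : {mpoly C[N]} := w1 i *: ydot - y i *: wdot.
pose wz z i := (h i).@[z].
have dotwz z : dot z (wz z) = 0.
  transitivity (dot z w1 * dot z y - dot z y * dot z w1); last by rewrite mulrC subrr.
  rewrite {1 4}/dot !mulr_suml -sumrB; apply: eq_bigr => i _.
  by rewrite /wz mevalB !mevalZ ydotE wdotE mulrBr !mulrA.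
have wz1 : wz z1 =1 w1.
  by move=> i; rewrite /wz mevalB !mevalZ ydotE wdotE zy zw0 mulr1 mulr0 subr0.
pose Mm : 'M[{mpoly C[N]}]_(r, K) := \matrix_(i, c) jet_comp h (d i).1 ((d i).2 c).
have MmE z : map_mx (meval z) Mm = jetmx d z (wz z).
  by apply/matrixP => i c; rewrite !mxE meval_jet_comp.
have M1 : jetmx d z1 (wz z1) = jetmx d z1 w1.
  by apply/matrixP => i c; rewrite !mxE; exact: meval_eq.
have /row_freeP[E ME] := free.
pose Ep : 'M[{mpoly C[N]}]_(K, r) := map_mx (@mpolyC N C) E.
pose up : 'cV[{mpoly C[N]}]_K := map_mx (@mpolyC N C) u.
have EpE z : map_mx (meval z) Ep = E.
  by apply/matrixP => a b; rewrite !mxE mevalC.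
have upE z : map_mx (meval z) up = u.
  by apply/matrixP => a b; rewrite !mxE mevalC.
pose V := kerv Mm Ep up.
pose dl := \det (Mm *m Ep).
have dlE z : dl.@[z] = \det (jetmx d z (wz z) *m E).
  by rewrite -(det_map_mx (meval z)) map_mxM MmE EpE.
(* The factor makes [U] vanish where (z, wz z) is not good or the jets may be dependent, so that
   orthogonality to GG holds at all z. *)
pose U c := zeta * dl * V c 0.
have /GG_max UF : forall G z w, GG G -> dot z w = 0 -> \sum_c (U c).@[z] * (G c).@[w] = 0.
  move=> G z w GGG zw'.
  have [z0|zn0] := eqVneq (zeta * dl).@[z] 0.
    by apply: big1 => c _; rewrite /U mevalM z0 !mul0r.
  move: (zn0); rewrite mevalM mulf_eq0 negb_or => /andP[ztn0 dln0].
  have gz : good z (wz z) by split.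
  have fz : row_free (jetmx d z (wz z)) by apply: (@row_free_mulmx1 _ _ _ _ E); rewrite -dlE.
  have MV : jetmx d z (wz z) *m map_mx (meval z) V = 0.
    by rewrite -MmE -map_mxM mul_kerv map_mx0.
  have := kernel_annihilates gz fz MV GGG zw'.
  move=> H; transitivity ((zeta * dl).@[z] * \sum_c (G c).@[w] * map_mx (meval z) V c 0).
    rewrite mulr_sumr; apply: eq_bigr => c _.
    by rewrite /U mevalM [map_mx _ _ _ _]mxE -mulrA; congr (_ * _); rewrite mulrC.
  by rewrite H mulr0.
move=> c; have := congr1 (meval z1) (UF c).
have V1 a : (V a 0).@[z1] = u a 0.
  have : map_mx (meval z1) V = u.
    by rewrite map_kerv MmE EpE upE M1 kerv_id.
  by move/matrixP/(_ a 0); rewrite mxE.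
have dl1 : dl.@[z1] = 1 by rewrite dlE M1 ME det1.
have UE a : (U a).@[z1] = zeta.@[z1] * u a 0 by rewrite /U 2!mevalM V1 dl1 mulr1.
rewrite /= (mevalM _ (F i0)) (mevalM _ (F c)) !UE ![_ * (zeta.@[z1] * _)]mulrCA.
exact/mulfI.
Qed.

(* For w orthogonal to b and x, the jets at (b + s x, w) are polynomials in s of bounded
   degree, and their kernel contains F(b + s x). *)
Lemma line_parallel b x w : (r <= K)%N -> (k <= K)%N ->
  good b w -> dot x w = 0 -> row_free (jetmx d b w) ->
  exists H : 'I_K -> {poly C}, [/\ exists c, H c != 0,
    forall c, (size (H c) <= (K * K).+1)%N &
    forall c, line b x (F i0) * H c = line b x (F c) * H i0].
Proof.
move=> rK kK bw xw free; have [bw0 zetab] := bw.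
pose zt s i := b i + x i * s.
have ztw s : dot (zt s) w = 0 by rewrite /zt dotDl bw0 xw mulr0 addr0.
have zt0 p : p.@[zt 0] = p.@[b] :> C by apply: meval_eq => i; rewrite /zt mulr0 addr0.
pose Mp : 'M[{poly C}]_(r, K) := \matrix_(i, c) jet_line b x w (d i).1 ((d i).2 c).
have MpE s : map_mx (horner_eval s) Mp = jetmx d (zt s) w.
  by apply/matrixP => i c; rewrite !mxE /horner_eval horner_jet_line.
have M0 : jetmx d (zt 0) w = jetmx d b w.
  apply/matrixP => i c; rewrite !mxE !jetcE !meval_sum; apply: eq_bigr => t _.
  by rewrite !mevalZ zt0.
have /row_freeP[E ME] := free.
pose f0 : 'cV[C]_K := \col_c (F c).@[b].
have Mf0 : jetmx d b w *m f0 = 0.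
  apply/colP => i; rewrite mxE [RHS]mxE -[RHS](jet_orthogonal (d i).1 (proj2 (d_jets i)) bw0).
  by apply: eq_bigr => c _; rewrite !mxE mulrC.
pose Ep : 'M[{poly C}]_(K, r) := map_mx (@polyC C) E.
pose fp : 'cV[{poly C}]_K := map_mx (@polyC C) f0.
have EpE s : map_mx (horner_eval s) Ep = E.
  by apply/matrixP => a c; rewrite !mxE /horner_eval hornerC.
have fpE s : map_mx (horner_eval s) fp = f0.
  by apply/matrixP => a c; rewrite !mxE /horner_eval hornerC.
pose V := kerv Mp Ep fp.
have V0 c : (V c 0).[0] = (F c).@[b].
  have : map_mx (horner_eval 0) V = f0 by rewrite map_kerv MpE EpE fpE M0 kerv_id.
  by move/matrixP/(_ c 0); rewrite !mxE.
pose dl := \det (Mp *m Ep).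
have dlE s : dl.[s] = \det (jetmx d (zt s) w *m E).
  by rewrite -/(horner_eval s dl) -(det_map_mx (horner_eval s)) map_mxM MpE EpE.
have Fb : (F i0).@[b] != 0.
  by move: zetab; rewrite /zeta mevalM mulf_eq0 negb_or => /andP[].
exists (fun c => V c 0); split.
- by exists i0; apply: contraNneq Fb => V00; rewrite -V0 V00 horner0.
- move=> c; have := @kerv_filtration _ _ k r K Mp Ep fp (poly_filtration C) _ _ _ c 0.
  move=> H; apply: leq_trans (H _ _ _) _.
  + by move=> i a; rewrite mxE (leq_trans (size_jet_line _ _ _ _ _)) // ltnS (proj1 (d_jets i)).
  + by move=> i a; rewrite mxE size_polyC leq_b1.
  + by move=> i a; rewrite mxE size_polyC leq_b1.
  + by rewrite ltnS leq_mul.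
- move=> c; apply/eqP; rewrite -subr_eq0; apply/eqP.
  apply: (@poly_eq0_generic _ (line b x zeta * dl)).
    apply/eqP => /(congr1 (fun p : {poly C} => p.[0])).
    rewrite hornerM horner_line zt0 dlE M0 ME det1 mulr1 horner0 => /eqP.
    by rewrite (negPf zetab).
  move=> s; rewrite hornerM horner_line mulf_eq0 negb_or => /andP[zs dls].
  have gs : good (zt s) w by split.
  have fs : row_free (jetmx d (zt s) w) by apply: (@row_free_mulmx1 _ _ _ _ E); rewrite -dlE.
  have MV : jetmx d (zt s) w *m map_mx (horner_eval s) V = 0.
    by rewrite -MpE -map_mxM mul_kerv map_mx0.
  have := kernel_parallel gs fs MV c; rewrite ![map_mx _ _ _ _]mxE => H.
  by rewrite hornerD hornerN !hornerM !horner_line; apply/eqP; rewrite subr_eq0; apply/eqP.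
Qed.

End Reflection.

(** * Linear systems solvable on a Zariski dense set *)

Section GenericKernel.
Variables (C : numFieldType) (N : nat).

Definition mpoly_dense (A : ('I_N -> C) -> Prop) :=
  forall p : {mpoly C[N]}, (forall x, A x -> p.@[x] = 0) -> p = 0.

(** At a point of maximal rank, choose combinations [L] of the rows that form a basis. Were this
    rank equal to [c], a nonzero minor would vanish at all points of [A], where kernels exist,
    against density. So there is a kernel vector at this point, and [kerv] extends it with degree at
    most the rank times [k]. *)
Lemma generic_kernel_mx (A : ('I_N -> C) -> Prop) (r c k : nat)
    (M : 'M[{mpoly C[N]}]_(r, c)) : mpoly_dense A ->
  (forall i j, msize (M i j) <= k.+1)%N ->
  (forall x, A x -> exists2 u : 'cV[C]_c, u != 0 & map_mx (meval x) M *m u = 0) ->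
  exists V : 'cV[{mpoly C[N]}]_c,
    [/\ V != 0, forall j, (msize (V j ord0) <= (c * k).+1)%N & M *m V = 0].
Proof.
move=> Adense szM kerA.
pose Q rho := `[< exists x, (rho <= \rank (map_mx (meval x) M))%N >].
have Q0 : exists rho, Q rho by exists 0%N; apply/asboolP; exists (fun=> 0).
have Qle rho : Q rho -> (rho <= c)%N.
  by move=> /asboolP[x]; move=> /leq_trans; apply; exact: rank_leq_col.
case: (ex_maxnP Q0 Qle) => rho /asboolP[x1 rho1] rhomax.
have rkmax x : (\rank (map_mx (meval x) M) <= \rank (map_mx (meval x1) M))%N.
  by apply: leq_trans rho1; apply: rhomax; apply/asboolP; exists x.
pose M1 := map_mx (meval x1) M.
have /submxP[L LM] : (row_base M1 <= M1)%MS by rewrite eq_row_base.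
have /row_freeP[E] := row_base_free M1; rewrite LM => ME.
pose Mm := map_mx (@mpolyC N C) L *m M.
pose Ep := map_mx (@mpolyC N C) E.
have LE x : map_mx (meval x) (map_mx (@mpolyC N C) L) = L.
  by apply/matrixP => i j; rewrite !mxE mevalC.
have EE x : map_mx (meval x) Ep = E.
  by apply/matrixP => i j; rewrite !mxE mevalC.
pose dl := \det (Mm *m Ep).
have dlE x : dl.@[x] = \det (L *m map_mx (meval x) M *m E).
  by rewrite -(det_map_mx (meval x)) !map_mxM EE LE.
have dl1 : dl != 0.
  apply/eqP => /(congr1 (meval x1)); rewrite meval0 dlE ME det1 => /eqP.
  by rewrite oner_eq0.
(* Where [dl] is nonzero, the rows of L M(x) attain the maximal rank and hence span all rows of
   M(x). *)
have rk x : dl.@[x] != 0 -> (map_mx (meval x) M <= L *m map_mx (meval x) M)%MS.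
  move=> dlx; have fx : row_free (L *m map_mx (meval x) M).
    by apply: (@row_free_mulmx1 _ _ _ _ E); rewrite -dlE.
  rewrite -(mxrank_leqif_sup (submxMl _ _)) eqn_leq mxrankS ?submxMl //=.
  by rewrite (eqP fx) rkmax.
have rkc : (\rank M1 < c)%N.
  rewrite ltn_neqAle rank_leq_col andbT; apply/negP => /eqP rkc.
  have dl0 : dl = 0.
    apply: Adense => x /kerA[u un0 Mu]; apply: contrapT => /eqP dlx.
    have fx : row_full (map_mx (meval x) M).
      rewrite /row_full eqn_leq rank_leq_col /=; apply: (leq_trans (eq_leq (esym rkc))).
      have fx : row_free (L *m map_mx (meval x) M).
        by apply: (@row_free_mulmx1 _ _ _ _ E); rewrite -dlE.
      by rewrite -(eqP fx) mxrankM_maxr.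
    by case/eqP: un0; apply: (row_full_inj fx); rewrite Mu mulmx0.
  by rewrite dl0 eqxx in dl1.
have [u1 u1n0 Mu1] : exists2 u : 'cV[C]_c, u != 0 & M1 *m u = 0.
  have /rowV0Pn[v] : kermx M1^T != 0.
    by rewrite kermx_eq0 /row_free mxrank_tr neq_ltn rkc.
  move=> /sub_kermxP vM vn0; exists v^T; first by rewrite trmx_eq0.
  by apply: trmx_inj; rewrite trmx_mul trmxK vM trmx0.
pose up := map_mx (@mpolyC N C) u1.
have upE x : map_mx (meval x) up = u1.
  by apply/matrixP => i j; rewrite !mxE mevalC.
pose V := kerv Mm Ep up.
exists V; split.
- apply: contraNneq u1n0 => V0.
  have : map_mx (meval x1) V = u1.
    rewrite map_kerv map_mxM LE EE upE kerv_id //.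
    by rewrite -mulmxA Mu1 mulmx0.
  by rewrite V0 map_mx0 => <-.
- move=> j; apply: leq_trans (_ : (\rank M1 * k).+1 <= _)%N; last first.
    by rewrite ltnS leq_mul2r rank_leq_col orbT.
  apply: (kerv_filtration (mpoly_filtration N C)) => a b.
  + rewrite mxE; apply: (filt_sum _ (mpoly_filtration N C)) => l _.
    rewrite -[k]add0n; apply: (filtM (mpoly_filtration N C)) => //.
    by rewrite mxE msizeC leq_b1.
  + by rewrite mxE msizeC leq_b1.
  + by rewrite mxE msizeC leq_b1.
- apply/colP => i; rewrite [RHS]mxE.
  suff : dl * (M *m V) i 0 = 0 by move/eqP; rewrite mulf_eq0 (negPf dl1) => /eqP.
  apply: mpoly_eq0 => x; rewrite mevalM.
  have [->|dlx] := eqVneq dl.@[x] 0; first by rewrite mul0r.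
  have /submxP[T TE] := rk _ dlx.
  have LMV : L *m map_mx (meval x) M *m map_mx (meval x) V = 0.
    by rewrite -(LE x) -!map_mxM mul_kerv map_mx0.
  have : map_mx (meval x) (M *m V) = 0 by rewrite map_mxM TE -mulmxA LMV mulmx0.
  by move/matrixP/(_ i 0); rewrite [map_mx _ _ _ _]mxE [X in _ = X -> _]mxE => ->; rewrite mulr0.
Qed.

Lemma generic_kernel (A : ('I_N -> C) -> Prop) (I J : finType) (k : nat)
    (M : I -> J -> {mpoly C[N]}) : mpoly_dense A ->
  (forall i j, msize (M i j) <= k.+1)%N ->
  (forall x, A x -> exists u : J -> C,
     (exists j, u j != 0) /\ forall i, \sum_j (M i j).@[x] * u j = 0) ->
  exists V : J -> {mpoly C[N]},
    [/\ exists j, V j != 0, forall j, (msize (V j) <= (#|J| * k).+1)%N &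
        forall i, \sum_j M i j * V j = 0].
Proof.
move=> Adense szM kerA.
pose Mx : 'M[{mpoly C[N]}]_(#|I|, #|J|) := \matrix_(i, j) M (enum_val i) (enum_val j).
have reidx (S : zmodType) (f : J -> S) : \sum_j f j = \sum_(i < #|J|) f (enum_val i).
  by rewrite -big_enum_val; apply: eq_bigl.
case: (@generic_kernel_mx A _ _ k Mx Adense) => [i j|x /kerA[u [[j uj] Mu]]|V [Vn0 szV MV]].
- by rewrite mxE.
- exists (\col_i u (enum_val i)).
    apply: contraNneq uj => /colP/(_ (enum_rank j)); rewrite !mxE enum_rankK => ->.
    by [].
  apply/colP => i; rewrite !mxE -[RHS](Mu (enum_val i)) reidx.
  by apply: eq_bigr => a _; rewrite !mxE.
- exists (fun j => V (enum_rank j) 0); split => //.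
    apply: contrapT => H; case/eqP: Vn0; apply/colP => i; rewrite mxE.
    apply: contrapT => /eqP Vi; apply: H; exists (enum_val i).
    by rewrite enum_valK.
  move=> i; have /colP/(_ (enum_rank i)) := MV; rewrite !mxE => H.
  rewrite -[RHS]H reidx; apply: eq_bigr => a _.
  by rewrite mxE enum_valK enum_rankK.
Qed.

End GenericKernel.

(** * Pade approximation along the lines through a point *)

Section Pade.
Variables (C : numFieldType) (N K : nat) (F : 'I_K -> {mpoly C[N]}) (i0 : 'I_K).
Variables (b : 'I_N -> C) (D : nat).
Hypothesis Fb : (F i0).@[b] != 0.

Definition low_degree_line x := exists H : 'I_K -> {poly C}, [/\ exists c, H c != 0,
    forall c, (size (H c) <= D.+1)%N &
    forall c, line b x (F i0) * H c = line b x (F c) * H i0].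

Hypothesis line_dense : mpoly_dense low_degree_line.

Definition line_expansion c : {poly {mpoly C[N]}} :=
  mmap (fun a => (a%:MP_[N])%:P) (fun j => ((b j)%:MP)%:P + ('X_j)%:P * 'X) (F c).

Lemma line_expansion_eval x c : map_poly (meval x) (line_expansion c) = line b x (F c).
Proof.
rewrite /line_expansion (rmorph_mmap (polyC \o @mpolyC N C) (map_poly (meval x))).
apply: eq_mmap => [a|j] /=; first by rewrite map_polyC /= mevalC.
by rewrite rmorphD rmorphM /= !map_polyC map_polyX /= mevalC mevalXU.
Qed.

(** Each power of s in F(b + s X) comes with exactly one factor X_j, so the degree of [F] does not
    enter. *)
Lemma line_expansion_size c l : (msize (line_expansion c)`_l <= l.+1)%N.
Proof.
have fN := mpoly_filtration N C.
(* The coefficient bound is stable under products, so it is a filtration with a dummy index. *)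
have fP : filtration (fun (_ : nat) (q : {poly {mpoly C[N]}}) =>
    forall l, msize q`_l <= l.+1)%N.
  split => //.
  - by move=> _ m; rewrite coef0 msize0.
  - by move=> m; rewrite coef1; case: m => [|m]; rewrite ?msize1 ?msize0.
  - by move=> _ x xP m; rewrite coefN msizeN.
  - by move=> _ x y xP yP m; rewrite coefD; apply: (filtD fN).
  - move=> _ _ x y xP yP m; rewrite coefM; apply: (filt_sum _ fN) => j _.
    rewrite -[X in (_ <= X.+1)%N](@subnKC j m) ?(leq_ord j) //.
    exact: (filtM fN).
have := @mmap_filtration N C _ _ (fun a => (a%:MP_[N])%:P)
  (fun j => ((b j)%:MP)%:P + ('X_j)%:P * 'X) (F c) (msize (F c)) fP.
apply => // [a|i] m.
  by rewrite coefC; case: m => [|m] /=; rewrite ?msize0 // msizeC leq_b1.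
rewrite coefD; apply: (filtD fN); first by rewrite coefC; case: m => [|m] /=; rewrite ?msize0 // msizeC leq_b1.
by rewrite coefMX coefC; case: m => [|[|m]] /=; rewrite ?msize0 // msizeX mdeg1.
Qed.

(** With H an exact solution on a line and g an approximate one, this turns the defect of g relative
    to F into its defect relative to H, whose degree is bounded. *)
Lemma cross_ratio (R : comNzRingType) (f0 fe H0 He : R) (ge g0 : R) :
  f0 * He = fe * H0 -> f0 * (ge * H0 - g0 * He) = H0 * (f0 * ge - fe * g0).
Proof.
move=> E; rewrite !mulrBr (mulrCA f0 g0) E; congr (_ - _).
  by rewrite mulrA mulrC.
by rewrite (mulrC fe H0) mulrCA (mulrC g0).
Qed.

Lemma dvdp_Xn_coef (q : {poly C}) n : (forall l, (l < n)%N -> q`_l = 0) -> 'X^n %| q.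
Proof.
move=> q0; rewrite -(poly_take_drop n q).
have -> : take_poly n q = 0.
  by apply/polyP => l; rewrite coef_take_poly coef0; case: ifP => // /q0.
by rewrite add0r dvdp_mull.
Qed.

(* Pade approximation of the ratios F_c / F_i0 along all lines through [b]: the
   coefficients of the approximants are polynomials in the direction of the line. *)
Lemma pade_family (Fh : 'I_K -> {poly {mpoly C[N]}}) :
  (forall x c, map_poly (meval x) (Fh c) = line b x (F c)) ->
  (forall c l, msize (Fh c)`_l <= l.+1)%N ->
  exists G : 'I_K -> {poly {mpoly C[N]}},
  [/\ exists c, G c != 0,
      forall c l, (msize (G c)`_l <= (K * D.+1 * (2 * D)).+1)%N &
      forall c, Fh i0 * G c = Fh c * G i0].
Proof.
move=> Fh_eval Fh_size.
(* Equations: the coefficients of s^0, ..., s^(2 D) in F_i0 G_e - F_e G_i0. Unknowns: the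
   coefficients of s^0, ..., s^D in the G_e. *)
pose I : finType := ('I_K * 'I_(2 * D).+1)%type.
pose J : finType := ('I_K * 'I_D.+1)%type.
pose M (i : I) (j : J) : {mpoly C[N]} :=
  ((Fh i0 *+ (j.1 == i.1) - Fh i.1 *+ (j.1 == i0)) * 'X^(j.2))`_(i.2).
have sumJ (S : zmodType) (f : 'I_K -> 'I_D.+1 -> S) :
    \sum_(j : J) f j.1 j.2 = \sum_c \sum_m f c m.
  by rewrite pair_big.
have delta (S : nzRingType) (a c : 'I_K) (p : S) (g : 'I_K -> S) :
    \sum_e (p *+ (e == c)) * g e = p * g c.
  rewrite (bigD1 c) //= eqxx mulr1n big1 ?addr0 // => e /negPf ->.
  by rewrite mulr0n mul0r.
case: (@generic_kernel C N low_degree_line I J (2 * D) M line_dense).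
- move=> [c l] [e m]; rewrite /M /= coefMXn; case: ifP => _; first by rewrite msize0.
  rewrite coefB !coefMn; have fN := mpoly_filtration N C.
  have sz a : (msize (Fh a)`_(l - m) <= (2 * D).+1)%N.
    by rewrite (leq_trans (Fh_size _ _)) // ltnS (leq_trans (leq_subr _ _)) // -ltnS.
  apply: (filtD fN); last apply: (filtN fN).
    by case: eqP => _; rewrite ?mulr1n ?mulr0n ?msize0.
  by case: eqP => _; rewrite ?mulr1n ?mulr0n ?msize0.
- move=> x [H [[c Hc] szH HE]].
  exists (fun j : J => (H j.1)`_(j.2)); split.
    exists (c, inord (size (H c)).-1) => /=.
    have sc : (0 < size (H c))%N by rewrite size_poly_gt0.
    by rewrite inordK ?(leq_trans _ (szH c)) // ?prednK // -lead_coefE lead_coef_eq0.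
  move=> [e l]; rewrite /M /=.
  transitivity ((line b x (F i0) * H e - line b x (F e) * H i0)`_l); last first.
    by rewrite HE subrr coef0.
  have HX a : H a = \sum_(m < D.+1) (H a)`_m *: 'X^m.
    by rewrite -poly_def; apply/esym/polyP => m; rewrite coef_poly;
       case: ltnP => // /(leq_trans (szH a)) /(nth_default 0) ->.
  rewrite -(delta _ i0 e (line b x (F i0)) H) -(delta _ i0 i0 (line b x (F e)) H).
  rewrite -sumrB coef_sum.
  rewrite (sumJ _ (fun a m => (((Fh i0 *+ (a == e) - Fh e *+ (a == i0)) * 'X^m)`_l).@[x] * (H a)`_m)).
  apply: eq_bigr => a _; rewrite -mulrBl [in RHS]HX mulr_sumr coef_sum.
  apply: eq_bigr => m _; rewrite -scalerAr coefZ mulrC; congr (_ * _).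
  by rewrite -coef_map rmorphM rmorphB !rmorphMn /= !Fh_eval map_polyXn.
move=> V [[[c m] Vcm] szV MV].
pose G e : {poly {mpoly C[N]}} := \sum_(a < D.+1) (V (e, a))%:P * 'X^a.
have GE e a : (G e)`_a = if insub a is Some a' then V (e, a') else 0.
  rewrite coef_sum; case: insubP => [a' aD aE|aD].
    rewrite (bigD1 a') //= coefCM coefXn aE eqxx mulr1 big1 ?addr0 // => j ja.
    by rewrite coefCM coefXn -aE eq_sym (negPf (_ : (j != a' :> nat))) ?mulr0 // val_eqE.
  rewrite big1 // => j _; rewrite coefCM coefXn; case: eqP => [ae|]; last by rewrite mulr0.
  by rewrite ae ltn_ord in aD.
have szG e : (size (G e) <= D.+1)%N.
  by apply/leq_sizeP => j jD; rewrite GE insubF // ltnNge jD.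
have trunc e l : (l < (2 * D).+1)%N -> (Fh i0 * G e - Fh e * G i0)`_l = 0.
  move=> lD; have := MV (e, Ordinal lD); rewrite /M /= => MVe; rewrite -[RHS]MVe.
  rewrite -(delta _ i0 e (Fh i0) G) -(delta _ i0 i0 (Fh e) G).
  rewrite -sumrB coef_sum.
  under [RHS]eq_bigr do rewrite [X in V X]surjective_pairing.
  rewrite (sumJ _ (fun a m => ((Fh i0 *+ (a == e) - Fh e *+ (a == i0)) * 'X^m)`_l * V (a, m))).
  apply: eq_bigr => a _; rewrite -mulrBl mulr_sumr coef_sum.
  by apply: eq_bigr => j _; rewrite mulrCA coefCM mulrC.
exists G; split.
- exists c; apply/eqP => /(congr1 (fun q : {poly {mpoly C[N]}} => q`_m)).
  by rewrite GE valK coef0 => /eqP; rewrite (negPf Vcm).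
- move=> e l; rewrite GE; case: insubP => [a _ _|_]; last by rewrite msize0.
  by apply: leq_trans (szV _) _; rewrite card_prod !card_ord.
move=> e; apply/eqP; rewrite -subr_eq0; apply/eqP/polyP => l; rewrite coef0.
apply: line_dense => x [H [[c' Hc'] szH HE]].
pose g a := map_poly (meval x) (G a).
have szg a : (size (g a) <= D.+1)%N by rewrite (leq_trans (size_poly _ _)).
have diffE a : map_poly (meval x) (Fh i0 * G a - Fh a * G i0) =
    line b x (F i0) * g a - line b x (F a) * g i0.
  pose phi : {rmorphism {poly {mpoly C[N]}} -> {poly C}} := map_poly (meval x).
  transitivity (phi (Fh i0 * G a - Fh a * G i0)); first by [].
  transitivity (phi (Fh i0) * phi (G a) - phi (Fh a) * phi (G i0)).
    transitivity (phi (Fh i0 * G a) - phi (Fh a * G i0)); first exact: rmorphB.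
    congr (_ - _); exact: rmorphM.
  by congr (_ * _ - _ * _); exact: Fh_eval.
have coefE a n : ((Fh i0 * G a - Fh a * G i0)`_n).@[x] =
    (line b x (F i0) * g a - line b x (F a) * g i0)`_n.
  by rewrite -diffE [RHS]coef_map.
rewrite coefE.
set f0 := line b x (F i0); set fe := line b x (F e).
have f00 : f0.[0] != 0.
  rewrite horner_line (_ : _.@[_] = (F i0).@[b]) //.
  by apply: meval_eq => j; rewrite mulr0 addr0.
have f0n0 : f0 != 0 by apply: contraNneq f00 => ->; rewrite horner0.
have H0 : H i0 != 0.
  apply: contraNneq Hc' => H0; have := HE c'; rewrite H0 mulr0 => /eqP.
  by rewrite mulf_eq0 (negPf f0n0).
have X1 : 'X^((2 * D).+1) %| f0 * g e - fe * g i0.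
  apply: dvdp_Xn_coef => a aD; by rewrite -coefE trunc // meval0.
have X2 : 'X^((2 * D).+1) %| f0 * (g e * H i0 - g i0 * H e).
  by rewrite (cross_ratio _ _ (HE e)) dvdp_mull.
(* As f0(0) is nonzero, the power of 'X divides this cross product itself, whose degree 2 D at most
   is too small for 'X^(2 D + 1). *)
have X3 : g e * H i0 - g i0 * H e = 0.
  have cop : coprimep 'X^((2 * D).+1) f0.
    by rewrite coprimep_expl // coprimep_sym -[ 'X]subr0 -polyC0 coprimep_XsubC.
  rewrite Gauss_dvdpr // in X2.
  apply: contraTeq X2 => n0; apply/negP => /(dvdp_leq n0).
  rewrite size_polyXn leqNgt => /negP; apply.
  have fP := poly_filtration C; rewrite mul2n -addnn ltnS.
  by apply: (filtD fP); last apply: (filtN fP); apply: (filtM fP).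
suff : f0 * g e - fe * g i0 = 0 by move=> ->; rewrite coef0.
have := cross_ratio (g e) (g i0) (HE e); rewrite X3 mulr0 => /esym/eqP.
by rewrite mulf_eq0 (negPf H0) => /eqP.
Qed.

(* Fix a parameter s <> 0 and put x = (v - b) / s, so that b + s x = v. *)
Lemma low_degree_parallel : exists V : 'I_K -> {mpoly C[N]},
  [/\ exists c, V c != 0,
      forall c, (msize (V c) <= (K * D.+1 * (2 * D)).+1)%N &
      forall c, F i0 * V c = F c * V i0].
Proof.
have [G [[c Gc] szG GE]] := pade_family line_expansion_eval line_expansion_size.
have [x Gx] : exists x, map_poly (meval x) (G c) != 0.
  have /mpoly_neq0P[x xP] : lead_coef (G c) != 0 by rewrite lead_coef_eq0.
  exists x; apply: contraNneq xP => /(congr1 (fun q : {poly C} => q`_(size (G c)).-1)).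
  by rewrite coef_map coef0 lead_coefE => ->.
(* The extra factor 'X forces s to be invertible. *)
have [s s0] : exists s, (map_poly (meval x) (G c) * 'X).[s] != 0.
  apply: contrapT => H; have : map_poly (meval x) (G c) * 'X = 0.
    by apply: poly_eq0_nat => k; apply: contrapT => /eqP Hk; apply: H; eexists; exact: Hk.
  by move/eqP; rewrite mulf_eq0 polyX_eq0 (negPf Gx).
move: s0; rewrite hornerM hornerX mulf_eq0 negb_or => /andP[Gs sn0].
pose h j : {mpoly C[N]} := s^-1 *: ('X_j - (b j)%:MP).
have hE v j : (h j).@[v] = s^-1 * (v j - b j) by rewrite mevalZ mevalB mevalXU mevalC.
have evalE (q : {poly {mpoly C[N]}}) v : q.[s%:MP].@[v] = (map_poly (meval v) q).[s].
  by rewrite -[in RHS](mevalC v s) horner_map.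
exists (fun e => mmap (@mpolyC N C) h (G e).[s%:MP]); split.
- exists c; apply/eqP => /(congr1 (meval (fun j => b j + x j * s))).
  rewrite meval0 meval_mmap (_ : meval _ _ = (G c).[s%:MP].@[x]).
    by rewrite evalE => /eqP; rewrite (negPf Gs).
  by apply: meval_eq => j; rewrite hE addrC addKr mulrC mulfK.
- move=> e; have fN := mpoly_filtration N C.
  apply: (mmap_filtration fN) => [a|j|].
  + by rewrite msizeC leq_b1.
  + apply: leq_trans (msizeZ_le _ _) _; apply: (filtD fN); first by rewrite msizeX mdeg1.
    by apply: (filtN fN); rewrite msizeC (leq_trans (leq_b1 _)).
  rewrite horner_coef; apply: (filt_sum _ fN) => m _; rewrite -[(_ * _)%N]addn0.
  by apply: (filtM fN) => //; rewrite -rmorphXn /= msizeC leq_b1.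
- move=> e; apply: mpoly_ext => v; rewrite !mevalM !meval_mmap.
  pose xv j := (h j).@[v].
  have Fv a : (F a).@[v] = (line_expansion a).[s%:MP].@[xv].
    rewrite evalE line_expansion_eval horner_line; apply: meval_eq => j.
    by rewrite /xv hE mulrAC mulVf // mul1r addrC subrK.
  have HM a a' : (line_expansion a * G a').[s%:MP].@[xv] =
      (line_expansion a).[s%:MP].@[xv] * (G a').[s%:MP].@[xv].
    by rewrite hornerM; exact: mevalM.
  rewrite !Fv -/xv; transitivity ((line_expansion i0 * G e).[s%:MP].@[xv]); first by rewrite HM.
  by rewrite GE HM.
Qed.

End Pade.

(** What remains is the density of the directions x allowed by [line_parallel]. They require a w
    orthogonal to b and x with independent jets; the given w1 need not be orthogonal to x, so x and
    w are deformed together. *)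
Theorem reflection_bound (C : numFieldType) (N K : nat) (F : 'I_K -> {mpoly C[N]})
    (i0 : 'I_K) (GG : ('I_K -> {mpoly C[N]}) -> Prop) :
  (2 < N)%N -> F i0 != 0 ->
  (forall G z w, GG G -> dot z w = 0 -> \sum_k (F k).@[z] * (G k).@[w] = 0) ->
  (forall U, (forall G z w, GG G -> dot z w = 0 -> \sum_k (U k).@[z] * (G k).@[w] = 0) ->
     forall k, F i0 * U k = F k * U i0) ->
  exists V : 'I_K -> {mpoly C[N]},
  [/\ exists c, V c != 0,
      forall c, (msize (V c) <= (K * (K * K).+1 * (2 * (K * K))).+1)%N &
      forall c, F i0 * V c = F c * V i0].
Proof.
move=> N3 F0 GGF GGmax.
pose j0 : 'I_N := Ordinal (ltn_trans (isT : 0 < 2)%N N3).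
have [z zP] : exists z, (zeta F i0 j0).@[z] != 0.
  apply: mpoly_neq0P; rewrite /zeta mulf_neq0 //.
  by rewrite -msize_poly_eq0 msizeX mdeg1.
have [|k [r [kK [d [b [w1 [dP bw1 free]]]] rkmax]]] := @rk_stable C N K F i0 j0 GG.
  exists z, (fun=> 0); split => //; rewrite /dot big1 // => i _.
  by rewrite mulr0.
have rK : (r <= K)%N.
  by rewrite -(eqP free) rank_leq_col.
have Fb : (F i0).@[b] != 0.
  by case: bw1 => _; rewrite /zeta mevalM mulf_eq0 negb_or => /andP[].
apply: (@low_degree_parallel _ _ _ _ _ b (K * K) Fb) => p pA.
apply: mpoly_eq0 => x.
(* Two linear conditions on more than two unknowns, by [2 < N]. *)
have [w2 w2n0 [bw2 xw2]] : exists2 w2 : 'I_N -> C, exists j, w2 j != 0 &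
    dot b w2 = 0 /\ dot x w2 = 0.
  pose A : 'M[C]_(N, 2) := \matrix_(i, j) (if j == 0 then b i else x i).
  have /rowV0Pn[v vA vn0] : kermx A != 0.
    rewrite kermx_eq0 /row_free neq_ltn (leq_ltn_trans (rank_leq_col _)) //.
  move/sub_kermxP: vA => vA; exists (fun i => v 0 i).
    apply: contrapT => H; case/eqP: vn0; apply/rowP => i; rewrite mxE.
    by apply: contrapT => /eqP vi; apply: H; exists i.
  by split; [have /rowP/(_ 0) := vA|have /rowP/(_ 1) := vA]; rewrite !mxE => H;
     rewrite -[RHS]H; apply: eq_bigr => i _; rewrite !mxE /= mulrC.
have [j w2j] := w2n0.
pose y i := (i == j)%:R / w2 j.
have yw2 : dot y w2 = 1.
  rewrite /dot (bigD1 j) //= big1 => [|i /negPf ij]; last by rewrite /y ij !mul0r.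
  by rewrite /y eqxx mul1r mulVf // addr0.
(* w moves inside b^perp from w2 at t = 0 to w1 at t = 1, and x moves to [xt t], which stays
   orthogonal to w because y.w2 = 1. Independence at t = 1 gives it for generic t; so p vanishes at
   [xt t] for generic t, hence at x = [xt 0]. *)
pose v i := w1 i - w2 i.
pose wt t i := w2 i + v i * t.
have dotwt u t : dot u (wt t) = dot u w2 + t * dot u v by rewrite dotC dotDl ![dot _ u]dotC.
have dotv u : dot u v = dot u w1 - dot u w2.
  by rewrite /dot -sumrB; apply: eq_bigr => i _; rewrite mulrBr.
pose xd i := dot y v * x i - dot x v * y i.
pose xt t i := x i + xd i * t.
have dotxt t : dot (xt t) (wt t) = 0.
  rewrite /xt dotDl (dotwt x) xw2 add0r.
  have -> : dot xd (wt t) = dot y v * dot x (wt t) - dot x v * dot y (wt t).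
    rewrite /dot !mulr_sumr -sumrB; apply: eq_bigr => i _.
    by rewrite /xd mulrBl !mulrA.
  rewrite !dotwt xw2 yw2 add0r -mulrDr; set X := dot x v; set Y := dot y v.
  rewrite [X * _]mulrDr mulr1 [X * (t * Y)]mulrCA [Y * (t * X)]mulrCA [Y * X]mulrC.
  by rewrite opprD addrCA (addrA X) subrr add0r subrr mulr0.
have bwt t : dot b (wt t) = 0.
  by rewrite dotwt dotv bw2 (proj1 bw1) subr0 mulr0 addr0.
pose Mp : 'M[{poly C}]_(r, K) := \matrix_(i, c) line w2 v (jet b (d i).1 ((d i).2 c)).
have MpE t : map_mx (horner_eval t) Mp = jetmx d b (wt t).
  by apply/matrixP => i c; rewrite !mxE /horner_eval horner_line.
have /row_freeP[E ME] := free.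
pose Ep : 'M[{poly C}]_(K, r) := map_mx (@polyC C) E.
have EpE t : map_mx (horner_eval t) Ep = E.
  by apply/matrixP => a c; rewrite !mxE /horner_eval hornerC.
pose dl := \det (Mp *m Ep).
have dlE t : dl.[t] = \det (jetmx d b (wt t) *m E).
  by rewrite -/(horner_eval t dl) -(det_map_mx (horner_eval t)) map_mxM MpE EpE.
have dln0 : dl != 0.
  apply/eqP => /(congr1 (fun q : {poly C} => q.[1])); rewrite horner0 dlE.
  have -> : jetmx d b (wt 1) = jetmx d b w1.
    apply/matrixP => i c; rewrite !mxE; apply: meval_eq => a.
    by rewrite /wt /v mulr1 addrC subrK.
  by rewrite ME det1 => /eqP; rewrite oner_eq0.
have pl0 : line x xd p = 0.
  apply: (poly_eq0_generic dln0) => t dlt; rewrite horner_line; apply: pA.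
  apply: (line_parallel GGF GGmax rkmax dP rK kK _ (dotxt t)).
    by split; [exact: bwt|case: bw1].
  by apply: (@row_free_mulmx1 _ _ _ _ E); rewrite -dlE.
have := congr1 (fun q : {poly C} => q.[0]) pl0.
rewrite horner_line horner0 => p0; rewrite -[RHS]p0; apply: meval_eq => i.
by rewrite mulr0 addr0.
Qed.

(** * Hermitian polynomials *)

Section MnmPair.
Variable N : nat.

Lemma mnm_pair_lshift (a b : 'X_{1..N}) j : mnm_pair a b (lshift N j) = a j.
Proof. by rewrite mnmE (unsplitK (inl j)). Qed.

Lemma mnm_pair_rshift (a b : 'X_{1..N}) j : mnm_pair a b (rshift N j) = b j.
Proof. by rewrite mnmE (unsplitK (inr j)). Qed.

Lemma mnm_pair_inj (a b a' b' : 'X_{1..N}) :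
  (mnm_pair a b == mnm_pair a' b') = (a == a') && (b == b').
Proof.
apply/eqP/andP => [/mnmP E|[/eqP -> /eqP ->] //]; split; apply/eqP/mnmP => j.
  by have := E (lshift N j); rewrite !mnm_pair_lshift.
by have := E (rshift N j); rewrite !mnm_pair_rshift.
Qed.

Lemma mnm_pair_surj (m : 'X_{1..N + N}) : exists a b, m = mnm_pair a b.
Proof.
exists [multinom m (lshift N j) | j < N], [multinom m (rshift N j) | j < N].
apply/mnmP => i; rewrite mnmE -[in LHS](splitK i); case: (split i) => j /=.
  by rewrite mnmE.
by rewrite mnmE.
Qed.

Lemma mdeg_mnm_pair (a b : 'X_{1..N}) : mdeg (mnm_pair a b) = (mdeg a + mdeg b)%N.
Proof.
rewrite !mdegE big_split_ord /=; congr (_ + _)%N; apply: eq_bigr => j _.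
  by rewrite mnm_pair_lshift.
by rewrite mnm_pair_rshift.
Qed.

End MnmPair.

Section HermitianPolynomials.
Variables (R : realType) (N : nat).
Local Notation C := (R[i]).
Implicit Types (p q : hpoly R N) (f g : {mpoly C[N]}) (z w : 'I_N -> C).

Lemma hpolyP p q : (forall a b, hcoef p a b = hcoef q a b) -> p = q.
Proof.
by move=> pq; apply/mpolyP => m; have [a [b ->]] := mnm_pair_surj m; exact: pq.
Qed.

(* Unlike in [heval], the values of z and w^bar are independent. *)
Definition hval p z w : C :=
  p.@[fun i => match split i with inl j => z j | inr j => w j end].

Lemma hevalE p z : heval p z = hval p z (fun j => (z j)^*).
Proof. by []. Qed.

Definition liftl f : hpoly R N := mmap (@mpolyC (N + N) C) (fun j => 'X_(lshift N j)) f.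
Definition liftr f : hpoly R N := mmap (@mpolyC (N + N) C) (fun j => 'X_(rshift N j)) f.

Lemma liftlZ c f : liftl (c *: f) = c *: liftl f.
Proof. by rewrite /liftl mmapZ mul_mpolyC. Qed.

Lemma liftrZ c f : liftr (c *: f) = c *: liftr f.
Proof. by rewrite /liftr mmapZ mul_mpolyC. Qed.

Lemma liftl_sum (I : Type) (r : seq I) (P : pred I) (F : I -> {mpoly C[N]}) :
  liftl (\sum_(i <- r | P i) F i) = \sum_(i <- r | P i) liftl (F i).
Proof. exact: (raddf_sum (mmap _ _)). Qed.

Lemma liftr_sum (I : Type) (r : seq I) (P : pred I) (F : I -> {mpoly C[N]}) :
  liftr (\sum_(i <- r | P i) F i) = \sum_(i <- r | P i) liftr (F i).
Proof. exact: (raddf_sum (mmap _ _)). Qed.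

Lemma hval_liftl f z w : hval (liftl f) z w = f.@[z].
Proof.
rewrite /hval /liftl meval_mmap; apply: meval_eq => j.
by rewrite mevalXU (unsplitK (inl j)).
Qed.

Lemma hval_liftr f z w : hval (liftr f) z w = f.@[w].
Proof.
rewrite /hval /liftr meval_mmap; apply: meval_eq => j.
by rewrite mevalXU (unsplitK (inr j)).
Qed.

Lemma hvalM p q z w : hval (p * q) z w = hval p z w * hval q z w.
Proof. exact: mevalM. Qed.

Lemma hvalZ c p z w : hval (c *: p) z w = c * hval p z w.
Proof. exact: mevalZ. Qed.

Lemma hvalB p q z w : hval (p - q) z w = hval p z w - hval q z w.
Proof. exact: mevalB. Qed.

Lemma hval_sum (I : Type) (r : seq I) (P : pred I) (F : I -> hpoly R N) z w :
  hval (\sum_(i <- r | P i) F i) z w = \sum_(i <- r | P i) hval (F i) z w.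
Proof. exact: meval_sum. Qed.

Lemma hval_ext p q : (forall z w, hval p z w = hval q z w) -> p = q.
Proof.
move=> pq; apply: mpoly_ext => v.
have E r : r.@[v] = hval r (fun j => v (lshift N j)) (fun j => v (rshift N j)).
  by apply: meval_eq => i; rewrite -[in LHS](splitK i); case: (split i).
by rewrite !E pq.
Qed.

Lemma mpolyX_pair (a b : 'X_{1..N}) :
  'X_[mnm_pair a b] = liftl 'X_[a] * liftr 'X_[b] :> hpoly R N.
Proof.
rewrite /liftl /liftr !mmapX /mmap1 mpolyXE_id big_split_ord /=; congr (_ * _).
  by apply: eq_bigr => j _; rewrite mnm_pair_lshift.
by apply: eq_bigr => j _; rewrite mnm_pair_rshift.
Qed.

Lemma hcoef_sum (I : Type) (r : seq I) (P : pred I) (F : I -> hpoly R N) a b :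
  hcoef (\sum_(i <- r | P i) F i) a b = \sum_(i <- r | P i) hcoef (F i) a b.
Proof. exact: (raddf_sum (mcoeff _)). Qed.

Lemma hcoefZ c p a b : hcoef (c *: p) a b = c * hcoef p a b.
Proof. exact: mcoeffZ. Qed.

Lemma hcoefX (a b a' b' : 'X_{1..N}) :
  hcoef ('X_[mnm_pair a b] : hpoly R N) a' b' = ((a == a') && (b == b'))%:R.
Proof. by rewrite /hcoef mcoeffX mnm_pair_inj. Qed.

Lemma hcoef_lift f g a b : hcoef (liftl f * liftr g) a b = f@_a * g@_b.
Proof.
have lE : liftl f = \sum_(m <- msupp f) f@_m *: liftl 'X_[m].
  by rewrite [f in LHS]mpolyE liftl_sum; apply: eq_bigr => m _; exact: liftlZ.
have rE : liftr g = \sum_(m <- msupp g) g@_m *: liftr 'X_[m].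
  by rewrite [g in LHS]mpolyE liftr_sum; apply: eq_bigr => m _; exact: liftrZ.
rewrite lE rE mulr_suml hcoef_sum [in RHS](mpolyE f) [in RHS](mpolyE g).
rewrite !(raddf_sum (mcoeff _)) mulr_suml; apply: eq_bigr => m _ /=.
rewrite !mulr_sumr hcoef_sum; apply: eq_bigr => l _ /=.
rewrite -scalerAl -scalerAr !hcoefZ -mpolyX_pair hcoefX !mcoeffZ !mcoeffX.
by rewrite mulrA mulrACA -natrM mulnb.
Qed.

Definition conjp f : {mpoly C[N]} := map_mpoly Num.conj f.

Lemma mcoeff_conjp f a : (conjp f)@_a = (f@_a)^*.
Proof. exact: mcoeff_map_mpoly. Qed.

Lemma meval_conjp f z : (conjp f).@[z] = (f.@[fun j => (z j)^*])^*.
Proof.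
rewrite /conjp /map_mpoly (rmorph_mmap (@mpolyC N C \o Num.conj) (meval z)).
rewrite [in RHS]/meval (rmorph_mmap idfun Num.conj).
apply: eq_mmap => [c|j] /=; first by rewrite mevalC.
by rewrite mevalXU conjCK.
Qed.

Lemma conjp_eq0 f : (conjp f == 0) = (f == 0).
Proof.
apply/eqP/eqP => [f0|->].
  apply/mpolyP => m; have := congr1 (mcoeff m) f0.
  by rewrite mcoeff_conjp !mcoeff0 => /(congr1 Num.conj); rewrite conjCK conjC0.
by apply/mpolyP => m; rewrite mcoeff_conjp !mcoeff0 conjC0.
Qed.

End HermitianPolynomials.

(** * Polarization and density of the null cone *)

Section Polarization.
Variables (R : realType) (N : nat).
Local Notation C := (R[i]).

(** After the substitution z = a + i b, w = a - i b the polynomial vanishes at all real (a, b),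
    which already makes it zero. The substitution is linear and invertible. *)
Lemma polarization (p : hpoly R N) : (forall z, heval p z = 0) -> p = 0.
Proof.
move=> p0.
pose h (i : 'I_(N + N)) : hpoly R N := match split i with
  | inl j => 'X_(lshift N j) + ('i : C) *: 'X_(rshift N j)
  | inr j => 'X_(lshift N j) - ('i : C) *: 'X_(rshift N j) end.
have hE v i : (h i).@[v] = match split i with
    | inl j => v (lshift N j) + 'i * v (rshift N j)
    | inr j => v (lshift N j) - 'i * v (rshift N j) end.
  by rewrite /h; case: (split i) => j; rewrite ?mevalB ?mevalD mevalZ !mevalXU.
pose p' := mmap (@mpolyC (N + N) C) h p.
have p'0 : p' = 0.
  apply/eqP/negPn/negP => /(mpoly_nonzero (@natr_inj _))[k [e]].
  set v := fun _ => _; rewrite /p' meval_mmap -(p0 (fun j => v (lshift N j) + 'i * v (rshift N j))).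
  have vr i : (v i)^* = v i by rewrite /v rmorphXn /= conjC_nat.
  move/eqP; apply; apply: meval_eq => i; rewrite hE; case: (split i) => j //.
  by rewrite rmorphD rmorphM /= !vr conjCi mulNr.
apply: hval_ext => z w; rewrite {2}/hval meval0.
pose v (i : 'I_(N + N)) : C := match split i with
  | inl j => (z j + w j) / 2 | inr j => (z j - w j) / (2 * 'i) end.
have <- : p'.@[v] = 0 by rewrite p'0 meval0.
rewrite /p' meval_mmap; apply: meval_eq => i; rewrite hE.
have n2 : (2 : C) != 0 by rewrite pnatr_eq0.
have ni : ('i : C) != 0 by rewrite neq0Ci.
have half (a b : C) : (a + b) / 2 + (a - b) / 2 = a.
  by rewrite -mulrDl addrACA subrr addr0 -mulr2n -[a *+ 2]mulr_natr mulfK.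
have half' (a b : C) : (a + b) / 2 - (a - b) / 2 = b.
  by rewrite -mulNr -mulrDl opprB [b - a]addrC addrACA subrr add0r -mulr2n -[b *+ 2]mulr_natr mulfK.
have ci (a : C) : 'i * (a / (2 * 'i)) = a / 2.
  by rewrite invfM mulrCA (mulrCA 'i) mulfV // mulr1.
case: (split i) => j; rewrite /v (unsplitK (inl j)) (unsplitK (inr j)) ci.
  by rewrite half.
by rewrite half'.
Qed.

End Polarization.

Section NullCone.
Variables (R : realType) (n : nat).
Local Notation C := (R[i]).

(** Turns the polarized r into the bilinear product z.w, for which the reflection argument is
    stated. *)
Definition flip (w : 'I_n.+1 -> C) (j : 'I_n.+1) : C := if j == ord_max then - w j else w j.

Lemma flipK w : flip (flip w) =1 w.
Proof. by move=> j; rewrite /flip; case: eqP => // _; rewrite opprK. Qed.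

Lemma conj_flip w j : (flip w j)^* = flip (fun j => (w j)^*) j.
Proof. by rewrite /flip; case: eqP => // _; rewrite rmorphN. Qed.

Lemma hval_rpoly z w : hval (rpoly R n) z w = dot z (flip w).
Proof.
rewrite /rpoly hvalB hval_sum hvalM /dot big_ord_recr /=; congr (_ + _).
  apply: eq_bigr => j _; rewrite hvalM /hval !mevalXU.
  rewrite (unsplitK (inl _)) (unsplitK (inr _)) /flip; case: eqP => // /(congr1 val) /= E.
  by have := ltn_ord j; rewrite E ltnn.
by rewrite /hval !mevalXU (unsplitK (inl _)) (unsplitK (inr _)) /flip eqxx mulrN.
Qed.

(** Cayley transforms of the natural numbers: infinitely many explicit points of the unit circle. *)
Definition circle_point (k : nat) : C := (1 + 'i * k%:R) / (1 - 'i * k%:R).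

Lemma circle_den k : 1 - 'i * k%:R != 0 :> C.
Proof.
rewrite subr_eq0; apply/eqP => /(congr1 (fun x => x ^+ 2)) /eqP.
rewrite expr1n exprMn sqrCi mulN1r -addr_eq0 -natrX.
by rewrite -(natrD C 1) pnatr_eq0.
Qed.

Lemma circle_pointJ k : circle_point k * (circle_point k)^* = 1.
Proof.
have d0 := circle_den k.
have d0' : 1 + 'i * k%:R != 0 :> C.
  rewrite -(inj_eq (can_inj conjCK)) conjC0 rmorphD rmorphM /= conjC1 conjCi conjC_nat.
  by rewrite mulNr.
rewrite /circle_point rmorphM fmorphV /= rmorphB rmorphD rmorphM /= conjC1 conjCi conjC_nat.
by rewrite mulNr opprK mulrACA -invfM [X in _ * X^-1]mulrC mulfV // mulf_neq0.
Qed.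

Lemma circle_point_inj : injective circle_point.
Proof.
move=> a b /eqP; rewrite eqr_div ?circle_den // => /eqP E.
have i0 : 'i * 2 != 0 :> C by rewrite mulf_neq0 ?neq0Ci ?pnatr_eq0.
apply/eqP; rewrite -(eqr_nat C); apply/eqP/(mulfI i0).
set x : C := a%:R in E *; set y : C := b%:R in E *.
apply/eqP; rewrite -subr_eq0; apply/eqP.
transitivity ((1 + 'i * x) * (1 - 'i * y) - (1 + 'i * y) * (1 - 'i * x)); first by ring.
by rewrite E subrr.
Qed.

(** The null cone contains the torus |z_j| = 1 for j at most n, |z_{n+1}| = sqrt n. After rescaling,
    a polynomial vanishing on it vanishes at all tuples of powers of circle points, hence is 0. *)
Lemma null_cone_dense (f : {mpoly C[n.+1]}) :
  (forall z, dot z (flip (fun j => (z j)^*)) = 0 -> f.@[z] = 0) -> (0 < n)%N -> f = 0.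
Proof.
move=> f0 n0.
pose rho (j : 'I_n.+1) : C := if j == ord_max then sqrtC n%:R else 1.
have rho0 j : rho j != 0.
  by rewrite /rho; case: (j == _); rewrite ?oner_neq0 // sqrtC_eq0 pnatr_eq0 -lt0n.
have rhor j : (rho j)^* = rho j.
  rewrite /rho; case: (j == _); last by rewrite conjC1.
  by apply: conj_Creal; rewrite ger0_real // sqrtC_ge0 ler0n.
pose g := mmap (@mpolyC n.+1 C) (fun j => rho j *: 'X_j) f.
have gE v : g.@[v] = f.@[fun j => rho j * v j].
  by rewrite meval_mmap; apply: meval_eq => j; rewrite mevalZ mevalXU.
have g0 : g = 0.
  apply/eqP/negPn/negP => /(mpoly_nonzero circle_point_inj)[k [e]].
  rewrite gE f0 ?eqxx // /dot big_ord_recr /= /flip eqxx mulrN.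
  have zz (t c : C) m : t^* = t -> c * c^* = 1 -> (t * c ^+ m) * (t * c ^+ m)^* = t ^+ 2.
    move=> tr cc; rewrite rmorphM rmorphXn /= tr mulrACA -exprMn cc expr1n mulr1.
    by rewrite expr2.
  rewrite (zz _ _ _ (rhor _) (circle_pointJ k)) /rho eqxx sqrtCK.
  rewrite (eq_bigr (fun=> 1)) ?sumr_const ?card_ord ?subrr // => j _.
  have jm : (widen_ord (leqnSn n) j == ord_max) = false.
    by apply/eqP => /(congr1 val) /= E; have := ltn_ord j; rewrite E ltnn.
  rewrite jm; apply: etrans (zz 1 _ _ _ (circle_pointJ k)) _; last by rewrite expr1n.
  exact: conjC1.
apply: mpoly_eq0 => v.
have := gE (fun j => v j / rho j); rewrite g0 meval0 => E; rewrite -[RHS]/0 [RHS]E.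
by apply: meval_eq => j; rewrite mulrC mulfVK.
Qed.

End NullCone.

(** * Spectral decomposition of the coefficient matrix *)

Section Spectral.
Variables (R : realType).
Local Notation C := (R[i]).

Lemma char_poly_conj (k : nat) (P D : 'M[C]_k) : P \in unitmx ->
  char_poly (invmx P *m D *m P) = char_poly D.
Proof.
move=> Pu; rewrite /char_poly /char_poly_mx.
have PP : map_mx (@polyC C) (invmx P) *m map_mx (@polyC C) P = 1%:M.
  by rewrite -map_mxM mulVmx // map_mx1.
have -> : 'X%:M - map_mx (@polyC C) (invmx P *m D *m P) =
  map_mx (@polyC C) (invmx P) *m ('X%:M - map_mx (@polyC C) D) *m map_mx (@polyC C) P.
  by rewrite mulmxBr mulmxBl !map_mxM scalar_mxC -(mulmxA 'X%:M) PP mulmx1.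
by rewrite !det_mulmx mulrAC -det_mulmx PP det1 mul1r.
Qed.

Lemma eigenvalues_diag (k : nat) (M : 'M[C]_k) (P : 'M[C]_k) (d : 'rV[C]_k) :
  P \in unitmx -> M = invmx P *m diag_mx d *m P ->
  perm_eq (eigenvalues M) [seq d 0 i | i <- enum 'I_k].
Proof.
move=> Pu ME; rewrite /eigenvalues; case: closed_field_poly_normal => r /= rE.
apply: prod_XsubC_eq; move: rE; rewrite (monicP (char_poly_monic M)) scale1r => <-.
rewrite ME char_poly_conj // char_poly_trig ?diag_mx_is_trig // big_map big_enum /=.
by apply: eq_bigr => i _; rewrite mxE eqxx mulr1n.
Qed.

Variable N : nat.
Implicit Types (p : hpoly R N).

Definition hsum (K : nat) (lam : 'I_K -> C) (F : 'I_K -> {mpoly C[N]}) : hpoly R N :=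
  \sum_k lam k *: (liftl (F k) * liftr (conjp (F k))).

Lemma hval_hsum (K : nat) (lam : 'I_K -> C) (F : 'I_K -> {mpoly C[N]}) z w :
  hval (hsum lam F) z w = \sum_k lam k * ((F k).@[z] * (conjp (F k)).@[w]).
Proof.
rewrite /hsum hval_sum.
apply: eq_bigr => k _.
rewrite hvalZ; congr (_ * _).
rewrite hvalM; congr (_ * _).
  exact: hval_liftl.
exact: hval_liftr.
Qed.

Lemma hcoef_hsum (K : nat) (lam : 'I_K -> C) (F : 'I_K -> {mpoly C[N]}) a b :
  hcoef (hsum lam F) a b = \sum_k lam k * ((F k)@_a * ((F k)@_b)^*).
Proof.
by rewrite /hsum hcoef_sum; apply: eq_bigr => k _; rewrite hcoefZ hcoef_lift mcoeff_conjp.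
Qed.

Lemma hcoef_small p a b : hcoef p a b != 0 -> (mdeg a < msize p)%N /\ (mdeg b < msize p)%N.
Proof.
rewrite /hcoef -mcoeff_msupp => /msize_mdeg_lt; rewrite mdeg_mnm_pair => H.
by split; apply: leq_ltn_trans H; rewrite ?leq_addr ?leq_addl.
Qed.

(** The F_k are read off a unitary diagonalization. An eigenvector with nonzero eigenvalue lies in
    the range of the matrix, whose rows vanish outside degree [d]; this gives homogeneity. *)
Lemma spectral_hsum p d : hermitian_symmetric p -> bihomogeneous d p ->
  exists k (lam : 'I_k -> C) (F : 'I_k -> {mpoly C[N]}),
    [/\ forall i, (lam i)^* = lam i,
        forall i, lam i != 0 -> F i \is d.-homog,
        p = hsum lam F &
        perm_eq (eigenvalues (coef_matrix p)) [seq lam i | i <- enum 'I_k]].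
Proof.
move=> hp bp; set M := coef_matrix p.
have ME i j : M i j = hcoef p (enum_val i : 'X_{1..N < msize p})
   (enum_val j : 'X_{1..N < msize p}) by rewrite mxE.
have Mh : M \is hermsymmx.
  by apply/is_hermitianmxP; rewrite expr0 scale1r; apply/matrixP => i j; rewrite !mxE hp.
have Mn := hermitian_normalmx Mh.
have [P [sp [Pu MPE PV spr]]] : exists (P : 'M[C]_#|{: 'X_{1..N < msize p}}|) sp,
    [/\ P \in unitmx, M = invmx P *m diag_mx sp *m P,
        invmx P = (P ^t Num.conj)%sesqui & forall i, (sp 0 i)^* = sp 0 i].
  exists (spectralmx M), (spectral_diag M); split.
  - exact: spectral_unit.
  - exact/orthomx_spectralP.
  - exact/invmx_unitary/spectral_unitarymx.
  - by move=> i; have /mxOverP/(_ 0 i) := hermitian_spectral_diag_real Mh; exact: conj_Creal.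
pose F k : {mpoly C[N]} := \sum_i (P k i)^* *: 'X_[(enum_val i : 'X_{1..N < msize p})].
have FE k (a : 'X_{1..N < msize p}) : (F k)@_a = (P k (enum_rank a))^*.
  rewrite /F (raddf_sum (mcoeff _)) (bigD1 (enum_rank a)) //= big1 => [|i ia].
    by rewrite mcoeffZ mcoeffX enum_rankK eqxx mulr1 addr0.
  rewrite mcoeffZ mcoeffX; case: eqP => [E|]; last by rewrite mulr0.
  by case/eqP: ia; rewrite -(enum_valK i); congr enum_rank; apply/val_inj.
have F0 k (a : 'X_{1..N}) : (msize p <= mdeg a)%N -> (F k)@_a = 0.
  move=> ap; rewrite /F (raddf_sum (mcoeff _)) big1 // => i _ /=.
  rewrite mcoeffZ mcoeffX; case: eqP => [E|]; last by rewrite mulr0.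
  by have := bmdeg (enum_val i); rewrite E ltnNge ap.
exists #|{: 'X_{1..N < msize p}}|, (fun i => sp 0 i), F; split.
- exact: spr.
- move=> k spk; apply/dhomogP => a; rewrite mcoeff_msupp => Fa.
  have ap : (mdeg a < msize p)%N by rewrite ltnNge; apply: contra Fa => /F0 ->.
  have aE : a = BMultinom ap by [].
  move: Fa; rewrite aE FE => Fa.
  have : M *m invmx P = invmx P *m diag_mx sp.
    by rewrite [in LHS]MPE mulmxK.
  move/matrixP/(_ (enum_rank (BMultinom ap)) k).
  rewrite mul_mx_diag PV [X in X = _ -> _]mxE [X in _ = X -> _]mxE => E.
  have : \sum_j M (enum_rank (BMultinom ap)) j * (P ^t Num.conj)%sesqui j k != 0.
    by rewrite E mulf_neq0 // 2!mxE.
  move=> n0; have [j Mj] : exists j, M (enum_rank (BMultinom ap)) j != 0.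
    apply: contrapT => H; case/eqP: n0; apply: big1 => j _.
    have [->|Mj] := eqVneq (M (enum_rank (BMultinom ap)) j) 0; first by rewrite mul0r.
    by case: H; exists j.
  by move: Mj; rewrite ME enum_rankK => /bp[].
- apply: hpolyP => a b; rewrite hcoef_hsum.
  have [ap|ap] := leqP (msize p) (mdeg a).
    rewrite big1 => [|k _]; last by rewrite F0 // mul0r mulr0.
    by apply: contrapT => /eqP /hcoef_small[]; rewrite ltnNge ap.
  have [bpp|bpp] := leqP (msize p) (mdeg b).
    rewrite big1 => [|k _]; last by rewrite [(F k)@_b]F0 // conjC0 !mulr0.
    by apply: contrapT => /eqP /hcoef_small[_]; rewrite ltnNge bpp.
  have -> : hcoef p a b = M (enum_rank (BMultinom ap)) (enum_rank (BMultinom bpp)).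
    by rewrite ME !enum_rankK.
  rewrite MPE mul_mx_diag PV !mxE; apply: eq_bigr => k _; rewrite !mxE.
  rewrite (FE k (BMultinom ap)) (FE k (BMultinom bpp)) conjCK.
  by rewrite mulrA; congr (_ * _); rewrite mulrC.
- exact: eigenvalues_diag MPE.
Qed.

(** Zero eigenvalues are dropped, so that the number of terms is A + B and does not grow with the
    degree. *)
Lemma signature_hsum p d A B : hermitian_symmetric p -> bihomogeneous d p ->
  signature_pair p = (A, B) ->
  exists (lam : 'I_(A + B) -> C) (F : 'I_(A + B) -> {mpoly C[N]}),
    [/\ forall i, F i \is d.-homog, p = hsum lam F &
        forall i : 'I_(A + B), if (i < A)%N then 0 < lam i else lam i < 0].
Proof.
move=> hp bp [cA cB].
have [k [mu [G [mur Gh pE pe]]]] := spectral_hsum hp bp.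
pose e1 := [seq i <- enum 'I_k | 0 < mu i]; pose e2 := [seq i <- enum 'I_k | mu i < 0].
have s1 : size e1 = A.
  by rewrite size_filter -cA (permP pe) [RHS]count_map.
have s2 : size e2 = B.
  by rewrite size_filter -cB (permP pe) [RHS]count_map.
have s12 : size (e1 ++ e2) == (A + B)%N by rewrite size_cat s1 s2.
pose t := Tuple s12.
have tP (i : 'I_(A + B)) : if (i < A)%N then 0 < mu (tnth t i) else mu (tnth t i) < 0.
  rewrite (tnth_nth (tnth t i)) /= nth_cat s1; case: ltnP => iA.
    by have := mem_nth (tnth t i) (_ : i < size e1)%N; rewrite s1 => /(_ iA); rewrite mem_filter => /andP[].
  have iB : (i - A < size e2)%N by rewrite s2 ltn_subLR.
  by have := mem_nth (tnth t i) iB; rewrite mem_filter => /andP[].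
exists (fun i => mu (tnth t i)), (fun i => G (tnth t i)); split => //.
- move=> i; apply: Gh; have := tP i; case: ifP => _ h; first by rewrite gt_eqF.
  by rewrite lt_eqF.
- rewrite pE /hsum -(big_tuple _ _ t xpredT (fun i => mu i *: (liftl (G i) * liftr (conjp (G i))))) /=.
  rewrite big_cat /= !big_filter !big_enum_cond /=.
  rewrite (bigID (fun i => 0 < mu i)) /=; congr (_ + _).
  rewrite [LHS](bigID (fun i => mu i < 0)) /= [X in _ + X]big1 ?addr0 => [|i].
    apply: eq_bigl => i; rewrite andb_idl // => mi; by rewrite -real_leNgt ?(ltW mi) ?real0 // CrealE mur.
  move=> /andP[n1 n2]; have mr : mu i \is Num.real by rewrite CrealE mur.
  move: n1 n2; rewrite -!real_leNgt ?real0 // => n1 n2.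
  by rewrite (le_anti (_ : mu i <= 0 <= mu i)) ?scale0r // n1 n2.
Qed.

End Spectral.

(** * Definite multiples of r and reflection for one exceptional eigenvalue *)

Section Reflecting.
Variables (R : realType) (n : nat).
Local Notation C := (R[i]).
Implicit Types (p : hpoly R n.+1) (z w : 'I_n.+1 -> C).

Lemma signature0 : signature_pair (0 : hpoly R n.+1) = (0%N, 0%N).
Proof.
have ME : coef_matrix (0 : hpoly R n.+1) = invmx 1%:M *m diag_mx 0 *m 1%:M.
  rewrite (_ : diag_mx 0 = 0) ?mulmx0 ?mul0mx; last by apply/matrixP => i j; rewrite !mxE mul0rn.
  by apply/matrixP => i j; rewrite !mxE; exact: mcoeff0.
have H := eigenvalues_diag (unitmx1 _ _) ME.
rewrite /signature_pair !(permP H) !count_map /=.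
by rewrite !(eq_count (a2 := pred0)) ?count_pred0 // => i; rewrite /= mxE ltxx.
Qed.

Lemma Iset_vanish p z w : Iset (rpoly R n) p -> dot z (flip w) = 0 -> hval p z w = 0.
Proof. by move=> [_ [q ->]] zw; rewrite hvalM hval_rpoly zw mul0r. Qed.

Lemma hval_hsum_diag (K : nat) (lam : 'I_K -> C) (F : 'I_K -> {mpoly C[n.+1]}) z :
  hval (hsum lam F) z (fun j => (z j)^*) = \sum_k lam k * ((F k).@[z] * ((F k).@[z])^*).
Proof.
rewrite hval_hsum; apply: eq_bigr => k _; congr (_ * (_ * _)).
by rewrite meval_conjp; congr (_^*); apply: meval_eq => j; rewrite conjCK.
Qed.

(** The sign [s] lets positive and negative definite forms share one argument. *)
Lemma sum_sq_eq0 (I : finType) (P : pred I) (s : C) (lam v : I -> C) :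
  (forall k, P k -> 0 < s * lam k) -> \sum_(k | P k) lam k * (v k * (v k)^*) = 0 ->
  forall k, P k -> v k = 0.
Proof.
move=> lamP S0 k Pk.
have : \sum_(k | P k) (s * lam k) * (v k * (v k)^*) = 0.
  under eq_bigr do rewrite -mulrA.
  by rewrite -mulr_sumr S0 mulr0.
move/psumr_eq0P => H; have /eqP := H (fun i Pi => mulr_ge0 (ltW (lamP i Pi)) (mul_conjC_ge0 _)) k Pk.
by rewrite mulf_eq0 gt_eqF ?lamP //= mul_conjC_eq0 => /eqP.
Qed.

Lemma definite_multiple_eq0 (K : nat) (s : C) (lam : 'I_K -> C) (F : 'I_K -> {mpoly C[n.+1]}) :
  (0 < n)%N -> (forall k, 0 < s * lam k) -> Iset (rpoly R n) (hsum lam F) -> hsum lam F = 0.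
Proof.
move=> n0 lamP IF; rewrite /hsum big1 // => k _.
suff -> : F k = 0 by rewrite (_ : liftl 0 = 0) ?mul0r ?scaler0 //; exact: (raddf0 (mmap _ _)).
apply: null_cone_dense n0 => z zz; have := Iset_vanish IF zz.
rewrite hval_hsum_diag => /(sum_sq_eq0 (P := xpredT) (fun k _ => lamP k)); exact.
Qed.

Definition flipp (f : {mpoly C[n.+1]}) : {mpoly C[n.+1]} :=
  mmap (@mpolyC n.+1 C) (fun j => if j == ord_max then - 'X_j else 'X_j) f.

Lemma meval_flipp f w : (flipp f).@[w] = f.@[flip w].
Proof.
rewrite /flipp meval_mmap; apply: meval_eq => j; rewrite /flip.
by case: (j == _); rewrite ?mevalN mevalXU.
Qed.

Lemma dot_conj z w : (dot z w)^* = dot (fun j => (z j)^*) (fun j => (w j)^*).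
Proof. by rewrite /dot rmorph_sum; apply: eq_bigr => j _; rewrite rmorphM. Qed.

Lemma dot_flip z w : dot (flip z) (flip w) = dot z w.
Proof.
by apply: eq_bigr => j _; rewrite /flip; case: (j == _) => //; rewrite mulrNN.
Qed.

Lemma isotropic_combination (I : finType) (lam u f : I -> C) (a b : C) :
  \sum_c lam c * (u c * (u c)^*) = 0 -> \sum_c lam c * (u c * (f c)^*) = 0 ->
  \sum_c lam c * (f c * (u c)^*) = 0 -> \sum_c lam c * (f c * (f c)^*) = 0 ->
  \sum_c lam c * ((a * u c - b * f c) * (a * u c - b * f c)^*) = 0.
Proof.
move=> uu uf fu ff.
transitivity (a * a^* * (\sum_c lam c * (u c * (u c)^*))
  - a * b^* * (\sum_c lam c * (u c * (f c)^*))
  - b * a^* * (\sum_c lam c * (f c * (u c)^*))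
  + b * b^* * (\sum_c lam c * (f c * (f c)^*))); last first.
  by rewrite uu uf fu ff !mulr0 !subr0 addr0.
rewrite !mulr_sumr -!sumrB -big_split; apply: eq_bigr => c _ /=.
rewrite rmorphB !(rmorphM Num.conj) /=.
move: (u c) (f c) (lam c) => x y l; move: (x^*) (y^*) (a^*) (b^*) => x' y' a' b'.
by ring.
Qed.

Lemma proportional_sq_sum (I : finType) (lam f g : I -> C) (a b : C) :
  (forall k, b * g k = f k * a) ->
  `|a| ^+ 2 * (\sum_k lam k * (f k * (f k)^*)) = `|b| ^+ 2 * (\sum_k lam k * (g k * (g k)^*)).
Proof.
move=> E; rewrite !normCK !mulr_sumr; apply: eq_bigr => k _.
rewrite mulrCA [RHS]mulrCA; congr (_ * _).
by rewrite mulrACA [RHS]mulrACA -!(rmorphM Num.conj) E [a * _]mulrC.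
Qed.

Section OneNegative.
Variables (K : nat) (lam : 'I_K -> C) (F : 'I_K -> {mpoly C[n.+1]}) (k0 : 'I_K) (s : C).
Hypothesis n_gt0 : (0 < n)%N.
Hypothesis lam_real : forall k, (lam k)^* = lam k.
(** Used with [s] equal to 1 for B = 1 and to -1 for A = 1; [k0] is the exceptional index. *)
Hypothesis lam_pos : forall k, k != k0 -> 0 < s * lam k.
Hypothesis IF : Iset (rpoly R n) (hsum lam F).

Let GG (G : 'I_K -> {mpoly C[n.+1]}) :=
  forall z w, dot z w = 0 -> \sum_k (F k).@[z] * (G k).@[w] = 0.

Let sharp (U : 'I_K -> {mpoly C[n.+1]}) k : {mpoly C[n.+1]} :=
  lam k *: flipp (conjp (U k)).

Let sharpE U k w : (sharp U k).@[w] = lam k * ((U k).@[fun j => (flip w j)^*])^*.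
Proof. by rewrite mevalZ meval_flipp meval_conjp. Qed.

Let GG_sharpF : GG (sharp F).
Proof.
move=> z w zw; rewrite -[RHS](@Iset_vanish _ z (flip w) IF).
  rewrite hval_hsum; apply: eq_bigr => k _.
  by rewrite mevalZ mulrCA meval_flipp.
by rewrite -[RHS]zw /dot; apply: eq_bigr => j _; rewrite flipK.
Qed.

(** [U] is orthogonal to the reflection of [F], which is in GG. Conjugating this relation and
    exchanging z and w through the reflection makes [F] orthogonal to the reflection of [U]. *)
Let GG_sharp U : (forall G z w, GG G -> dot z w = 0 -> \sum_k (U k).@[z] * (G k).@[w] = 0) ->
  GG (sharp U).
Proof.
move=> HU z w zw.
pose z' j := (flip w j)^*; pose w' := flip (fun j => (z j)^*).
have zw' : dot z' w' = 0.
  rewrite -[RHS]conjC0 -[X in X^*]zw dot_conj dotC -[RHS]dot_flip.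
  by apply: eq_bigr => j _; rewrite /z' conj_flip.
have := HU _ _ _ GG_sharpF zw' => /(congr1 Num.conj); rewrite conjC0 => H.
rewrite -[RHS]H rmorph_sum; apply: eq_bigr => k _.
have FE : (F k).@[fun j => (flip w' j)^*] = (F k).@[z].
  by apply: meval_eq => j; rewrite flipK conjCK.
rewrite !sharpE FE !(rmorphM Num.conj) /= lam_real conjCK -/z'.
by rewrite mulrCA [RHS]mulrCA [X in _ * X = _]mulrC.
Qed.

(* On the null cone the vectors F(z) and U(z) span an isotropic subspace, which is
   at most a line as the form has a single negative (or positive) direction. *)
Lemma reflected_parallel U :
  (forall G z w, GG G -> dot z w = 0 -> \sum_k (U k).@[z] * (G k).@[w] = 0) ->
  forall k, F k0 * U k = F k * U k0.
Proof.
move=> HU k; apply/eqP; rewrite -subr_eq0; apply/eqP.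
apply: null_cone_dense n_gt0 => z zz.
pose w := flip (fun j => (z j)^*).
have sh V c : (sharp V c).@[w] = lam c * ((V c).@[z])^*.
  by rewrite sharpE; congr (_ * _^*); apply: meval_eq => j; rewrite flipK conjCK.
have T (f g : 'I_K -> {mpoly C[n.+1]}) : \sum_c (f c).@[z] * (sharp g c).@[w] = 0 ->
    \sum_c lam c * ((f c).@[z] * ((g c).@[z])^*) = 0.
  by move=> fg; rewrite -[RHS]fg; apply: eq_bigr => c _; rewrite sh mulrCA.
have TUU := T _ _ (HU _ _ _ (GG_sharp HU) zz).
have TUF := T _ _ (HU _ _ _ GG_sharpF zz).
have TFU := T _ _ (GG_sharp HU zz).
have TFF := T _ _ (GG_sharpF zz).
pose a := (F k0).@[z]; pose b := (U k0).@[z].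
pose v c := a * (U c).@[z] - b * (F c).@[z].
have T0 : \sum_c lam c * (v c * (v c)^*) = 0 := isotropic_combination a b TUU TUF TFU TFF.
have v0 : v k0 = 0 by rewrite /v -/a -/b mulrC subrr.
have vk : v k = 0.
  have [->//|kk] := eqVneq k k0.
  apply: (sum_sq_eq0 (P := fun k => k != k0) (s := s) (lam := lam)) => //.
  by move: T0; rewrite (bigD1 k0) //= v0 mul0r mulr0 add0r.
by rewrite mevalB !mevalM -[RHS]vk /v -/a -/b; congr (_ - _); rewrite mulrC.
Qed.

Lemma pihomogM (f g : {mpoly C[n.+1]}) d e : f \is d.-homog ->
  pihomog mdeg (d + e) (f * g) = f * pihomog mdeg e g.
Proof.
move=> fd; pose k := maxn (msize g) e.+1.
rewrite [in LHS](pihomog_partitionE (leq_maxl (msize g) e.+1)) mulr_sumr raddf_sum /=.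
rewrite (bigD1 (Ordinal (leq_maxr (msize g) e.+1))) //= big1 => [|i ie].
  by rewrite addr0 pihomog_dE // dhomogM // pihomogP.
apply: (@pihomog_ne0 _ _ _ (d + i)); last by rewrite dhomogM // pihomogP.
by rewrite eqn_add2l.
Qed.

(** The bounded vector V need not be homogeneous, but [F] is, so passing to components of one degree
    e preserves F_k0 V_k = F_k V_k0. The choice of e as degree of the leading monomial of V_k0 keeps
    this component nonzero. *)
Lemma bounded_equiv_degree d : (2 <= n)%N -> F k0 != 0 -> (forall k, F k \is d.-homog) ->
  exists e, (e <= K * (K * K).+1 * (2 * (K * K)))%N /\
    bihom_equiv_degree (hsum lam F) e.
Proof.
move=> n2 F0 Fh.
have [V [[c Vc] szV VF]] : exists V : 'I_K -> {mpoly C[n.+1]},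
  [/\ exists c, V c != 0,
      forall c, (msize (V c) <= (K * (K * K).+1 * (2 * (K * K))).+1)%N &
      forall c, F k0 * V c = F c * V k0].
  apply: (@reflection_bound C n.+1 K F k0 GG) => //; last exact: reflected_parallel.
  by move=> G z w; exact.
have V0 : V k0 != 0.
  apply: contraNneq Vc => Vk0; have : F k0 * V c = 0 by rewrite VF Vk0; exact: mulr0.
  by move/mpolyM_eq0 => /(_ F0)/eqP.
pose e := mdeg (mlead (V k0)).
pose W k := pihomog mdeg e (V k).
have We k : W k \is e.-homog by exact: pihomogP.
have W0 : W k0 != 0.
  apply/eqP => W0; have lV : (mdeg (mlead (V k0)) < msize (V k0))%N by rewrite mlead_deg.
  have := congr1 (mcoeff (mlead (V k0))) (pihomog_partitionE (leqnn (msize (V k0)))).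
  rewrite (raddf_sum (mcoeff _)) big1 => [/eqP|i _ /=]; first by rewrite mleadc_eq0 (negPf V0).
  have [ie|ie] := eqVneq (i : nat) e; first by rewrite ie -/(W k0) W0 mcoeff0.
  by apply: (dhomog_nemf_coeff (pihomogP _ _ _)); rewrite eq_sym.
have WF k : F k0 * W k = F k * W k0.
  by rewrite /W -(pihomogM (V k) e (Fh k0)) -(pihomogM (V k0) e (Fh k)) VF.
exists e; split.
  by rewrite -ltnS (leq_trans _ (szV k0)) // mlead_deg.
exists (hsum lam W); split.
- move=> a b; rewrite !hcoef_hsum rmorph_sum; apply: eq_bigr => k _.
  by rewrite !(rmorphM Num.conj) /= conjCK lam_real [_^* * _]mulrC.
- move=> a b; rewrite hcoef_hsum => S0.
  have [k Wk] : exists k, lam k * ((W k)@_a * ((W k)@_b)^*) != 0.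
    apply: contrapT => H; case/eqP: S0; apply: big1 => k _.
    by apply: contrapT => /eqP Hk; apply: H; exists k.
  move: Wk; rewrite !mulf_eq0 !negb_or conjC_eq0 => /and3P[_ Wa Wb].
  by split; apply: (dhomog_mf (We k)); rewrite mcoeff_msupp.
- exists (W k0), (F k0); split; [exact: W0|exact: F0|move=> z].
  transitivity (`|(W k0).@[z]| ^+ 2 * \sum_k lam k * ((F k).@[z] * ((F k).@[z])^*)).
    by congr (_ * _); exact: hval_hsum_diag.
  transitivity (`|(F k0).@[z]| ^+ 2 * \sum_k lam k * ((W k).@[z] * ((W k).@[z])^*)).
    apply: proportional_sq_sum => k; have := congr1 (meval z) (WF k).
    by rewrite (mevalM z (F k0)) (mevalM z (F k)).
  by congr (_ * _); rewrite -hval_hsum_diag.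
Qed.

End OneNegative.

End Reflecting.

(** * The rank of a multiple of r *)

Lemma dhomog_meval (F : fieldType) (N d : nat) (f : {mpoly F[N]}) (c : F) (v : 'I_N -> F) :
  f \is d.-homog -> f.@[fun j => c * v j] = c ^+ d * f.@[v].
Proof.
move=> fd; rewrite !mevalE mulr_sumr big_seq [RHS]big_seq; apply: eq_bigr => m mf.
rewrite mulrCA; congr (_ * _); under eq_bigr do rewrite exprMn.
rewrite big_split /= prodrXr -mdegE; congr (_ ^+ _ * _).
exact: (dhomog_mf fd).
Qed.

Section RankBound.
Variables (R : realType) (n : nat).
Local Notation C := (R[i]).
Variables (K d : nat) (lam : 'I_K -> C) (F : 'I_K -> {mpoly C[n.+1]}).
Hypothesis Fh : forall k, F k \is d.-homog.
Hypothesis IF : Iset (rpoly R n) (hsum lam F).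
Hypothesis p_neq0 : hsum lam F != 0.

Let p := hsum lam F.

(** Rows of Z against columns of its adjugate are dual bases up to the factor det Z, and depend
    polynomially on Z. *)
Let pairing (i l : 'I_n.+1) (Z : 'M[C]_n.+1) : C :=
  hval p (fun j => Z i j) (flip (fun j => \adj Z j l)).

Let pairing_off i l Z : i != l -> pairing i l Z = 0.
Proof.
move=> il; apply: (Iset_vanish IF).
rewrite -[LHS]/(dot _ (flip (flip _))).
have -> : dot (fun j => Z i j) (flip (flip (fun j => \adj Z j l))) = (Z *m \adj Z) i l.
  by rewrite mxE; apply: eq_bigr => j _; rewrite flipK.
by rewrite mul_mx_adj mxE (negPf il) mulr0n.
Qed.

Let hval_scale c z w : hval p z (fun j => c * w j) = c ^+ d * hval p z w.
Proof.
rewrite !hval_hsum mulr_sumr; apply: eq_bigr => k _.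
rewrite (_ : (conjp (F k)).@[_] = c ^+ d * (conjp (F k)).@[w]).
  by rewrite [RHS]mulrCA; congr (_ * _); rewrite mulrCA.
apply: dhomog_meval; apply/dhomogP => m; rewrite mcoeff_msupp mcoeff_conjp conjC_eq0 => Fm.
by apply: (dhomog_mf (Fh k)); rewrite mcoeff_msupp.
Qed.

(** Take p(z, w) and w_i nonzero and u = [flip w]; then z.u is nonzero, since p vanishes on z.u = 0.
    If row i of Z is z and the other rows form a basis of u^perp, column i of the adjugate is a
    multiple of u. *)
Let pairing_neq0 i : exists Z, pairing i i Z != 0.
Proof.
have [v] : exists v, (p * 'X_(rshift n.+1 i)).@[v] != 0.
  apply: mpoly_neq0P; apply/eqP => /mpolyM_eq0 => /(_ p_neq0)/eqP.
  by rewrite -msize_poly_eq0 msizeX mdeg1.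
rewrite mevalM mevalXU mulf_eq0 negb_or => /andP[pv vi].
pose z j := v (lshift n.+1 j); pose w j := v (rshift n.+1 j).
have {pv} pzw : hval p z w != 0.
  rewrite (_ : hval p z w = p.@[v]) //; apply: meval_eq => j.
  by rewrite -[in RHS](splitK j); case: (split j).
pose u := flip w.
have ui : u i != 0 by rewrite /u /flip; case: ifP; rewrite ?oppr_eq0.
have zu : dot z u != 0.
  by apply: contraNneq pzw => zu; apply/eqP; apply: (Iset_vanish IF).
pose Z : 'M[C]_n.+1 := \matrix_(l, j)
  if l == i then z j else (l == j)%:R - u l / u i * (j == i)%:R.
have Zrow (x : 'I_n.+1 -> C) l : \sum_j Z l j * x j =
    if l == i then dot z x else x l - u l / u i * x i.
  case: ifP => li; first by apply: eq_bigr => j _; rewrite mxE li.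
  under eq_bigr do rewrite mxE li mulrBl.
  rewrite sumrB; congr (_ - _).
    rewrite (bigD1 l) //= big1 => [|j /negPf jl]; last by rewrite eq_sym jl mul0r.
    by rewrite eqxx mul1r addr0.
  rewrite (bigD1 i) //= big1 => [|j /negPf ->]; last by rewrite mulr0 mul0r.
  by rewrite eqxx mulr1 addr0.
have Zu : Z *m (\col_j u j) = dot z u *: delta_mx i 0.
  apply/colP => l; rewrite !mxE eqxx andbT.
  transitivity (\sum_j Z l j * u j); first by apply: eq_bigr => j _; rewrite !mxE.
  rewrite Zrow; case: eqP => [_|_]; first by rewrite mulr1.
  by rewrite mulr0 mulfVK // subrr.
have detZ : \det Z != 0.
  rewrite -det_tr; apply/det0P => -[x xn0 /rowP xZ]; case/eqP: xn0.
  have xP l : (if l == i then dot z (x 0) else x 0 l - u l / u i * x 0 i) = 0.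
    rewrite -Zrow; have := xZ l; rewrite !mxE => H; rewrite -[RHS]H.
    by apply: eq_bigr => j _; rewrite !mxE mulrC.
  have xu l : x 0 l = x 0 i / u i * u l.
    have [->|li] := eqVneq l i; first by rewrite mulfVK.
    by have := xP l; rewrite (negPf li) => /eqP; rewrite subr_eq0 => /eqP ->; rewrite mulrC mulrA mulrAC.
  have := xP i; rewrite eqxx.
  have -> : dot z (x 0) = x 0 i / u i * dot z u.
    by rewrite /dot mulr_sumr; apply: eq_bigr => j _; rewrite xu mulrCA.
  move/eqP; rewrite !mulf_eq0 (negPf zu) orbF invr_eq0 (negPf ui) orbF => /eqP xi.
  by apply/rowP => l; rewrite xu xi !mul0r mxE.
exists Z; rewrite /pairing.
have adjE j : \adj Z j i = \det Z / dot z u * u j.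
  have := congr1 (mulmx (\adj Z)) Zu; rewrite mulmxA mul_adj_mx mul_scalar_mx -scalemxAr.
  move/colP/(_ j); rewrite mxE [RHS]mxE -colE !mxE => E.
  by apply: (mulfI zu); rewrite -E [RHS]mulrC mulrAC mulfVK.
have -> : hval p (fun j => Z i j) (flip (fun j => \adj Z j i)) =
    hval p z (fun j => \det Z / dot z u * w j).
  apply: meval_eq => j; case: (split j) => l; first by rewrite mxE eqxx.
  by rewrite /flip adjE /u /flip; case: (l == _); rewrite // mulrN opprK.
by rewrite hval_scale mulf_neq0 // expf_neq0 // mulf_neq0 // invr_eq0.
Qed.

Let pairing_line i (Z D : 'M[C]_n.+1) : exists h : {poly C},
  forall t, h.[t] = pairing i i (Z + t *: D).
Proof.
pose Zp : 'M[{poly C}]_n.+1 := map_mx (@polyC C) Z + 'X *: map_mx (@polyC C) D.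
pose arg (a : 'I_(n.+1 + n.+1)) : {poly C} := match split a with
  | inl j => Zp i j
  | inr j => if j == ord_max then - \adj Zp j i else \adj Zp j i end.
exists (mmap (@polyC C) arg p) => t; rewrite horner_mmap.
have ZpE : map_mx (horner_eval t) Zp = Z + t *: D.
  by apply/matrixP => a b; rewrite !mxE /horner_eval !hornerE.
have adjE j : (\adj Zp j i).[t] = \adj (Z + t *: D) j i.
  by rewrite -ZpE -map_mx_adj [RHS]mxE.
apply: meval_eq => a; rewrite /arg; case: (split a) => j.
  by rewrite -ZpE [RHS]mxE.
by rewrite /flip -adjE; case: (j == _) => //; rewrite hornerN.
Qed.

(** On the line from Z1 to Z each pairing is a nonzero polynomial in the parameter, so some
    parameter avoids the zeros of all of them. *)
Let pairing_common (s : seq 'I_n.+1) : exists Z, forall i, i \in s -> pairing i i Z != 0.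
Proof.
elim: s => [|i s [Z ZP]]; first by exists 0.
have [Z1 Z1P] := pairing_neq0 i.
have /choice[h hE] := fun l => pairing_line l Z1 (Z - Z1).
have qn0 : \prod_(l <- i :: s) h l != 0.
  rewrite prodf_seq_neq0; apply/allP => l ls /=.
  move: ls; rewrite inE => /predU1P[->|ls].
    apply: contraNneq Z1P => hi; have := hE i 0.
    by rewrite hi horner0 scale0r addr0 => <-.
  apply: contraNneq (ZP _ ls) => hl; have := hE l 1.
  by rewrite hl horner0 scale1r addrC subrK => <-.
have [t tP] : exists t, (\prod_(l <- i :: s) h l).[t] != 0.
  apply: contrapT => H; case/eqP: qn0; apply: poly_eq0_nat => m.
  by apply: contrapT => /eqP Hm; apply: H; eexists; exact: Hm.
exists (Z1 + t *: (Z - Z1)) => l ls; rewrite -hE.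
move: tP; rewrite horner_prod prodf_seq_neq0 => /allP/(_ l ls).
by [].
Qed.

(* Let z_i and w_j run over dual bases: the matrix of values p(z_i, w_j) vanishes off
   the diagonal, and its diagonal entries do not vanish for a generic choice. *)
Lemma hsum_rank : (n.+1 <= K)%N.
Proof.
have [Z ZP] := pairing_common (enum 'I_n.+1).
pose A : 'M[C]_(n.+1, K) := \matrix_(i, k) (lam k * (F k).@[fun j => Z i j]).
pose B : 'M[C]_(K, n.+1) := \matrix_(k, l) (conjp (F k)).@[flip (fun j => \adj Z j l)].
have ABE : A *m B = diag_mx (\row_i pairing i i Z).
  apply/matrixP => i l; rewrite !mxE.
  transitivity (pairing i l Z).
    by rewrite /pairing hval_hsum; apply: eq_bigr => k _; rewrite !mxE mulrA.
  by have [->|il] := eqVneq i l; rewrite ?mulr1n // pairing_off.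
have : \rank (A *m B) = n.+1.
  apply: mxrank_unit; rewrite unitmxE unitfE ABE det_diag prodf_seq_neq0.
  by apply/allP => i _ /=; rewrite mxE ZP // mem_enum.
by move=> <-; apply: leq_trans (mxrankM_maxl _ _) (rank_leq_col _).
Qed.

End RankBound.

(** * Diagonal multiples of r *)

Section CoefficientCount.
Variables (R : realDomainType) (N : nat) (P : pred R).
Hypothesis P0 : P 0 = false.

Definition coef_count (c : {mpoly R[N]}) : nat := count (fun m => P c@_m) (msupp c).

Lemma coef_countD (p q : {mpoly R[N]}) :
  (forall m, m \in msupp p -> m \notin msupp q) ->
  coef_count (p + q) = (coef_count p + coef_count q)%N.
Proof.
move=> dis; rewrite /coef_count.
have dis' : [predI msupp p & msupp q] =1 xpred0.
  by move=> m /=; case: (boolP (m \in msupp p)) => //= /dis/negPf ->.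
rewrite (permP (msuppD dis')) count_cat; congr (_ + _)%N; apply: eq_in_count => m mp.
  by rewrite mcoeffD (memN_msupp_eq0 (dis _ mp)) addr0.
have mNp : m \notin msupp p by apply/negP => /dis; rewrite mp.
by rewrite mcoeffD (memN_msupp_eq0 mNp) add0r.
Qed.

Lemma coef_countMX (p : {mpoly R[N]}) m : coef_count (p * 'X_[m]) = coef_count p.
Proof.
rewrite /coef_count (permP (msuppMX p m)) count_map; apply: eq_count => l /=.
by rewrite mcoeffMX.
Qed.

Lemma coef_countX a m : coef_count (a *: 'X_[m] : {mpoly R[N]}) = P a.
Proof.
have [->|an0] := eqVneq a 0; first by rewrite scale0r /coef_count msupp0 /= P0.
by rewrite /coef_count msuppMCX //= mcoeffZ mcoeffX eqxx mulr1 addn0.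
Qed.

Lemma coef_count_sumX (a : R) (I : eqType) (s : seq I) (f : I -> 'X_{1..N}) :
  injective f -> uniq s ->
  coef_count (\sum_(j <- s) a *: 'X_[f j] : {mpoly R[N]}) = (size s * P a)%N.
Proof.
move=> f_inj; elim: s => [|j s IH] /=; first by rewrite big_nil /coef_count msupp0.
move=> /andP[js us]; rewrite big_cons coef_countD ?coef_countX ?IH ?mulSn // => m.
rewrite !mcoeff_msupp mcoeffZ mcoeffX; case: (f j =P m) => [<- _|_]; last by rewrite mulr0 eqxx.
rewrite negbK (raddf_sum (mcoeff _)) big_seq big1 // => l ls /=.
rewrite mcoeffZ mcoeffX; case: (f l =P f j) => [/f_inj lj|]; last by rewrite mulr0.
by rewrite -lj ls in js.
Qed.

End CoefficientCount.

(** * Multiples of s with prescribed numbers of positive and negative coefficients *)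

Section Chain.
Variables (R : realFieldType) (n : nat).
Hypothesis n_gt0 : (0 < n)%N.

Local Notation P := {mpoly R[n.+1]}.

Definition fin_var (j : 'I_n) : 'I_n.+1 := widen_ord (leqnSn n) j.

(* [rpoly] in the variables x_j = |z_j|^2; called s below. *)
Definition spoly : P := \sum_(j < n) 'X_(fin_var j) - 'X_ord_max.

Definition npos := @coef_count R n.+1 (fun x => 0 < x).
Definition nneg := @coef_count R n.+1 (fun x => x < 0).

Definition top d : 'X_{1..n.+1} := (U_(ord0) *+ d)%MM.
Definition last d : 'X_{1..n.+1} := (U_(ord_max) *+ d)%MM.

Lemma fin_var_max j : fin_var j != ord_max.
Proof. by apply/eqP => /(congr1 val) /= E; have := ltn_ord j; rewrite E ltnn. Qed.

Lemma ord0_max : (ord0 : 'I_n.+1) != ord_max.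
Proof. by rewrite -val_eqE /= eq_sym -lt0n. Qed.

Lemma spolyM m : 'X_[m] * spoly = \sum_(j < n) 'X_[m + U_(fin_var j)] - 'X_[m + U_(ord_max)].
Proof.
rewrite /spoly mulrBr mulr_sumr -mpolyXD; congr (_ - _).
by apply: eq_bigr => j _; rewrite -mpolyXD.
Qed.

Lemma spoly_homog : spoly \is 1.-homog.
Proof.
rewrite /spoly rpredB //; last by rewrite dhomogX /= mdeg1.
by apply: rpred_sum => j _; rewrite dhomogX /= mdeg1.
Qed.

(* A multiple of s of degree d, with [A] positive and [B] negative coefficients,
   ready for the next move: the sign of its coefficient of x_1^d is recorded. *)
Definition chain (sg : bool) (A B : nat) : Prop := exists (d : nat) (c : P),
  [/\ (0 < d)%N /\ c \is d.-homog, exists q, c = spoly * q, c@_(last d) != 0,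
      npos c = A /\ nneg c = B & if sg then 0 < c@_(top d) else c@_(top d) < 0].

Lemma coef_count_block (Q : pred R) (a : R) m : Q 0 = false ->
  coef_count Q (\sum_(j < n) a *: 'X_[m + U_(fin_var j)] : P) = (n * Q a)%N.
Proof.
move=> Q0; rewrite (@coef_count_sumX _ _ _ Q0 a _ _ (fun j => m + U_(fin_var j))%MM).
- by rewrite -[index_enum _]/(Finite.enum _) -enumT size_enum_ord.
- move=> i j /eqP; rewrite eqm_add2l eq_mnm1 => /eqP /(congr1 val) /= ij.
  exact: val_inj.
- exact: index_enum_uniq.
Qed.

(** The move changes just one old coefficient, that of x_1^d x_{n+1}, from t to t - a. It creates n
    coefficients a at the x_1^d x_j, which are free of x_{n+1} and so do not meet x_{n+1} c. The
    count is stated additively to avoid truncated subtraction. *)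
Lemma chain_move d (c : P) (a : R) (t := c@_(top d)) :
  (0 < d)%N -> c \is d.-homog -> (exists q, c = spoly * q) -> c@_(last d) != 0 ->
  a != 0 ->
  let c' := c * 'X_[U_(ord_max)] + a *: ('X_[top d] * spoly) in
  [/\ c' \is d.+1.-homog, exists q, c' = spoly * q, c'@_(last d.+1) != 0,
      c'@_(top d.+1) = a &
      forall Q : pred R, Q 0 = false ->
        (coef_count Q c' + Q t = coef_count Q c + Q (t - a)%R + n * Q a)%N].
Proof.
move=> d0 ch [q cq] cl an0 c'.
have topD e : top e.+1 = (top e + U_(ord0))%MM by rewrite /top mulmSr.
have topmax e : top e ord_max = 0%N by rewrite mulmnE mnm1E (negPf ord0_max).
have topm e : mdeg (top e) = e by rewrite /top mdegMn mdeg1 mul1n.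
have lastm e : mdeg (last e) = e by rewrite /last mdegMn mdeg1 mul1n.
have lastmax e : last e ord_max = e by rewrite mulmnE mnm1E eqxx mul1n.
have sE : c' = (c - t *: 'X_[top d]) * 'X_[U_(ord_max)]
   + ((t - a) *: 'X_[top d + U_(ord_max)]
   + \sum_(j < n) a *: 'X_[top d + U_(fin_var j)]).
  rewrite /c' spolyM scalerBr scaler_sumr mulrBl -scalerAl -mpolyXD scalerBl.
  move: (c * _) (t *: _) (\sum_(_ < n) _) (a *: _) => x y z w.
  by rewrite -!addrA; congr (_ + _); rewrite !addrA addNr add0r addrC.
have coefmax (m : 'X_{1..n.+1}) :
    m \in msupp (\sum_(j < n) a *: 'X_[top d + U_(fin_var j)] : P) -> m ord_max = 0%N.
  rewrite mcoeff_msupp => mc; apply/eqP; apply: contraNT mc => mmax.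
  rewrite (raddf_sum (mcoeff m)) big1 // => j _ /=; rewrite mcoeffZ mcoeffX.
  case: (_ =P m) => [mE|]; last by rewrite mulr0.
  by case/eqP: mmax; rewrite -mE mnmDE topmax mnm1E (negPf (fin_var_max j)).
have mulmax (f : P) m : m \in msupp (f * 'X_[U_(ord_max)]) -> (0 < m ord_max)%N.
  rewrite (perm_mem (msuppMX _ _)) => /mapP[l _ ->].
  by rewrite mnmDE mnm1E eqxx.
split.
- rewrite /c' -[d.+1]addn1 rpredD //; first by rewrite dhomogM // dhomogX /= mdeg1.
  by apply: rpredZ; apply: dhomogM; [rewrite dhomogX; apply/eqP; exact: topm|exact: spoly_homog].
- exists (q * 'X_[U_(ord_max)] + a *: 'X_[top d]).
  by rewrite [RHS]mulrDr [spoly * (q * _)]mulrA -cq -scalerAr [spoly * 'X_[top d]]mulrC.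
- rewrite /c' mcoeffD (_ : last d.+1 = U_(ord_max) + last d)%MM; last by rewrite /last mulmS.
  rewrite mcoeffMX spolyM mcoeffZ mcoeffB mcoeffX.
  have -> : (top d + U_(ord_max) == U_(ord_max) + last d)%MM = false.
    rewrite addmC eqm_add2l; apply/eqP => /mnmP/(_ ord_max).
    by rewrite topmax lastmax => d0'; rewrite -d0' in d0.
  rewrite (raddf_sum (mcoeff _)) big1 ?subr0 ?mulr0 ?addr0 // => j _ /=.
  rewrite mcoeffX; case: (_ =P _) => // /mnmP/(_ ord_max).
  by rewrite !mnmDE topmax lastmax !mnm1E eqxx (negPf (fin_var_max j)).
- rewrite sE !mcoeffD memN_msupp_eq0; last first.
    by apply/negP => /mulmax; rewrite topmax.
  rewrite mcoeffZ mcoeffX (_ : _ == _ = false) ?mulr0 ?add0r; last first.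
    by rewrite topD eqm_add2l eq_mnm1 eq_sym (negPf ord0_max).
  rewrite (raddf_sum (mcoeff _)) (bigD1 (Ordinal n_gt0)) //= big1 => [|j j0].
    rewrite addr0 mcoeffZ mcoeffX (_ : _ == _ = true) ?mulr1 //.
    by rewrite topD eqm_add2l eq_mnm1.
  rewrite mcoeffZ mcoeffX (_ : _ == _ = false) ?mulr0 //.
  by rewrite topD eqm_add2l eq_mnm1 -val_eqE /=; apply: negPf; move: j0; rewrite -val_eqE.
- move=> Q Q0; set f := c - t *: 'X_[top d] in sE.
  have ftop : top d \notin msupp f.
    by rewrite mcoeff_msupp negbK mcoeffB mcoeffZ mcoeffX eqxx mulr1 subrr.
  have cE : coef_count Q c = (coef_count Q f + Q t)%N.
    rewrite -(coef_countX Q0 t (top d)) -coef_countD ?subrK // => m mf.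
    by apply/negP => /msuppZ_le; rewrite msuppX inE => /eqP mE; rewrite -mE mf in ftop.
  rewrite sE coef_countD; last first.
    move=> m mm; apply/negP => /msuppD_le; rewrite mem_cat => /orP[/msuppZ_le|/coefmax m0].
      rewrite msuppX inE => /eqP mE; move: mm; rewrite mE (perm_mem (msuppMX _ _)).
      by move=> /mapP[l lf /eqP]; rewrite addmC eqm_add2l => /eqP le; rewrite le lf in ftop.
    by have := mulmax _ _ mm; rewrite m0.
  rewrite coef_countMX [coef_count Q (_ *: _ + _)]coef_countD; last first.
    move=> m /msuppZ_le; rewrite msuppX inE => /eqP ->; apply/negP => /coefmax.
    by rewrite mnmDE mnm1E eqxx addn1.
  rewrite coef_countX // coef_count_block // cE -!addnA; congr (_ + _)%N.
  by rewrite addnA addnC.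
Qed.

Lemma spoly_count : npos spoly = n /\ nneg spoly = 1%N.
Proof.
have sE : spoly = \sum_(j < n) 1 *: 'X_[0 + U_(fin_var j)] + (-1) *: 'X_ord_max.
  by rewrite scaleN1r; congr (_ - _); apply: eq_bigr => j _; rewrite scale1r add0m.
have dis m : m \in msupp (\sum_(j < n) 1 *: 'X_[0 + U_(fin_var j)] : P) ->
    m \notin msupp ((-1) *: 'X_ord_max : P).
  rewrite mcoeff_msupp => mc; apply/negP => /msuppZ_le; rewrite msuppX inE => /eqP mE.
  case/eqP: mc; rewrite (raddf_sum (mcoeff m)) big1 // => j _ /=.
  by rewrite mE mcoeffZ mcoeffX add0m eq_mnm1 (negPf (fin_var_max j)) mulr0.
rewrite /npos /nneg sE !(coef_countD _ dis) !coef_count_block ?ltxx // !coef_countX ?ltxx //.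
by rewrite ltr01 ltr10 ltrN10 ltr0N1 muln1 muln0 addn0.
Qed.

Lemma chain_start : chain true n 1.
Proof.
exists 1%N, spoly; split.
- by split=> //; exact: spoly_homog.
- by exists 1; rewrite mulr1.
- rewrite mcoeffB (raddf_sum (mcoeff _)) big1 => [|j _ /=].
    by rewrite /last mulm1n mcoeffX eqxx sub0r oppr_eq0 oner_eq0.
  by rewrite /last mulm1n mcoeffX eq_mnm1 (negPf (fin_var_max j)).
- exact: spoly_count.
- rewrite mcoeffB (raddf_sum (mcoeff _)) (bigD1 (Ordinal n_gt0)) //= big1 => [|j j0].
    rewrite /top mulm1n !mcoeffX !eq_mnm1 [ord_max == _]eq_sym (negPf ord0_max).
    by rewrite (_ : _ == _ = true) ?subr0 ?addr0 ?ltr01.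
  rewrite /top mulm1n mcoeffX eq_mnm1 (_ : _ == _ = false) //.
  by rewrite -val_eqE /=; apply: negPf; move: j0; rewrite -val_eqE.
Qed.

(* The next polynomial is x_{n+1} c + al x_1^d s. *)
Lemma chain_step (sg sg' : bool) A B A' B' (al : R) :
  (forall t : R, (if sg then 0 < t else t < 0) ->
     let a := al * t in
     [/\ if sg' then 0 < a else a < 0,
        (A' + (0 < t)%R = A + (0 < t - a)%R + n * (0 < a)%R)%N &
        (B' + (t < 0)%R = B + (t - a < 0)%R + n * (a < 0)%R)%N]) ->
  chain sg A B -> chain sg' A' B'.
Proof.
move=> H [d [c [[d0 ch] cq cl [cA cB] ct]]].
have [a_sg AE BE] := H _ ct.
have a0 : al * c@_(top d) != 0.
  by move: a_sg; case: sg' {H} => h; rewrite ?(gt_eqF h) ?(lt_eqF h).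
have [c'h c'q c'l c't cnt] := chain_move d0 ch cq cl a0.
exists d.+1, (c * 'X_[U_(ord_max)] + (al * c@_(top d)) *: ('X_[top d] * spoly)); split => //.
- split; apply/eqP.
    by rewrite -(eqn_add2r (0 < c@_(top d))%R) [X in X == _]cnt ?ltxx // AE -cA.
  by rewrite -(eqn_add2r (c@_(top d) < 0)%R) [X in X == _]cnt ?ltxx // BE -cB.
- by rewrite c't.
Qed.

(** The ratio a / t selects the move: 1/2 keeps the sign of t - a, 1 cancels that coefficient, 2
    reverses its sign, and -1 makes the n new coefficients negative. *)
Lemma chain_add A B : chain true A B -> chain true (A + n) B.
Proof.
apply: (@chain_step _ _ _ _ _ _ (1 / 2)) => t t0 a.
have [a0 ta] : 0 < a /\ 0 < t - a by rewrite /a; split; lra.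
rewrite a0 ta t0 (lt_gtF a0) (lt_gtF ta) (lt_gtF t0); split => //; lia.
Qed.

Lemma chain_add_pred A B : chain true A B -> chain true (A + n.-1) B.
Proof.
apply: (@chain_step _ _ _ _ _ _ 1) => t t0 a.
have [a0 ta] : 0 < a /\ t - a = 0 by rewrite /a; split; lra.
rewrite a0 ta ltxx t0 (lt_gtF a0) (lt_gtF t0); split => //; lia.
Qed.

Lemma chain_add_pred1 A B : chain true A B -> chain true (A + n.-1) B.+1.
Proof.
apply: (@chain_step _ _ _ _ _ _ 2) => t t0 a.
have [a0 ta] : 0 < a /\ t - a < 0 by rewrite /a; split; lra.
rewrite a0 ta (lt_gtF ta) t0 (lt_gtF a0) (lt_gtF t0); split => //; lia.
Qed.

Lemma chain_flip A B : chain true A B -> chain false A (B + n).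
Proof.
apply: (@chain_step _ _ _ _ _ _ (-1)) => t t0 a.
have [a0 ta] : a < 0 /\ 0 < t - a by rewrite /a; split; lra.
rewrite a0 ta (lt_gtF ta) t0 (lt_gtF a0) (lt_gtF t0); split => //; lia.
Qed.

Lemma chain_neg A B : chain false A B -> chain false A (B + n).
Proof.
apply: (@chain_step _ _ _ _ _ _ (1 / 2)) => t t0 a.
have [a0 ta] : a < 0 /\ t - a < 0 by rewrite /a; split; lra.
rewrite a0 ta (lt_gtF ta) t0 (lt_gtF a0) (lt_gtF t0); split => //; lia.
Qed.

(** Write B - 1 = e + i n with e < n. From s, make e moves adding (n - 1, 1), then complete A by
    steps n and n - 1, and finally add n negative coefficients i times. The hypothesis leaves at
    least (n - 1)(n - 2) for the middle phase. *)
Lemma chain_exists A B : (0 < B)%N -> (n + n.-1 * n.-1 + n.-1 * (n - 2) <= A)%N ->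
  exists sg, chain sg A B.
Proof.
move=> B0 An.
pose e := (B.-1 %% n)%N; pose i := (B.-1 %/ n)%N.
pose X := (A - n - e * n.-1)%N.
have en : (e <= n.-1)%N by rewrite -ltnS prednK // ltn_mod.
have ce f : chain true (n + f * n.-1) (1 + f).
  elim: f => [|f IH]; first by rewrite mul0n !addn0; exact: chain_start.
  by rewrite addnS mulSnr addnA; exact: chain_add_pred1.
have cb f b : chain true (n + f * n.-1 + b * n) (1 + f).
  elim: b => [|b IH]; first by rewrite addn0.
  by rewrite mulSnr addnA; exact: chain_add.
have ca f b a : chain true (n + f * n.-1 + b * n + a * n.-1) (1 + f).
  elim: a => [|a IH]; first by rewrite addn0.
  by rewrite mulSnr addnA; exact: chain_add_pred.
have [a [b XE]] : exists a b, (X = b * n + a * n.-1)%N.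
  have eX : (e * n.-1 <= n.-1 * n.-1)%N by rewrite leq_mul2r en orbT.
  have Xn : (n.-1 * (n - 2) <= X)%N by rewrite /X; lia.
  have [n1|n1] := leqP n 1.
    have n1' : n = 1%N by lia.
    by exists 0%N, X; rewrite mul0n addn0 [X in (_ * X)%N]n1' muln1.
  have n10 : (0 < n.-1)%N by lia.
  (* X = q (n - 1) + b = b n + (q - b)(n - 1), and b is at most n - 2, which is at most q. *)
  pose b := (X %% n.-1)%N; pose q := (X %/ n.-1)%N.
  have XE : (X = q * n.-1 + b)%N by exact: divn_eq.
  have bn : (b < n.-1)%N by rewrite ltn_mod.
  have qb : (b <= q)%N.
    have : (n - 2 <= q)%N by rewrite leq_divRL // mulnC.
    by lia.
  exists (q - b)%N, b; rewrite XE mulnBl.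
  have -> : (b * n = b * n.-1 + b)%N by rewrite -mulnSr prednK.
  have : (b * n.-1 <= q * n.-1)%N by rewrite leq_mul2r qb orbT.
  by lia.
have AE : A = (n + e * n.-1 + b * n + a * n.-1)%N.
  have eX : (e * n.-1 <= n.-1 * n.-1)%N by rewrite leq_mul2r en orbT.
  by rewrite /X in XE; lia.
have cA : chain true A (1 + e) by rewrite AE; exact: ca.
have BE : B = (1 + e + i * n)%N.
  have := divn_eq B.-1 n; rewrite -/i -/e; lia.
rewrite BE; case: (i) => [|k]; first by exists true; rewrite addn0.
exists false; elim: k => [|k IH]; first by rewrite mul1n; exact: chain_flip.
by rewrite [(k.+2 * n)%N]mulSnr addnA; exact: chain_neg.
Qed.

Lemma coef_countN (Q : pred R) (c : P) :
  coef_count Q (- c) = coef_count (fun x => Q (- x)) c.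
Proof.
rewrite /coef_count (permP (msuppN c)); apply: eq_count => m /=.
by rewrite mcoeffN.
Qed.

(* Two blocks with disjoint supports: a fixed one with a large power of x_{n+1},
   and x_1^{d-1} s. Both pure powers x_1^d and x_{n+1}^d occur. *)
Lemma unbounded_family A B k : (0 < B)%N ->
  (n + n.-1 * n.-1 + n.-1 * (n - 2) <= A)%N ->
  exists d (c : P), [/\ (k <= d)%N /\ c \is d.-homog, exists q, c = spoly * q,
    c@_(last d) != 0, c@_(top d) != 0 & npos c = (A + n)%N /\ nneg c = B.+1].
Proof.
move=> B0 An; have [sg [d0 [c0 [[d00 ch] [q cq] cl [cA cB] _]]]] := chain_exists B0 An.
(* Exponents of x_{n+1} are at least 2 in the first block and at most 1 in the second; [f] equalizes
   the degrees, and k makes them large. *)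
pose e := (k + 2)%N; pose f := (d0.-1 + e)%N; pose d := f.+1.
have dE : d = (d0 + e)%N by rewrite /d /f -addSn prednK.
pose c : P := c0 * 'X_[last e] + spoly * 'X_[top f].
have lastmax a : last a ord_max = a by rewrite mulmnE mnm1E eqxx mul1n.
have topmax a : top a ord_max = 0%N by rewrite mulmnE mnm1E (negPf ord0_max).
have supp1 m : m \in msupp (c0 * 'X_[last e]) -> (1 < m ord_max)%N.
  rewrite (perm_mem (msuppMX _ _)) => /mapP[l _ ->].
  by rewrite mnmDE lastmax /e; lia.
have supp2 m : m \in msupp (spoly * 'X_[top f]) -> (m ord_max <= 1)%N.
  rewrite (perm_mem (msuppMX _ _)) => /mapP[l ls ->]; rewrite mnmDE topmax add0n.
  have := dhomog_mf spoly_homog ls; rewrite /= mdegE (bigD1 ord_max) //= => <-.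
  exact: leq_addr.
have dis m : m \in msupp (c0 * 'X_[last e]) -> m \notin msupp (spoly * 'X_[top f]).
  by move=> /supp1 m1; apply/negP => /supp2; rewrite leqNgt m1.
exists d, c; split.
- split; first by rewrite dE /e; lia.
  rewrite /c rpredD //.
    by rewrite dE; apply: dhomogM => //; rewrite dhomogX; apply/eqP; rewrite /= mdegMn mdeg1 mul1n.
  rewrite -[d]add1n; apply: dhomogM; first exact: spoly_homog.
  by rewrite dhomogX; apply/eqP; rewrite /= mdegMn mdeg1 mul1n.
- by exists (q * 'X_[last e] + 'X_[top f]); rewrite /c cq [RHS]mulrDr mulrA.
- have -> : last d = (last e + last d0)%MM.
    by rewrite dE; apply/mnmP => j; rewrite mnmDE !mulmnE -mulnDr addnC.
  rewrite mcoeffD mcoeffMX [X in _ + X]memN_msupp_eq0 ?addr0 //.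
  by apply: dis; rewrite mcoeff_msupp mcoeffMX.
- rewrite mcoeffD memN_msupp_eq0 ?add0r; last by apply/negP => /supp1; rewrite topmax.
  have -> : top d = (top f + U_(ord0))%MM by rewrite /d /top mulmSr.
  rewrite mcoeffMX mcoeffB (raddf_sum (mcoeff _)) (bigD1 (Ordinal n_gt0)) //= big1 => [|j j0].
    rewrite !mcoeffX !eq_mnm1 [ord_max == _]eq_sym (negPf ord0_max).
    by rewrite (_ : fin_var _ == ord0 = true) ?subr0 ?addr0 ?oner_neq0.
  rewrite mcoeffX eq_mnm1 (_ : fin_var _ == ord0 = false) //.
  by rewrite -val_eqE /=; apply: negPf; move: j0; rewrite -val_eqE.
- have [sn s1] := spoly_count.
  rewrite /npos /nneg !(coef_countD _ dis) !coef_countMX.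
  by rewrite -/(npos c0) -/(npos spoly) -/(nneg c0) -/(nneg spoly) cA cB sn s1 addn1.
Qed.

End Chain.

(** * Diagonal Hermitian polynomials and their restriction to curves *)

Section Diagonal.
Variables (R : realType) (N : nat).
Local Notation C := (R[i]).

(* The Hermitian polynomial with diagonal coefficient matrix obtained from c by
   the substitution x_j = |z_j|^2. *)
Definition diagp (c : {mpoly R[N]}) : hpoly R N :=
  mmap (@mpolyC (N + N) C \o real_complex R)
    (fun j => 'X_(lshift N j) * 'X_(rshift N j)) c.

HB.instance Definition _ := GRing.RMorphism.copy diagp diagp.

Lemma diagpZ a c : diagp (a *: c) = (real_complex R a) *: diagp c.
Proof. by rewrite /diagp mmapZ /= mul_mpolyC. Qed.

Lemma diagpX m : diagp 'X_[m] = 'X_[mnm_pair m m].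
Proof.
rewrite mpolyX_pair /diagp /liftl /liftr !mmapX /mmap1 -big_split.
by apply: eq_bigr => j _; rewrite exprMn.
Qed.

Lemma hcoef_diagp c a b : hcoef (diagp c) a b = if a == b then real_complex R c@_a else 0.
Proof.
have -> : diagp c = \sum_(m <- msupp c) (real_complex R c@_m) *: 'X_[mnm_pair m m].
  rewrite [c in LHS]mpolyE (raddf_sum diagp); apply: eq_bigr => m _ /=.
  by rewrite diagpZ diagpX.
rewrite hcoef_sum; under eq_bigr do rewrite hcoefZ hcoefX.
have [->|ab] := eqVneq a b; last first.
  rewrite big1 // => m _; case: eqP => [->|_]; last by rewrite mulr0.
  by rewrite (negPf ab) mulr0.
under eq_bigr do rewrite andbb.
have [bc|bc] := boolP (b \in msupp c).
  rewrite (bigD1_seq b) ?msupp_uniq //= eqxx mulr1 big1 ?addr0 // => m /negPf ->.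
  by rewrite mulr0.
rewrite (memN_msupp_eq0 bc) rmorph0 big_seq big1 // => m mc.
by case: eqP => [mb|_]; [rewrite -mb mc in bc|rewrite mulr0].
Qed.

Lemma conj_real_complex (x : R) : (real_complex R x)^* = real_complex R x.
Proof. by apply: conj_Creal; rewrite complex_real. Qed.

Lemma diagp_hermitian c : hermitian_symmetric (diagp c).
Proof.
move=> a b; rewrite !hcoef_diagp [b == a]eq_sym.
by case: eqP => [->|_]; rewrite ?conj_real_complex ?conjC0.
Qed.

Lemma diagp_bihomogeneous c d : c \is d.-homog -> bihomogeneous d (diagp c).
Proof.
move=> cd a b; rewrite hcoef_diagp; have [<-|_] := eqVneq a b; last by rewrite eqxx.
move=> ca; suff ad : mdeg a = d by [].
apply: (dhomog_mf cd); rewrite mcoeff_msupp; apply: contraNneq ca => ->.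
by rewrite rmorph0.
Qed.

Lemma diagp_signature c : signature_pair (diagp c) =
  (coef_count (fun x => 0 < x) c, coef_count (fun x => x < 0) c).
Proof.
pose T : finType := 'X_{1..N < msize (diagp c)}.
pose d : 'rV[C]_#|T| := \row_i real_complex R c@_(enum_val i : T).
have ME : coef_matrix (diagp c) = invmx 1%:M *m diag_mx d *m 1%:M.
  rewrite invmx1 mulmx1 mul1mx; apply/matrixP => i j; rewrite !mxE hcoef_diagp.
  rewrite -[_ == _ :> 'X_{1..N}]/(_ == _ :> T) (inj_eq enum_val_inj).
  by case: eqP => // _; rewrite mulr1n.
have pe := eigenvalues_diag (unitmx1 _ _) ME.
have small m : m \in msupp c -> (mdeg m < msize (diagp c))%N.
  move=> mc; have [] := @hcoef_small R N (diagp c) m m; last by [].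
  rewrite hcoef_diagp eqxx; apply: contraTneq mc => /eqP.
  by rewrite fmorph_eq0 => /eqP mc; rewrite mcoeff_msupp mc eqxx.
have cnt (P : pred C) (Q : pred R) : (forall x, P (real_complex R x) = Q x) -> Q 0 = false ->
    count P (eigenvalues (coef_matrix (diagp c))) = coef_count Q c.
  move=> PQ Q0; rewrite (permP pe) (count_map (fun i => d 0 i)) /coef_count -!size_filter.
  rewrite -(size_map (fun i => val (enum_val i : T))); apply/perm_size/uniq_perm.
  - rewrite map_inj_uniq; first exact/filter_uniq/enum_uniq.
    by move=> i j /val_inj; exact: enum_val_inj.
  - exact/filter_uniq/msupp_uniq.
  move=> m; rewrite mem_filter; apply/mapP/andP => [[i0]|[Qm mc]].
    rewrite mem_filter /= mxE PQ => /andP[Qi _] ->; split=> //.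
    by rewrite mcoeff_msupp; apply: contraTneq Qi => ->; rewrite Q0.
  exists (enum_rank (BMultinom (small _ mc))); last by rewrite enum_rankK.
  by rewrite mem_filter /= mxE enum_rankK PQ Qm mem_enum.
rewrite /signature_pair; congr (_, _); apply: cnt; rewrite ?ltxx // => x.
  by rewrite -(rmorph0 (real_complex R)) ltcR.
by rewrite -(rmorph0 (real_complex R)) ltcR.
Qed.

(** Only z stays formal: each monomial of [p] contributes a scalar times z^a with |a| = m. *)
Lemma hval_bihomogeneous_coef (p : hpoly R N) (m : nat) (h : 'I_N -> {poly C}) k :
  bihomogeneous m p ->
  (mmap (fun a => (a%:MP_[N])%:P) (fun i => match split i with
     | inl j => ('X_j)%:P | inr j => map_poly (@mpolyC N C) (h j) end) p
   : {poly {mpoly C[N]}})`_k \is m.-homog.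
Proof.
move=> pm; rewrite /mmap coef_sum big_seq rpred_sum // => l lp.
have [a [b lE]] := mnm_pair_surj l.
have [am _] : mdeg a = m /\ mdeg b = m.
  by apply: pm; rewrite /hcoef -lE -mcoeff_msupp.
rewrite lE /mmap1 big_split_ord /=.
rewrite (eq_bigr (fun j => ('X_j ^+ a j)%:P)) => [|j _]; last first.
  by rewrite (unsplitK (inl j)) mnm_pair_lshift polyC_exp.
rewrite -(rmorph_prod (@polyC {mpoly C[N]})) -mpolyXE_id.
rewrite (eq_bigr (fun j => map_poly (@mpolyC N C) (h j ^+ b j))) => [|j _]; last first.
  by rewrite (unsplitK (inr j)) mnm_pair_rshift rmorphXn.
rewrite -(rmorph_prod (map_poly (@mpolyC N C))) coefCM coefCM coef_map /=.
rewrite mul_mpolyC; apply: rpredZ; rewrite mulrC mul_mpolyC; apply: rpredZ.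
by rewrite dhomogX; apply/eqP.
Qed.

End Diagonal.

Lemma mmap_single (R : nzRingType) (T : comNzRingType) (f : {rmorphism R -> T}) (N d : nat)
    (c : {mpoly R[N]}) (j : 'I_N) (s : T) : c \is d.-homog ->
  mmap f (fun l => if l == j then s else 0) c = f c@_(U_(j) *+ d) * s ^+ d.
Proof.
move=> cd; pose m0 : 'X_{1..N} := (U_(j) *+ d)%MM.
have m0E : mmap1 (fun l => if l == j then s else 0) m0 = s ^+ d.
  rewrite /mmap1 (bigD1 j) //= eqxx mulmnE mnm1E eqxx mul1n big1 ?mulr1 // => l lj.
  by rewrite (negPf lj) mulmnE mnm1E eq_sym (negPf lj) mul0n expr0.
have mE m : m \in msupp c -> m != m0 -> mmap1 (fun l => if l == j then s else 0) m = 0.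
  move=> mc mm0; have [l lj ml] : exists2 l, l != j & m l != 0%N.
    apply: contrapT => H; case/eqP: mm0; apply/mnmP => l.
    have ml i : i != j -> m i = 0%N.
      by move=> ij; apply: contrapT => /eqP mi; apply: H; exists i.
    rewrite mulmnE mnm1E; have [<-|jl] := eqVneq j l; last by rewrite mul0n ml // eq_sym.
    have := dhomog_mf cd mc; rewrite /= mdegE (bigD1 j) //= big1 ?addn0 => [->|i /ml //].
    by rewrite mul1n.
  by rewrite /mmap1 (bigD1 l) //= (negPf lj) expr0n (negPf ml) mul0r.
rewrite /mmap; have [m0c|m0c] := boolP (m0 \in msupp c).
  rewrite (bigD1_seq m0) ?msupp_uniq //= m0E big_seq_cond big1 ?addr0 // => m /andP[mc mm0].
  by rewrite mE // mulr0.
rewrite (memN_msupp_eq0 m0c) rmorph0 mul0r big_seq big1 // => m mc.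
by rewrite mE ?mulr0 //; apply: contraNneq m0c => <-.
Qed.

Lemma lowest_coef (S : comNzRingType) (u v : S) (a b p q : {poly S}) k :
  u%:P * a * p = v%:P * b * q -> (forall l, (l < k)%N -> a`_l = 0) ->
  u * (a`_k * p`_0) = v * (b * q)`_k.
Proof.
move=> E a0; have := congr1 (fun r : {poly S} => r`_k) E.
rewrite /= -!mulrA !coefCM => <-; congr (_ * _).
rewrite coefM big_ord_recr /= big1 => [|l _]; last by rewrite a0 ?mul0r.
by rewrite add0r subnn.
Qed.

Lemma scale_monomial (F : fieldType) (N d : nat) (a b s : F) (u x : {mpoly F[N]}) :
  (a * b * s ^+ d) *: (u * x ^+ d) = u * (a%:MP * (b%:MP * (x * s%:MP) ^+ d)).
Proof.
by rewrite !mul_mpolyC [x * _]mulrC mul_mpolyC exprZn -!scalerAr !scalerA.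
Qed.

(** * Lower bound for the projective degree *)

Section LowerBound.
Variables (R : realType) (N : nat).
Local Notation C := (R[i]).
Local Notation P := {mpoly C[N]}.

Let spec (g : 'I_N -> {poly C}) (p : hpoly R N) : {poly P} :=
  mmap (fun a => (a%:MP_[N])%:P) (fun i => match split i with
     | inl j => ('X_j)%:P | inr j => map_poly (@mpolyC N C) (g j) end) p.

Let specM g p q : spec g (p * q) = spec g p * spec g q.
Proof. exact: (rmorphM (mmap (polyC \o @mpolyC N C) _)). Qed.

Let spec_liftl g f : spec g (liftl f) = f%:P.
Proof.
rewrite /spec /liftl (rmorph_mmap (@mpolyC (N + N) C) (mmap (polyC \o @mpolyC N C) _)).
transitivity (polyC (mmap (@mpolyC N C) (fun j => 'X_j) f)); last first.
  by congr polyC; apply: mpoly_ext => v; rewrite meval_mmap; apply: meval_eq => j; rewrite mevalXU.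
rewrite (rmorph_mmap (@mpolyC N C) (@polyC P)); apply: eq_mmap => [a|j] /=.
  by rewrite mmapC.
by rewrite mmapX mmap1U (unsplitK (inl j)).
Qed.

Let spec_liftr g f : spec g (liftr f) = map_poly (@mpolyC N C) (mmap (@polyC C) g f).
Proof.
rewrite /spec /liftr (rmorph_mmap (@mpolyC (N + N) C) (mmap (polyC \o @mpolyC N C) _)).
rewrite (rmorph_mmap (@polyC C) (map_poly (@mpolyC N C))); apply: eq_mmap => [a|j] /=.
  by rewrite mmapC /= map_polyC.
by rewrite mmapX mmap1U (unsplitK (inr j)).
Qed.

Let spec_sq g f r : spec g (liftl f * liftr (conjp f) * r) =
  f%:P * map_poly (@mpolyC N C) (mmap (@polyC C) g (conjp f)) * spec g r.
Proof.
apply: etrans (specM _ _ _) _; congr (_ * _); apply: etrans (specM _ _ _) _.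
by congr (_ * _); [exact: spec_liftl|exact: spec_liftr].
Qed.

Let spec_diagp0 (c : {mpoly R[N]}) d j (s : C) (a : 'I_N -> C) : c \is d.-homog ->
  (spec (fun l => if l == j then s%:P else (a l)%:P * 'X) (diagp c)).[0] =
  (real_complex R c@_(U_(j) *+ d))%:MP * ('X_j * s%:MP) ^+ d.
Proof.
move=> cd; set g := fun l : 'I_N => _.
rewrite -(mmap_single (@mpolyC N C \o real_complex R) _ _ cd).
rewrite -/(horner_eval 0 _) /spec /diagp.
rewrite (rmorph_mmap (@mpolyC (N + N) C \o real_complex R) (mmap (polyC \o @mpolyC N C) _)).
rewrite (rmorph_mmap _ (horner_eval (0 : P))).
apply: eq_mmap => [x|l] /=; first by rewrite mmapC /= /horner_eval hornerC.
rewrite (rmorphM (mmap (polyC \o @mpolyC N C) _)) /= !mmapX !mmap1U.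
rewrite (unsplitK (inl l)) (unsplitK (inr l)) /horner_eval hornerM hornerC /g.
case: eqP => [->|_]; first by rewrite map_polyC /= hornerC.
by rewrite rmorphM /= map_polyC map_polyX /= hornerM hornerX mulr0 mulr0.
Qed.

Lemma hequiv_polarized (p q : hpoly R N) (u v : P) :
  (forall z, `|u.@[z]| ^+ 2 * heval p z = `|v.@[z]| ^+ 2 * heval q z) ->
  liftl u * liftr (conjp u) * p = liftl v * liftr (conjp v) * q.
Proof.
move=> H; apply/eqP; rewrite -subr_eq0; apply/eqP; apply: polarization => z.
rewrite hevalE hvalB; apply/eqP; rewrite subr_eq0; apply/eqP.
have E (f : P) (r : hpoly R N) :
    hval (liftl f * liftr (conjp f) * r) z (fun j => (z j)^*) = `|f.@[z]| ^+ 2 * heval r z.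
  rewrite hevalE hvalM; congr (_ * _); rewrite hvalM normCK; congr (_ * _).
    exact: hval_liftl.
  rewrite hval_liftr meval_conjp; congr (_^*); apply: meval_eq => j.
  by rewrite conjCK.
by rewrite !E.
Qed.

(* Restrict w to a curve through a multiple of e_j, and compare the lowest-order
   coefficients on the curve. *)
Lemma hequiv_power (c : {mpoly R[N]}) d m (q : hpoly R N) (u v : P) j :
  c \is d.-homog -> bihomogeneous m q -> c@_(U_(j) *+ d) != 0 -> u != 0 ->
  liftl u * liftr (conjp u) * diagp c = liftl v * liftr (conjp v) * q ->
  exists (k : C) (h : P), [/\ k != 0, h \is m.-homog & k *: (u * 'X_[U_(j) *+ d]) = v * h].
Proof.
move=> cd qm cj u0 E.
have [pt] : exists pt, (conjp u * 'X_j).@[pt] != 0.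
  apply: mpoly_neq0P; apply/eqP => /mpolyM_eq0; rewrite conjp_eq0 => /(_ u0)/eqP.
  by rewrite -msize_poly_eq0 msizeX mdeg1.
rewrite mevalM mevalXU mulf_eq0 negb_or => /andP[upt ptj].
(* The curve joins pt_j e_j at parameter 0 to [pt] at 1. The conjugate of u may vanish at the former
   but not at the latter, so it has a finite order k at 0. *)
pose g l : {poly C} := if l == j then (pt j)%:P else (pt l)%:P * 'X.
pose uh := mmap (@polyC C) g (conjp u).
have uh0 : uh != 0.
  apply: contraNneq upt => uh0; have := horner_mmap g (conjp u) 1.
  rewrite -/uh uh0 horner0 => ->; apply/eqP; apply: meval_eq => l; rewrite /g.
  by have [->|_] := eqVneq l j; rewrite ?hornerC // hornerM hornerC hornerX mulr1.
have exk : exists k, uh`_k != 0 by exists (size uh).-1; rewrite -lead_coefE lead_coef_eq0.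
case: (ex_minnP exk) => k uhk kmin.
have EE := etrans (esym (spec_sq g u _)) (etrans (congr1 (spec g) E) (spec_sq g v _)).
pose h : P := (map_poly (@mpolyC N C) (mmap (@polyC C) g (conjp v)) * spec g q)`_k.
exists (uh`_k * real_complex R c@_(U_(j) *+ d) * pt j ^+ d), h; split.
- apply: mulf_neq0; last exact: expf_neq0.
  by apply: mulf_neq0; [exact: uhk|rewrite fmorph_eq0; exact: cj].
- rewrite /h coefM; apply: rpred_sum => l _.
  rewrite coef_map /= mul_mpolyC; apply: rpredZ.
  exact: hval_bihomogeneous_coef.
have az l : (l < k)%N -> (map_poly (@mpolyC N C) uh)`_l = 0.
  move=> lk; rewrite coef_map /=; suff -> : uh`_l = 0 by exact: mpolyC0.
  by apply/eqP; apply: contraLR lk => ul; rewrite -leqNgt kmin.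
apply: etrans (lowest_coef EE az); rewrite -horner_coef0 (spec_diagp0 _ _ _ cd) coef_map.
by rewrite -mpolyXn; exact: scale_monomial.
Qed.

(** From k1 u x_j1^d = v h1 and k2 u x_j2^d = v h2 one finds that h1 x_j2^d and h2 x_j1^d are
    proportional. Hence x_j1^d divides h1, whose degree is m. *)
Lemma diagp_projective_degree (c : {mpoly R[N]}) d j1 j2 :
  c \is d.-homog -> j1 != j2 -> c@_(U_(j1) *+ d) != 0 -> c@_(U_(j2) *+ d) != 0 ->
  (d <= projective_degree (diagp c))%N.
Proof.
move=> cd j12 c1 c2.
have [[q [_ qm [u [v [u0 v0 E]]]]] _] :=
  projective_degreeP (diagp_hermitian c) (diagp_bihomogeneous cd).
have {}E := hequiv_polarized E.
have [k1 [h1 [k10 hh1 E1]]] := hequiv_power cd qm c1 u0 E.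
have [k2 [h2 [k20 hh2 E2]]] := hequiv_power cd qm c2 u0 E.
have EE : k2 *: (h1 * 'X_[U_(j2) *+ d]) = k1 *: (h2 * 'X_[U_(j1) *+ d]).
  have /mpolyM_eq0/(_ v0)/eqP : v * (k2 *: (h1 * 'X_[U_(j2) *+ d]) -
      k1 *: (h2 * 'X_[U_(j1) *+ d])) = 0.
    rewrite mulrBr -!scalerAr !mulrA -E1 -E2 -!scalerAl !scalerA [k1 * k2]mulrC.
    by rewrite mulrAC subrr.
  by rewrite subr_eq0 => /eqP.
have h10 : h1 != 0.
  apply/eqP => h10; move: E1; rewrite h10 mulr0 => /eqP; rewrite scaler_eq0 (negPf k10) /=.
  move=> /eqP/mpolyM_eq0/(_ u0)/eqP.
  by rewrite -msize_poly_eq0 msizeX.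
have muh := mlead_supp h10; set mu := mlead h1 in muh.
have := congr1 (mcoeff (U_(j2) *+ d + mu)%MM) EE.
rewrite mcoeffZ mcoeffMX mcoeffZ => EM.
have : (U_(j2) *+ d + mu)%MM \in msupp (h2 * 'X_[U_(j1) *+ d]).
  rewrite mcoeff_msupp; apply/eqP => H; move/eqP: EM; rewrite H mulr0 mulf_eq0 (negPf k20) /=.
  by apply/negP; rewrite -mcoeff_msupp.
rewrite (perm_mem (msuppMX _ _)) => /mapP[nu _ /mnmP/(_ j1)].
rewrite !mnmDE !mulmnE !mnm1E eqxx eq_sym (negPf j12) mul0n add0n mul1n => muE.
have <- := dhomog_mf hh1 muh.
by rewrite /= mdegE (bigD1 j1) //= muE -addnA leq_addr.
Qed.

End LowerBound.

Local Open Scope classical_set_scope.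

(** * Assembling the five assertions *)

Section Final.
Variables (R : realType) (n : nat).
Hypothesis n2 : (2 <= n)%N.
Local Notation C := (R[i]).
Local Notation HI A B := (@Hset R n A B `&` Iset (rpoly R n)).

Let n_gt0 : (0 < n)%N := ltnW n2.

Lemma diagp_spoly : diagp (spoly R n) = rpoly R n.
Proof.
have E j : diagp ('X_j : {mpoly R[n.+1]}) = 'X_(lshift n.+1 j) * 'X_(rshift n.+1 j).
  by rewrite /diagp mmapX mmap1U.
rewrite /spoly /rpoly (raddfB (@diagp R n.+1)) (raddf_sum (@diagp R n.+1)).
by congr (_ - _); [apply: eq_bigr => j _|]; exact: E.
Qed.

Lemma diagp_multiple (c : {mpoly R[n.+1]}) d A B : c \is d.-homog ->
  (exists q, c = spoly R n * q) -> npos c = A -> nneg c = B -> HI A B (diagp c).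
Proof.
move=> cd [q cq] cA cB; split; first split.
- exact: diagp_hermitian.
- by exists d; exact: diagp_bihomogeneous.
- by rewrite diagp_signature -cA -cB.
split; first exact: diagp_hermitian.
exists (diagp q); rewrite -diagp_spoly cq; exact: (rmorphM (@diagp R n.+1)).
Qed.

Lemma diagp_multipleN (c : {mpoly R[n.+1]}) d A B : c \is d.-homog ->
  (exists q, c = spoly R n * q) -> npos c = A -> nneg c = B -> HI B A (diagp (- c)).
Proof.
move=> cd [q cq] cA cB; apply: (@diagp_multiple _ d).
- by rewrite rpredN.
- by exists (- q); rewrite cq mulrN.
- rewrite -cB /npos coef_countN; apply: eq_count => m /=.
  by rewrite oppr_gt0.
- rewrite -cA /nneg coef_countN; apply: eq_count => m /=.
  by rewrite oppr_lt0.
Qed.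

Lemma HI_nonempty A B : (0 < B)%N -> (n + n.-1 * n.-1 + n.-1 * (n - 2) <= A)%N ->
  HI A B !=set0 /\ HI B A !=set0.
Proof.
move=> B0 An; have [sg [d [c [[_ ch] cq _ [cA cB] _]]]] := chain_exists R n_gt0 B0 An.
split; first by exists (diagp c); exact: diagp_multiple ch cq cA cB.
by exists (diagp (- c)); exact: diagp_multipleN ch cq cA cB.
Qed.

Lemma HI_hsum A B p : HI A B p ->
  exists m (lam : 'I_(A + B) -> C) (F : 'I_(A + B) -> {mpoly C[n.+1]}),
    [/\ forall i, F i \is m.-homog, p = hsum lam F &
        forall i : 'I_(A + B), if (i < A)%N then 0 < lam i else lam i < 0].
Proof.
move=> [[hp [m bp] sp] _].
by have [lam [F H]] := signature_hsum hp bp sp; exists m, lam, F.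
Qed.

Lemma HI00 : HI 0%N 0%N = [set 0].
Proof.
apply/seteqP; split => [p /HI_hsum[m [lam [F [_ -> _]]]]|_ ->] /=.
  by rewrite /hsum big_ord0.
have h0 : hermitian_symmetric (0 : hpoly R n.+1).
  by move=> a b; rewrite /hcoef !mcoeff0 conjC0.
split; first split=> //.
- by exists 0%N => a b; rewrite /hcoef mcoeff0 eqxx.
- exact: signature0.
by split => //; exists 0; rewrite mulr0.
Qed.

Lemma HI_neq0 A B p : HI A B p -> (A + B != 0)%N -> p != 0.
Proof.
move=> [[_ _ sp] _] AB; apply: contraNneq AB => p0.
by move: sp; rewrite p0 signature0 => -[<- <-].
Qed.

Lemma HI_definite A B : A = 0%N \/ B = 0%N -> (A + B != 0)%N -> HI A B = set0.
Proof.
move=> AB0 AB; apply/seteqP; split => // p pAB.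
have /eqP := HI_neq0 pAB AB; apply.
have [m [lam [F [_ pE lamP]]]] := HI_hsum pAB; have Ip := proj2 pAB.
rewrite pE in Ip *; case: AB0 => E.
  apply: (definite_multiple_eq0 (s := -1)) => // k.
  by have := lamP k; rewrite ifN ?mulN1r ?oppr_gt0 // -leqNgt (leq_trans (eq_leq E)).
apply: (definite_multiple_eq0 (s := 1)) => // k.
have kA : (k < A)%N by have := ltn_ord k; lia.
by have := lamP k; rewrite kA mul1r.
Qed.

Lemma HI_rank A B p : HI A B p -> (A + B != 0)%N -> (n < A + B)%N.
Proof.
move=> pAB AB; have pn0 := HI_neq0 pAB AB; have Ip := proj2 pAB.
have [m [lam [F [Fh pE _]]]] := HI_hsum pAB.
by rewrite pE in Ip pn0; exact: hsum_rank Fh Ip pn0.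
Qed.

Lemma projective_degree_bound A B p : A = 1%N \/ B = 1%N -> HI A B p ->
  (projective_degree p <= (A + B) * ((A + B) * (A + B)).+1 * (2 * ((A + B) * (A + B))))%N.
Proof.
move=> AB1 pAB; have Ip := proj2 pAB.
have [[hp [m bp] _] _] := pAB.
have AB : (A + B != 0)%N by case: AB1 => ->; rewrite ?addn1.
have pn0 := HI_neq0 pAB AB.
have [d [lam [F [Fh pE lamP]]]] := HI_hsum pAB.
have lamr k : (lam k)^* = lam k.
  apply: conj_Creal; have := lamP k; case: ifP => _ h.
    by rewrite ger0_real // ltW.
  by rewrite ler0_real // ltW.
have [k0 [s sP]] : exists k0 s, forall k, k != k0 -> 0 < s * lam k.
  case: AB1 => E.
    have h0 : (0 < A + B)%N by rewrite lt0n.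
    exists (Ordinal h0), (-1) => k kk; have := lamP k; rewrite ifN ?mulN1r ?oppr_gt0 //.
    by move: kk; rewrite -val_eqE /= -leqNgt -lt0n => /(leq_trans (eq_leq E)).
  have hA : (A < A + B)%N by lia.
  exists (Ordinal hA), 1 => k kk; have := lamP k; rewrite ifT ?mul1r //.
  by move: kk; rewrite -val_eqE /= => /eqP kk; have := ltn_ord k; lia.
rewrite pE in Ip pn0 hp bp *.
(* If F_k0 were 0, p would be a definite multiple of r, hence 0. *)
have F0 : F k0 != 0.
  apply: contraNneq pn0 => F0; rewrite /hsum big1 // => k _.
  suff -> : F k = 0 by rewrite (_ : liftl 0 = 0) ?mul0r ?scaler0 //; exact: (raddf0 (mmap _ _)).
  have [->//|kk] := eqVneq k k0.
  apply: null_cone_dense n_gt0 => z zz; have := Iset_vanish Ip zz.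
  rewrite hval_hsum_diag (bigD1 k0) //= F0 meval0 mul0r mulr0 add0r => S0.
  exact: (sum_sq_eq0 (P := fun k => k != k0) sP S0 kk).
have [e [eb he]] := bounded_equiv_degree n_gt0 lamr sP Ip n2 F0 Fh.
by apply: leq_trans eb; have [_] := projective_degreeP hp bp; exact.
Qed.

Lemma HI_finite A B : A = 1%N \/ B = 1%N -> HI A B !=set0 ->
  sup_projective_degree (HI A B) \is a fin_num.
Proof.
move=> AB1 [p pAB]; rewrite fin_numE; apply/andP; split.
  rewrite -ltNye (lt_le_trans (ltNyr (projective_degree p)%:R)) //.
  by apply: ereal_sup_ubound; exists p.
pose b := ((A + B) * ((A + B) * (A + B)).+1 * (2 * ((A + B) * (A + B))))%N.
rewrite -ltey (le_lt_trans _ (ltry (b%:R : R))) //.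
apply: ge_ereal_sup => _ [q qAB <-].
by rewrite lee_fin ler_nat projective_degree_bound.
Qed.

Lemma HI_unbounded A B : (forall k, exists2 p, HI A B p & (k <= projective_degree p)%N) ->
  HI A B !=set0 /\ sup_projective_degree (HI A B) = +oo%E.
Proof.
move=> H; split; first by have [p pAB _] := H 0%N; exists p.
apply/eqyP => x x0; have [p pAB kp] := H (Num.truncn x).+1.
apply: le_ereal_sup_tmp; exists ((projective_degree p)%:R)%:E; first by exists p.
by rewrite lee_fin (le_trans (ltW (truncnS_gt x))) // ler_nat.
Qed.

Lemma HI_infinite A B : (0 < B)%N -> (n + n.-1 * n.-1 + n.-1 * (n - 2) <= A)%N ->
  (HI (A + n) B.+1 !=set0 /\ sup_projective_degree (HI (A + n) B.+1) = +oo%E) /\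
  (HI B.+1 (A + n) !=set0 /\ sup_projective_degree (HI B.+1 (A + n)) = +oo%E).
Proof.
move=> B0 An; split; apply: HI_unbounded => k;
  have [d [c [[kd ch] cq cl ct [cA cB]]]] := unbounded_family R n_gt0 k B0 An.
- exists (diagp c); first exact: diagp_multiple ch cq cA cB.
  apply: leq_trans kd _; exact: diagp_projective_degree ch (ord0_max n_gt0) ct cl.
- exists (diagp (- c)); first exact: diagp_multipleN ch cq cA cB.
  apply: leq_trans kd _; apply: diagp_projective_degree (ord0_max n_gt0) _ _.
  + by rewrite rpredN.
  + by rewrite mcoeffN oppr_eq0.
  + by rewrite mcoeffN oppr_eq0.
Qed.

End Final.

Theorem theorem8p2 (R : realType) (n : nat) (hn : (2 <= n)%N) :
  let M := (2 * (2 * n ^ 2 - n))%N in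
  let HI := fun A B : nat => @Hset R n A B `&` Iset (rpoly R n) in
  [/\ HI 0%N 0%N = [set 0],
      forall A B : nat,
        (A = 0%N \/ B = 0%N) /\ ~ (A = 0%N /\ B = 0%N) -> HI A B = set0,
      (forall A : nat, (A < n)%N -> HI A 1%N = set0) /\
      (forall B : nat, (B < n)%N -> HI 1%N B = set0),
      forall A B : nat,
        (A = 1%N /\ (M - 1 <= B)%N) \/ (B = 1%N /\ (M - 1 <= A)%N) ->
        HI A B !=set0 /\ sup_projective_degree (HI A B) \is a fin_num &
      forall A B : nat,
        (M <= A + B)%N -> (2 <= A)%N -> (2 <= B)%N ->
        HI A B !=set0 /\ sup_projective_degree (HI A B) = +oo%E].
Proof.
move=> M HI.
(* The larger of A and B is at least M / 2. It must exceed the threshold of [chain_exists] by n, the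
   number of positive coefficients in the second block of [unbounded_family]. The left side is 2 (2
   n^2 - 3 n + 3). *)
have Mn : (2 * (n + n.-1 * n.-1 + n.-1 * (n - 2) + n) <= M)%N.
  have [k nk] : exists k, n = k.+2 by exists n.-2; lia.
  by rewrite /M nk /= subSS subSS subn0 expnS expn1; nia.
split.
- exact: HI00.
- move=> A B [AB nAB]; apply: HI_definite => //.
  by apply/eqP => /eqP; rewrite addn_eq0 => /andP[/eqP A0 /eqP B0]; case: nAB.
- split=> [A An|B Bn]; apply/seteqP; split => // p pAB.
    by have := HI_rank pAB; rewrite addn1 => /(_ isT); rewrite ltnS leqNgt An.
  by have := HI_rank pAB; rewrite add1n => /(_ isT); rewrite ltnS leqNgt Bn.
- move=> A B AB.
  have AB1 : A = 1%N \/ B = 1%N by case: AB => -[]; [left|right].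
  have ne : HI A B !=set0.
    case: AB => -[-> h].
      by apply: (proj2 (HI_nonempty R hn _ _)) => //; lia.
    by apply: (proj1 (HI_nonempty R hn _ _)) => //; lia.
  by split => //; exact: HI_finite.
- move=> A B MAB A2 B2; have [le|le] := leqP B A.
    have -> : A = (A - n + n)%N by lia.
    have -> : B = B.-1.+1 by lia.
    by apply: (proj1 (HI_infinite R hn _ _)); lia.
  have -> : B = (B - n + n)%N by lia.
  have -> : A = A.-1.+1 by lia.
  by apply: (proj2 (HI_infinite R hn _ _)); lia.
Qed.
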